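(* Let $b$ be a fragmentation coefficient satisfying the following three hypotheses. (i) For all $x>0$, $b(x,\cdot)$ is a nonnegative measure on the interval $[0,x]$, and for all $\psi\in\mathcal{C}_0([0,+\infty))$ the function $x\mapsto\int_{[0,x]}b(x,y)\psi(y)\,dy$ is measurable. (ii) There exists $\kappa>1$ such that $\int_0^x b(x,y)\,dy=\kappa B(x)$ for all $x>0$, where $B(x):=\int_0^x\frac{y}{x}\,b(x,y)\,dy$. (iii) There exist $0<B_m<B_M$ and $0<\gamma<2$ such that $2B_m\,x^{\gamma-1}\le b(x,y)\le 2B_M\,x^{\gamma-1}$ for all $0<y<x$. Then for any $m$ with $1/2<m<1$ there exists $M$ with $1<M<2$ such that the operator $$Tg(x)=-x\,\partial_x g(x)-2g(x)+\int_x^\infty b(y,x)\,g(y)\,dy-B(x)\,g(x)\qquad(x>0)$$ has a spectral gap in the space $X:=L^1\big((0,\infty),(x^m+x^M)\,dx\big)$. More precisely, there exist $\alpha>0$ and a constant $C\ge 1$ such that, for all $g_{in}\in X$ with $\int_0^\infty x\,g_{in}(x)\,dx=1$, $$\|g_t-G\|_{X}\le C\,e^{-\alpha t}\,\|g_{in}-G\|_{X}\qquad(t\ge 0),$$ where $g_t$ is the solution of $\partial_t g_t=Tg_t$ with initial condition $g_0=g_{in}$, and $G$ is the self-similar profile, i.e. the unique stationary solution ($TG=0$) with $\int_0^\infty x\,G(x)\,dx=1$.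
   Context: The fragmentation coefficient $b(y,x)$ is defined for $y>x>0$. By hypothesis (iii), the measure $b(x,\cdot)$ has a density with respect to Lebesgue measure, denoted $b(x,y)$ for $0<y<x$. The norm of $X$ is $\|g\|_X=\int_0^\infty (x^m+x^M)\,|g(x)|\,dx$. Since $x\le x^m+x^M$ for $x>0$, one has $X\subset L^1((0,\infty),x\,dx)$, so $\int_0^\infty x\,g(x)\,dx$ is well defined for $g\in X$. The self-similar fragmentation equation is $$\partial_t g_t(x)=-x\,\partial_x g_t(x)-2g_t(x)+\int_x^\infty b(y,x)\,g_t(y)\,dy-B(x)\,g_t(x),\qquad g_0(x)=g_{in}(x)\qquad(x>0,\ t\ge0).$$ Its solution is the one given by the evolution semigroup associated with $T$, $g_t=e^{tT}g_{in}$, that is, the solution $g\in C([0,\infty);L^1((0,\infty),x\,dx))$ which conserves the total mass: $\int_0^\infty x\,g_t(x)\,dx=\int_0^\infty x\,g_{in}(x)\,dx$ for all $t\ge0$. The operator $T$ on $X$ is taken with a dense domain on which it is closed. The self-similar profile $G$ is the unique stationary solution of this equation with $\int_0^\infty x\,G(x)\,dx=1$. It is strictly positive, and its existence and uniqueness under hypotheses (i)-(iii) are known. ''Spectral gap'' in $X$ is understood in the sense of the exponential decay estimate stated in the claim. *)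

(* Defs.v *)
From HB Require Import structures.
From mathcomp Require Export all_boot all_order all_algebra.
From mathcomp Require Export all_classical all_reals all_analysis.
From mathcomp Require Export measurable_realfun.
Export Order.TTheory GRing.Theory Num.Theory.
Export numFieldNormedType.Exports.

Set Implicit Arguments.
Unset Strict Implicit.
Unset Printing Implicit Defensive.

Local Open Scope classical_set_scope.
Local Open Scope ring_scope.

Section SelfSimilarFragmentation.
Variable R : realType.

Local Notation leb := (@lebesgue_measure R).

Section Coefficient.
(* The fragmentation coefficient appears in two forms: [b x] is the measure
   b(x, .), and [beta x y] is its Lebesgue density b(x, y), 0 < y < x. *)
Variables (b : R -> {measure set (measurableTypeR R) -> \bar R})
          (beta : R -> R -> R).

Definition C0_halfline (psi : R -> R) : Prop :=
  {within `[0, +oo[%classic, continuous psi} /\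
  psi x @[x --> +oo] --> (0 : R).

Definition frag_measure : Prop :=
  (forall x, 0 < x -> b x (~` `[0, x]%classic) = 0%E) /\
  (forall psi, C0_halfline psi ->
     measurable_fun (`]0, +oo[%classic : set R)
       (fun x => \int[b x]_(y in `[0%R, x]) (psi y)%:E)%E).

Definition frag_rate (x : R) : R := \int[b x]_(y in `[0, x]) (y / x).

Definition frag_number : Prop :=
  exists kappa : R, 1 < kappa /\
    forall x, 0 < x -> b x `[0, x]%classic = (kappa * frag_rate x)%:E.

(* Joint measurability is what makes the gain term
   x |-> int_x^oo b(y, x) g(y) dy independent of the chosen versions of the
   densities b(y, .) and measurable in x. *)
Definition frag_density : Prop :=
  measurable_fun
    [set p : R * R | 0 < p.2 < p.1]
    (fun p => beta p.1 p.2) /\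
  (forall x, 0 < x -> forall A : set R, measurable A ->
     b x A = (\int[leb]_(y in A `&` `]0%R, x[) (beta x y)%:E)%E).

Definition frag_bounds : Prop :=
  exists Bm BM gamma : R,
    [/\ 0 < Bm < BM, 0 < gamma < 2 &
        forall x y, 0 < y < x ->
          2 * Bm * x `^ (gamma - 1) <= beta x y <= 2 * BM * x `^ (gamma - 1)].

Section WeightedL1.
(* Elements of X = L^1((0, oo), (x^m + x^M) dx) are represented by functions on
   R of which only the values on (0, oo), up to null sets, are relevant. *)
Variables m M : R.

Definition inX (g : R -> R) : Prop :=
  leb.-integrable `]0, +oo[%classic
    (fun x => ((x `^ m + x `^ M) * g x)%:E).

Definition normX (g : R -> R) : \bar R :=
  (\int[leb]_(x in `]0%R, +oo[) ((x `^ m + x `^ M) * `|g x|)%:E)%E.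

Definition eqX (f g : R -> R) : Prop :=
  {ae leb, forall x, 0 < x -> f x = g x}.

Definition test_function (phi : R -> R) : Prop :=
  [/\ forall x, derivable phi x 1,
      continuous (derive1 phi) &
      exists a c : R, 0 < a < c /\ forall x, ~~ (a <= x <= c) -> phi x = 0].

(* d is the distributional derivative of g on (0, oo); both are locally
   integrable where this is used. *)
Definition weak_derivative (g d : R -> R) : Prop :=
  forall phi, test_function phi ->
    \int[leb]_(x in `]0, +oo[) (g x * derive1 phi x) =
    - \int[leb]_(x in `]0, +oo[) (d x * phi x).

Definition frag_gain (g : R -> R) (x : R) : R :=
  \int[leb]_(y in `]x, +oo[) (beta y x * g y).

(* Graph of T in X x X: g is in the domain of T and h = T g. The domain consists
   of the g in X for which every term of T g lies in X. On it T is the closed,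
   densely defined generator of a C_0-semigroup; with larger domains the equation
   has spurious solutions, in which mass enters from x = oo. *)
Definition T_graph (g h : R -> R) : Prop :=
  inX g /\
  exists d : R -> R,
    [/\ weak_derivative g d,
        inX (fun x => x * d x),
        inX (frag_gain g),
        inX (fun x => frag_rate x * g x) &
        eqX h (fun x => - (x * d x) - 2 * g x + frag_gain g x
                        - frag_rate x * g x)].

Definition C0_semigroup (S : R -> (R -> R) -> R -> R) : Prop :=
  [/\ forall t f, 0 <= t -> inX f -> inX (S t f),
      forall t (a : R) f g, 0 <= t -> inX f -> inX g ->
        eqX (S t (fun x => a * f x + g x)) (fun x => a * S t f x + S t g x),
      forall t, 0 <= t -> exists K : R, forall f, inX f ->
        (normX (S t f) <= K%:E * normX f)%E,
      (forall f, inX f -> eqX (S 0 f) f) /\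
      (forall s t f, 0 <= s -> 0 <= t -> inX f ->
         eqX (S (s + t) f) (S s (S t f))) &
      forall f, inX f ->
        normX (fun x => S t f x - f x) @[t --> (0 : R)^'+] --> (0 : \bar R)].

(* S t = e^{tT}: S is a C_0-semigroup on X and its generator, domain included,
   is T. *)
Definition semigroup_of_T (S : R -> (R -> R) -> R -> R) : Prop :=
  C0_semigroup S /\
  forall f h, inX f -> inX h ->
    (normX (fun x => (S t f x - f x) / t - h x) @[t --> (0 : R)^'+]
       --> (0 : \bar R)) <-> T_graph f h.

Definition mass (g : R -> R) : R := \int[leb]_(x in `]0, +oo[) (x * g x).

Definition self_similar_profile (G : R -> R) : Prop :=
  T_graph G (fun=> 0) /\ mass G = 1.

End WeightedL1.
End Coefficient.
End SelfSimilarFragmentation.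

(* Main.v *)
Require Import Defs.
From mathcomp Require Import ring lra.

(** The proof is an infinitesimal form of the theorem of Harris, carried out
    on the generator T. Write W(x) = x^m + x^M; the choice M = 3/2 always
    works, as would any M strictly between 1 and 2. For a small eps > 0 put
    N(f) = int (x + eps W(x)) |f(x)| dx, a norm equivalent to the norm of X
    because x <= W(x). Three facts about T are combined.

    Confinement. Transport makes moments of order p grow at rate p - 1, which
    is negative for p = m. Fragmentation of clusters of size y produces
    moments of order p at a rate at most a constant times y^(gamma + p), and
    for p = M > 1 the production is smaller than the loss by c2 y^(gamma + M).
    Hence W is a Lyapunov function: along the flow int W |f| decreases at rate
    a int W |f| up to an error K int x |f| (moment_gt1, drift_lyapunov).

    Mixing. The weight x is neutral, since the total mass is conserved
    (mass_generator), so that int x |f| cannot grow. It even decreases when f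
    has mass zero and is mostly carried by a fixed interval [u, v]: every
    cluster with size in [u, v] produces fragments of each size below u with a
    rate bounded from below, and the common part of the fragments of positive
    and of negative clusters cancels (doeblin).

    Combination. Choosing [u, v] so that W(y) is large compared with y outside
    it, and then eps so that the gain from mixing absorbs K int x |f|, one
    gets d/dt N(f) <= - alpha N(f) + c |mass f| (harris_constants,
    harris_dissipation). Applied to f = g_in - G, of mass zero, this is
    exponential decay in N.

    The norm is not differentiable, so this differential inequality is only
    ever stated for explicit Euler steps, as a bound on N(f + s T f) up to
    o(s) along a sequence of step sizes s tending to 0. In such a step the
    loss term is a pointwise damping (nrm_damping), while the transport term f
    - s x f' is, up to o(s), the dilated function f((1 - s) x), whose norms
    are explicit (transport_nrm); the reason is that f(x) - f((1 - s) x) is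
    the integral of the weak derivative over ](1 - s) x, x], hence s times an
    average of x f' which converges to x f' in norm (weak_derivative_average,
    logav_cvg). For an orbit in the domain of T, Euler steps agree with the
    semigroup up to o(s), and a Dini argument integrates the inequality
    (orbit_decay); the left continuity of orbits that it needs comes from the
    uniform boundedness principle (semigroup_locally_bounded). The same
    averages show that the domain of T is dense (domain_dense), which extends
    the decay to all of X. *)

Set Implicit Arguments.
Unset Strict Implicit.
Unset Printing Implicit Defensive.

Local Open Scope classical_set_scope.
Local Open Scope ring_scope.

(** * Weighted L1 spaces on the half line *)

Notation half_line R := (`]0%R, +oo[%classic : set R).

Lemma ae_weaken (R : realType) (P Q : R -> Prop) : (forall x, P x -> Q x) ->
  {ae @lebesgue_measure R, forall x, P x} ->
  {ae @lebesgue_measure R, forall x, Q x}.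
Proof. by move=> PQ; apply: (@filterS _ _ (ae_filter_ringOfSetsType _)). Qed.

Lemma ae_weaken2 (R : realType) (P Q T : R -> Prop) : (forall x, P x -> Q x -> T x) ->
  {ae @lebesgue_measure R, forall x, P x} ->
  {ae @lebesgue_measure R, forall x, Q x} ->
  {ae @lebesgue_measure R, forall x, T x}.
Proof. by move=> PQ; apply: (@filterS2 _ _ (ae_filter_ringOfSetsType _)). Qed.

Lemma eq_imp_le d (T : porderType d) (x y : T) : x = y -> (x <= y)%O.
Proof. by move=> ->. Qed.

Section WeightedSpace.
Variable R : realType.
Local Notation leb := (@lebesgue_measure R).
Local Notation D := (half_line R).
Variable w : R -> R.
Hypothesis w_gt0 : forall x, 0 < x -> 0 < w x.
Hypothesis mw : measurable_fun D w.

Implicit Types f g h : R -> R.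

Definition inL (f : R -> R) : Prop :=
  leb.-integrable D (fun x => (w x * f x)%:E).

Definition nrm (f : R -> R) : R := \int[leb]_(x in D) (w x * `|f x|).

Lemma measurable_half_line : measurable D.
Proof. exact: measurable_itv. Qed.
Hint Resolve measurable_half_line : core.

Lemma half_lineE x : D x = (0 < x) :> Prop.
Proof. by rewrite /= in_itv/= andbT. Qed.

Lemma inL_measurable f : inL f -> measurable_fun D f.
Proof.
move=> /integrableP[/measurable_EFinP mf _].
apply: (@eq_measurable_fun _ _ _ _ D (fun x => (w x)^-1 * (w x * f x))) => //.
  move=> x /[!inE]; rewrite half_lineE => x0.
  by rewrite mulKf// gt_eqF// w_gt0.
apply: measurable_funM => //.
apply: (@eq_measurable_fun _ _ _ _ D (fun x => (w x) `^ (-1))).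
  move=> x /[!inE]; rewrite half_lineE => x0.
  by rewrite powR_inv1// ltW// w_gt0.
exact: (measurableT_comp (measurable_powR _)) mw.
Qed.

Lemma inL_le f g : measurable_fun D f -> inL g ->
  (forall x, 0 < x -> `|f x| <= `|g x|) -> inL f.
Proof.
move=> mf ig fg; apply: le_integrable ig => //.
  by apply/measurable_EFinP/measurable_funM.
move=> x; rewrite half_lineE => x0.
rewrite lee_fin !normrM ler_wpM2l//; exact: fg.
Qed.

Lemma inL_ae_le f g : measurable_fun D f -> inL g ->
  {ae leb, forall x, 0 < x -> `|f x| <= `|g x|} -> inL f.
Proof.
move=> mf ig fg; apply/integrableP; split.
  by apply/measurable_EFinP/measurable_funM.
move/integrableP : (ig) => [mg]; apply: le_lt_trans.
apply: ae_ge0_le_integral => //.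
- by apply: measurableT_comp => //; apply/measurable_EFinP/measurable_funM.
- by apply: measurableT_comp.
- apply: ae_weaken fg => x fg; rewrite half_lineE => x0.
  by rewrite lee_fin !normrM ler_wpM2l// fg.
Qed.

Lemma inL0 : inL (fun=> 0).
Proof.
by apply: eq_integrable (integrable0 _ _) => // x _; rewrite mulr0.
Qed.

Lemma inLD f g : inL f -> inL g -> inL (fun x => f x + g x).
Proof.
move=> If Ig; apply: eq_integrable (integrableD _ If Ig) => // x _.
by rewrite -EFinD mulrDr.
Qed.

Lemma inLZ (a : R) f : inL f -> inL (fun x => a * f x).
Proof.
move=> If; apply: eq_integrable (integrableZl _ a If) => // x _.
by rewrite -EFinM mulrCA.
Qed.

Lemma inLN f : inL f -> inL (fun x => - f x).
Proof.
move=> /(inLZ (-1)) If; apply: eq_integrable If => // x _.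
by rewrite mulN1r.
Qed.

Lemma inLB f g : inL f -> inL g -> inL (fun x => f x - g x).
Proof. by move=> If /inLN; exact: inLD. Qed.

Lemma inL_abs f : inL f -> inL (fun x => `|f x|).
Proof.
move=> If; apply: (inL_le _ If); last by move=> x; rewrite normr_id.
by apply: measurableT_comp => //; exact: inL_measurable.
Qed.

Lemma inL_int f : inL f -> leb.-integrable D (EFin \o (fun x => w x * `|f x|)).
Proof. exact: inL_abs. Qed.

Lemma EFin_nrm f : inL f -> (nrm f)%:E = (\int[leb]_(x in D) (w x * `|f x|)%:E)%E.
Proof. by move=> /inL_int If; rewrite /nrm /Rintegral fineK//; exact: integrable_fin_num. Qed.

Lemma nrm_ge0 f : 0 <= nrm f.
Proof.
apply: Rintegral_ge0 => x; rewrite half_lineE => x0.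
by rewrite mulr_ge0// ltW// w_gt0.
Qed.

Lemma nrm_ae_le f g : measurable_fun D f -> inL g ->
  {ae leb, forall x, 0 < x -> `|f x| <= `|g x|} -> nrm f <= nrm g.
Proof.
move=> mf Ig fg.
have If := inL_ae_le mf Ig fg.
rewrite -lee_fin !EFin_nrm//; apply: ae_ge0_le_integral => //.
- by move=> x; rewrite half_lineE => x0; rewrite lee_fin mulr_ge0// ltW// w_gt0.
- by apply/measurable_EFinP/measurable_funM => //; apply: measurableT_comp.
- by move=> x; rewrite half_lineE => x0; rewrite lee_fin mulr_ge0// ltW// w_gt0.
- apply/measurable_EFinP/measurable_funM => //; apply: measurableT_comp => //.
  exact: inL_measurable.
- apply: ae_weaken fg => x fg; rewrite half_lineE => x0.
  by rewrite lee_fin ler_wpM2l ?fg// ltW// w_gt0.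
Qed.

Lemma nrm_ae_eq f g : inL f -> inL g -> eqX f g -> nrm f = nrm g.
Proof.
move=> If Ig fg; apply/le_anti/andP; split; apply: nrm_ae_le => //;
  try exact: inL_measurable;
  by apply: ae_weaken fg => x fg x0; rewrite fg.
Qed.

Lemma eq_nrm f g : (forall x, 0 < x -> f x = g x) -> nrm f = nrm g.
Proof.
by move=> fg; apply: eq_Rintegral => x /[!inE]; rewrite half_lineE => /fg ->.
Qed.

Lemma eq_inL f g : (forall x, 0 < x -> f x = g x) -> inL f -> inL g.
Proof.
move=> fg; apply: eq_integrable => // x /[!inE]; rewrite half_lineE => /fg ->//.
Qed.

Lemma nrm0 : nrm (fun=> 0) = 0.
Proof. by rewrite /nrm; under eq_Rintegral do rewrite normr0 mulr0; rewrite Rintegral_cst// mul0r. Qed.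

Lemma nrmZ (a : R) f : inL f -> nrm (fun x => a * f x) = `|a| * nrm f.
Proof.
move=> If; rewrite -RintegralZl//; last exact: inL_int.
by apply: eq_Rintegral => x _; rewrite normrM mulrCA.
Qed.

Lemma nrmN f : inL f -> nrm (fun x => - f x) = nrm f.
Proof. by move=> If; apply: eq_Rintegral => x _; rewrite normrN. Qed.

Lemma nrmD f g : inL f -> inL g -> nrm (fun x => f x + g x) <= nrm f + nrm g.
Proof.
move=> If Ig; rewrite -RintegralD//; try exact: inL_int.
apply: le_Rintegral => //.
- exact/inL_int/inLD.
- apply: eq_integrable (integrableD _ (inL_int If) (inL_int Ig)) => //.
- move=> x; rewrite half_lineE => x0.
  by rewrite -mulrDr ler_wpM2l ?ler_normD// ltW// w_gt0.
Qed.

Lemma nrmDE f g : inL f -> inL g ->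
  nrm (fun x => `|f x| + `|g x|) = nrm f + nrm g.
Proof.
move=> If Ig; rewrite -RintegralD//; try exact: inL_int.
by apply: eq_Rintegral => x _; rewrite ger0_norm ?addr_ge0// mulrDr.
Qed.

Lemma nrmB f g : inL f -> inL g -> nrm (fun x => f x - g x) <= nrm f + nrm g.
Proof. by move=> If Ig; rewrite -(nrmN Ig); apply: nrmD => //; exact: inLN. Qed.

Lemma nrm_distC f g : nrm (fun x => f x - g x) = nrm (fun x => g x - f x).
Proof. by apply: eq_Rintegral => x _; rewrite distrC. Qed.

Lemma nrm_lipschitz f g : inL f -> inL g ->
  `|nrm f - nrm g| <= nrm (fun x => f x - g x).
Proof.
move=> If Ig; rewrite ler_norml; apply/andP; split.
  rewrite nrm_distC lerNl opprB lerBlDr.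
  rewrite -{1}(@eq_nrm (fun x => (g x - f x) + f x) g).
    by apply: nrmD => //; exact: inLB.
  by move=> x _; rewrite subrK.
rewrite lerBlDr -{1}(@eq_nrm (fun x => (f x - g x) + g x) f).
  by apply: nrmD => //; exact: inLB.
by move=> x _; rewrite subrK.
Qed.

End WeightedSpace.
Arguments measurable_half_line {R}.
#[export] Hint Resolve measurable_half_line : core.

(** * Limit theorems and the uniform boundedness principle *)

Lemma limn_einf_itv (R : realType) (u : nat -> \bar R) (a b : \bar R) :
  (forall n, a <= u n <= b)%E -> (a <= limn_einf u <= b)%E.
Proof.
move=> ab; rewrite limn_einf_lim; apply/andP; split.
  apply: lime_ge; first exact: is_cvg_einfs.
  apply: nearW => n; apply: le_ereal_inf_tmp => _ [k _ <-].
  by have /andP[] := ab k.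
apply: lime_le; first exact: is_cvg_einfs.
apply: nearW => n; apply: (@le_trans _ _ (u n)); last by have /andP[] := ab n.
by apply: ereal_inf_lbound; exists n => /=.
Qed.

Lemma measurable_limn_einf d (T : measurableType d) (R : realType) (A : set T)
    (f : nat -> T -> \bar R) : (forall n, measurable_fun A (f n)) ->
  measurable_fun A (fun x => limn_einf (f^~ x)).
Proof.
move=> mf.
rewrite (_ : (fun x => _) = -%E \o (fun x => limn_esup (fun n => (- f n x)%E))).
  apply: measurableT_comp => //.
  by apply: measurable_fun_limn_esup => n; exact: measurableT_comp.
apply/funext => x /=; rewrite -limn_einfN; congr limn_einf.
by apply/funext => n /=; rewrite oppeK.
Qed.

Section WeightedLimits.
Variable R : realType.
Local Notation leb := (@lebesgue_measure R).
Local Notation D := (half_line R).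
Variable w : R -> R.
Hypothesis w_gt0 : forall x, 0 < x -> 0 < w x.
Hypothesis mw : measurable_fun D w.
Implicit Types f g : R -> R.

Local Notation inL := (inL w).
Local Notation nrm := (nrm w).

(** Norm bounds survive almost everywhere convergence; the limit may have been
    defined by pointwise means only, so its membership in the space is part of
    the conclusion. *)
Lemma nrm_fatou (h : nat -> R -> R) f (C : R) :
  measurable_fun D f -> (forall n, inL (h n)) ->
  {ae leb, forall x, 0 < x -> h n x @[n --> \oo] --> f x} ->
  (forall n, nrm (h n) <= C) -> inL f /\ nrm f <= C.
Proof.
move=> mf Ih hf hC.
have mwf : measurable_fun D (fun x => (w x * `|f x|)%:E).
  by apply/measurable_EFinP/measurable_funM => //; exact: measurableT_comp.
have ge0 (k : R -> R) x : D x -> (0 <= (w x * `|k x|)%:E)%E.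
  by rewrite half_lineE => x0; rewrite lee_fin mulr_ge0// ltW// w_gt0.
have mh n : measurable_fun D (fun x => (w x * `|h n x|)%:E).
  apply/measurable_EFinP/measurable_funM => //; apply: measurableT_comp => //.
  exact: (inL_measurable w_gt0 mw).
have le : (\int[leb]_(x in D) (w x * `|f x|)%:E <= C%:E)%E.
  have -> : (\int[leb]_(x in D) (w x * `|f x|)%:E =
      \int[leb]_(x in D) limn_einf (fun n => (w x * `|h n x|)%:E))%E.
    apply: ge0_ae_eq_integral => //.
    - exact: measurable_limn_einf.
    - exact: ge0.
    - move=> x Dx; suff /andP[h1 h2] : (0 <= limn_einf (fun n => (w x * `|h n x|)%:E) <= +oo)%E by [].
      by apply: limn_einf_itv => n; rewrite ge0//= leey.
    - apply: ae_weaken hf => x hf; rewrite half_lineE => x0.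
      have whf : (w x * `|h n x|)%:E @[n --> \oo] --> (w x * `|f x|)%:E.
        apply/cvg_EFin; first by near=> n.
        apply: cvgM; first exact: cvg_cst.
        by apply: cvg_norm; exact: hf.
      by rewrite (cvg_limn_einf_sup whf).1.
  apply: le_trans (fatou _ _ _ _) _ => //.
    by move=> n x; exact: ge0.
  suff /andP[h1 h2] : (0 <= limn_einf (fun n =>
      \int[leb]_(x in D) (w x * `|h n x|)%:E) <= C%:E)%E by [].
  apply: limn_einf_itv => n; apply/andP; split.
    by apply: integral_ge0 => x; exact: ge0.
  by rewrite -EFin_nrm// lee_fin.
have If : inL f.
  apply/integrableP; split.
    by apply/measurable_EFinP/measurable_funM.
  apply: le_lt_trans (ltry C).
  apply: le_trans le.
  apply: ge0_le_integral => //.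
  - by apply: measurableT_comp => //; apply/measurable_EFinP/measurable_funM.
  - move=> x; rewrite half_lineE => x0.
    by rewrite lee_fin normrM gtr0_norm ?w_gt0.
by split => //; rewrite -lee_fin EFin_nrm.
Unshelve. all: by end_near.
Qed.

Lemma nrm_dominated (h : nat -> R -> R) f g :
  measurable_fun D f -> (forall n, measurable_fun D (h n)) ->
  {ae leb, forall x, 0 < x -> h n x @[n --> \oo] --> f x} ->
  inL g -> (forall n x, 0 < x -> `|h n x| <= g x) ->
  inL f /\ nrm (fun x => h n x - f x) @[n --> \oo] --> (0 : R).
Proof.
move=> mf mh hf Ig hg.
have mwh n : measurable_fun D (fun x => (w x * h n x)%:E).
  by apply/measurable_EFinP/measurable_funM.
have mwf : measurable_fun D (fun x => (w x * f x)%:E).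
  by apply/measurable_EFinP/measurable_funM.
have whf : {ae leb, forall x, D x ->
    (w x * h n x)%:E @[n --> \oo] --> (w x * f x)%:E}.
  apply: ae_weaken hf => x hf; rewrite half_lineE => x0.
  apply/cvg_EFin; first by near=> n.
  by apply: cvgM; [exact: cvg_cst | exact: hf].
have whg : {ae leb, forall x n, D x -> (`|(w x * h n x)%:E| <= (w x * g x)%:E)%E}.
  apply: aeW => x n; rewrite half_lineE => x0.
  rewrite lee_fin normrM gtr0_norm ?w_gt0// ler_wpM2l//; last exact: hg.
  exact/ltW/w_gt0.
have [If cvg0 _] := @dominated_convergence _ _ _ leb D measurable_half_line _ _ _ mwh mwf whf Ig whg.
split => //.
rewrite (_ : (fun n => _) = fun n => fine (\int[leb]_(x in D) `|(w x * h n x)%:E - (w x * f x)%:E|)%E).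
  exact: (fine_cvg cvg0).
apply/funext => n; congr fine; apply: eq_integral => x /[!inE].
rewrite half_lineE => x0.
by rewrite -EFinB -mulrBr abse_EFin normrM (gtr0_norm (w_gt0 x0)).
Unshelve. all: by end_near.
Qed.

Lemma inL_sum (g : nat -> R -> R) m n : (forall k, inL (g k)) ->
  inL (fun x => \sum_(m <= k < n) g k x).
Proof.
move=> Ig; elim: n => [|n IHn].
  apply: (eq_inL _ (inL0 w)) => x _; rewrite big_geq//.
have [mn|mn] := leqP m n; last first.
  by apply: (eq_inL _ (inL0 w)) => x _; rewrite big_geq.
apply: (eq_inL _ (inLD IHn (Ig n))) => x _.
by rewrite big_nat_recr.
Qed.

Lemma nrm_sum (g : nat -> R -> R) m n : (forall k, inL (g k)) ->
  nrm (fun x => \sum_(m <= k < n) g k x) <= \sum_(m <= k < n) nrm (g k).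
Proof.
move=> Ig; elim: n => [|n IHn].
  rewrite big_geq// (@eq_nrm _ _ _ (fun=> 0)) ?nrm0//.
  by move=> x _; rewrite big_geq.
have [mn|mn] := leqP m n; last first.
  rewrite big_geq// (@eq_nrm _ _ _ (fun=> 0)) ?nrm0//.
  by move=> x _; rewrite big_geq.
rewrite big_nat_recr//=.
rewrite (@eq_nrm _ _ _ (fun x => \sum_(m <= k < n) g k x + g n x)).
  by apply: le_trans (nrmD w_gt0 mw (inL_sum _ _ Ig) (Ig n)) _; rewrite lerD2r.
by move=> x _; rewrite big_nat_recr.
Qed.

(** The theorem of Riesz and Fischer for absolutely convergent series. The
    tails are bounded by an explicit function t, so that the distance from the
    limit to each partial sum comes out in closed form: it is the Fatou bound
    for the tail. *)
Lemma nrm_complete (g : nat -> R -> R) (t : nat -> R) :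
  (forall k, inL (g k)) ->
  (forall n N, \sum_(n <= k < N) nrm (g k) <= t n) ->
  exists f, inL f /\
    forall n, nrm (fun x => f x - \sum_(0 <= k < n) g k x) <= t n.
Proof.
move=> Ig gt.
have mg k : measurable_fun D (g k) by exact: (inL_measurable w_gt0 mw).
pose s n x := \sum_(0 <= k < n) g k x.
have Is n : inL (s n) by exact: inL_sum.
have ms n : measurable_fun D (s n) by exact: (inL_measurable w_gt0 mw).
pose f x := fine (limn_esup (fun n => (s n x)%:E)).
have mf : measurable_fun D f.
  apply: (measurableT_comp (fine_measurable measurableT)).
  by apply: measurable_fun_limn_esup => n; exact/measurable_EFinP.
have sf : {ae leb, forall x, 0 < x -> s n x @[n --> \oo] --> f x}.
  have wg0 k x : D x -> (0 <= (w x * `|g k x|)%:E)%E.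
    by rewrite half_lineE => x0; rewrite lee_fin mulr_ge0// ltW// w_gt0.
  have mwg k : measurable_fun D (fun x => (w x * `|g k x|)%:E).
    by apply/measurable_EFinP/measurable_funM => //; exact: measurableT_comp.
  pose F x := (\sum_(0 <= k <oo) (w x * `|g k x|)%:E)%E.
  have mF : measurable_fun D F.
    apply: (@ge0_emeasurable_sum _ _ _ _ (fun k x => (w x * `|g k x|)%:E) predT).
      by move=> k x Dx _; exact: wg0.
    by [].
  have F0 x : D x -> (0 <= F x)%E.
    by move=> Dx; apply: nneseries_ge0 => k _ _; exact: wg0.
  have IF : leb.-integrable D F.
    apply/integrableP; split => //.
    rewrite (_ : (\int[leb]_(x in D) `|F x| = \int[leb]_(x in D) F x)%E); last first.
      by apply: eq_integral => x /[!inE] Dx; rewrite gee0_abs ?F0.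
    rewrite integral_nneseries//.
    apply: le_lt_trans (ltry (t 0%N)).
    apply: lime_le.
      by apply: is_cvg_nneseries => k _ _; apply: integral_ge0 => x Dx; exact: wg0.
    apply: nearW => n.
    apply: le_trans (_ : _ <= (\sum_(0 <= k < n) nrm (g k))%:E)%E _; last by rewrite lee_fin.
    rewrite -sumEFin; apply: lee_sum => k _; by rewrite EFin_nrm.
  have := @integrable_ae _ _ _ leb _ measurable_half_line _ IF.
  apply: ae_weaken => x.
  rewrite half_lineE => /[swap] x0 /(_ x0) Ffin.
  have : cvgn (series (fun k => w x * `|g k x|)).
    apply: nnseries_is_cvg; first by move=> k; rewrite mulr_ge0// ltW// w_gt0.
    by rewrite ltey_eq Ffin.
  have -> : (fun k => w x * `|g k x|) = (fun k => `|w x * g k x|).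
    by apply/funext => k; rewrite normrM gtr0_norm ?w_gt0.
  move/(@normed_cvg R R^o) => cws.
  have sE : (fun n => s n x) = (fun n => (w x)^-1 * series (fun k => w x * g k x) n).
    apply/funext => n; rewrite /series/= -mulr_sumr mulKf//.
    by rewrite gt_eqF// w_gt0.
  have cs : cvgn (fun n => s n x).
    by rewrite sE; apply: is_cvgM => //; exact: is_cvg_cst.
  suff -> : f x = limn (s^~ x) by [].
  have cEs : (s n x)%:E @[n --> \oo] --> (limn (s^~ x))%:E.
    by apply/cvg_EFin => //; first by near=> n.
  by rewrite /f (cvg_limn_einf_sup cEs).2.
exists f; split.
  have [] // := @nrm_fatou s f (t 0%N) mf Is sf.
  by move=> n; apply: le_trans (nrm_sum 0 n Ig) _.
move=> n.
have [] // := @nrm_fatou (fun N x => s (N + n)%N x - s n x) (fun x => f x - s n x) (t n).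
- exact: measurable_funB.
- by move=> N; exact: inLB.
- apply: ae_weaken sf => x sf x0.
  by apply: cvgB; [by rewrite (@cvg_shiftn n _ (s^~ x)); exact: sf | exact: cvg_cst].
- move=> N.
  rewrite (@eq_nrm _ _ _ (fun x => \sum_(n <= k < N + n) g k x)).
    by apply: le_trans (nrm_sum _ _ Ig) _.
  move=> x _; rewrite /s (big_cat_nat (n := n) (p := N + n))//= ?leq_addl//.
  by rewrite addrAC subrr add0r.
Unshelve. all: by end_near.
Qed.

(** A gliding hump argument that avoids Baire category. If no common bound
    existed, the norms of some p (nu j) would outgrow 3^j. Adding or
    subtracting 3^-j h_j, whichever makes p (nu j) of the partial sum large,
    builds an absolutely convergent series whose sum f has p (nu j) f
    unbounded: the terms after the j-th are too small to undo the j-th choice. *)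
Lemma uniform_boundedness (p : nat -> (R -> R) -> R) :
  (forall n f g, inL f -> inL g -> p n (fun x => f x + g x) <= p n f + p n g) ->
  (forall n a f, inL f -> p n (fun x => a * f x) = `|a| * p n f) ->
  (forall n, exists K, forall f, inL f -> p n f <= K * nrm f) ->
  (forall f, inL f -> exists C, forall n, p n f <= C) ->
  exists K, forall n f, inL f -> p n f <= K * nrm f.
Proof.
move=> pD pZ pb ptb; apply: contrapT => nK.
have p_ge0 n f : inL f -> 0 <= p n f.
  move=> If; have p0 : p n (fun x => 0 * f x) = 0 by rewrite pZ// normr0 mul0r.
  have := pD n f (fun x => -1 * f x) If (inLZ _ If).
  rewrite (pZ n (-1))// normrN1 mul1r.
  rewrite (_ : (fun x => _) = (fun x => 0 * f x)).
    by rewrite p0; lra.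
  by apply/funext => x; rewrite mulN1r subrr mul0r.
pose B n := [set y | exists2 h, inL h /\ nrm h <= 1 & y = p n h].
have B0 n : B n 0.
  exists (fun x : R => 0 * (fun=> 0 : R) x).
    split; first exact/inLZ/inL0.
    by rewrite nrmZ ?normr0 ?mul0r//; exact: inL0.
  by rewrite pZ ?normr0 ?mul0r//; exact: inL0.
have hB n : has_sup (B n).
  split; first by exists 0.
  have [K hK] := pb n.
  exists `|K| => _ [h [Ih h1] ->].
  apply: le_trans (hK _ Ih) _; apply: le_trans (ler_norm _) _.
  rewrite normrM ler_piMr// ger0_norm//; exact: nrm_ge0.
pose op n := sup (B n).
have pop n f : inL f -> p n f <= op n * nrm f.
  move=> If; have [f0|fn0] := eqVneq (nrm f) 0.
    by have [K /(_ _ If)] := pb n; rewrite f0 !mulr0.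
  have fgt0 : 0 < nrm f by rewrite lt_def fn0 nrm_ge0.
  rewrite -ler_pdivrMr//; apply: ub_le_sup; first exact: (hB n).2.
  exists (fun x => (nrm f)^-1 * f x).
    split; first exact: inLZ.
    by rewrite nrmZ// gtr0_norm ?invr_gt0// mulVf.
  by rewrite pZ// gtr0_norm ?invr_gt0// mulrC.
have opu c : exists n, c < op n.
  apply: contrapT => no; apply: nK; exists c => n f If.
  apply: le_trans (pop _ _ If) _; rewrite ler_wpM2r ?nrm_ge0//.
  by rewrite leNgt; apply/negP => cn; apply: no; exists n.
have /choice[nu hnu] : forall j : nat, exists n, 6 * 3 ^+ j * j.+1%:R < op n by move=> j; exact: opu.
have op_gt0 j : 0 < op (nu j).
  by apply: le_lt_trans (hnu j); rewrite !mulr_ge0// exprn_ge0.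
have /choice[h hh] : forall j : nat, exists h, [/\ inL h, nrm h <= 1 & 2 / 3 * op (nu j) <= p (nu j) h].
  move=> j; have : 0 < 3^-1 * op (nu j) by rewrite mulr_gt0.
  move=> /sup_adherent /(_ (hB (nu j)))[_ [h [Ih h1] ->] lth].
  exists h; split => //; apply: le_trans (ltW lth).
  rewrite -/(op (nu j)); lra.
pose e j x := 3 ^- j * h j x.
pose F j (s : R -> R) : R -> R :=
  if 3 ^- j * p (nu j) (h j) <= p (nu j) (fun x => s x + e j x) then e j else (fun x => -1 * e j x).
pose s := fix s j := if j is j'.+1 then (fun x => s j' x + F j' (s j') x) else (fun=> 0).
pose g j := F j (s j).
have Ih j : inL (h j) by have [] := hh j.
have Ie j : inL (e j) by exact: inLZ.
have IF j f : inL (F j f) by rewrite /F; case: ifPn => _ //; exact: inLZ.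
have ge3 j : 0 < (3 : R) ^- j by rewrite invr_gt0 exprn_gt0.
have ne j : nrm (e j) <= 3 ^- j.
  rewrite nrmZ// gtr0_norm// ler_piMr ?(ltW (ge3 j))//; by have [] := hh j.
have ng j : nrm (g j) <= 3 ^- j.
  by rewrite /g /F; case: ifPn => _ //; rewrite nrmZ// normrN1 mul1r.
have Ig j : inL (g j) by exact: IF.
have sE j x : s j x = \sum_(0 <= k < j) g k x.
  by elim: j => [|j IH]; [rewrite big_geq | rewrite big_nat_recr//= -IH].
have Is j : inL (s j) by apply: eq_inL (inL_sum 0 j Ig) => x _; rewrite sE.
(* One of s + e and s - e is large, because their difference is 2 e. *)
have ps j : 3 ^- j * p (nu j) (h j) <= p (nu j) (s j.+1).
  rewrite /= /F; case: ifPn => //; rewrite -ltNge => lt1.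
  have := pD (nu j) (fun x => s j x + e j x) (fun x => -1 * (s j x + -1 * e j x)).
  rewrite pZ; last by apply: inLD => //; exact: inLZ.
  have -> : (fun x => s j x + e j x + -1 * (s j x + -1 * e j x)) = (fun x => 2 * e j x).
    by apply/funext => x; ring.
  rewrite (pZ _ 2)// (pZ _ (3 ^- j))// normrN1 mul1r (gtr0_norm (ge3 j)) ger0_norm//.
  have I1 : inL (fun x => s j x + e j x) by exact: inLD.
  have I2 : inL (fun x => -1 * (s j x + -1 * e j x)).
    by apply: inLZ; apply: inLD => //; exact: inLZ.
  move=> /(_ I1 I2) le2.
  set a := _ * p _ _ in lt1 le2 *; set b := p _ _ in lt1 le2 *; set c := p _ _ in le2 *.
  lra.
have gt n N : \sum_(n <= k < N) nrm (g k) <= 3 / 2 * 3 ^- n.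
  apply: (@le_trans _ _ (\sum_(n <= k < N) 3 ^- k)).
    by apply: ler_sum => k _; exact: ng.
  have [nN|Nn] := leqP n N; last first.
    by rewrite big_geq ?(ltnW Nn)// mulr_ge0// ltW.
  suff : \sum_(n <= k < N) (3 : R) ^- k = 3 / 2 * (3 ^- n - 3 ^- N).
    move=> ->; rewrite ler_pM2l// lerBlDr lerDl ltW//.
  elim: N nN => [|N IH].
    by rewrite leqn0 => /eqP ->; rewrite big_geq// subrr mulr0.
  rewrite leq_eqVlt => /predU1P[->|nN]; first by rewrite big_geq// subrr mulr0.
  rewrite big_nat_recr//= IH// exprS invfM; lra.
(* The terms after the j-th have total norm at most 3^-j / 2, so they cost op
    (nu j) 3^-j / 2, less than the 2/3 op (nu j) 3^-j gained in step j; the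
    margin of 1/6 exceeds j + 1. *)
have [f [If ft]] := @nrm_complete g (fun n => 3 / 2 * 3 ^- n) Ig gt.
have [C hC] := ptb f If.
have [j Cj] : exists j : nat, C < j.+1%:R.
  by exists (Num.truncn C); exact: truncnS_gt.
have := hC (nu j); rewrite leNgt => /negP; apply.
apply: lt_le_trans Cj _.
have If1 : inL (fun x => -1 * (f x - s j.+1 x)) by apply: inLZ; exact: inLB.
have := pD (nu j) f _ If If1.
have -> : (fun x => f x + -1 * (f x - s j.+1 x)) = s j.+1.
  by apply/funext => x; ring.
have := pop (nu j) _ If1; rewrite nrmZ ?normrN1 ?mul1r; last exact: inLB.
have ftj : nrm (fun x => f x - s j.+1 x) <= 3 / 2 * 3 ^- j.+1.
  apply: le_trans (ft j.+1); apply: eq_imp_le.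
  by apply: eq_nrm => x _; rewrite sE.
have := ps j; have [_ _ hp] := hh j; have := hnu j; have := ge3 j; have := op_gt0 j.
rewrite exprS invfM in ftj.
have : (3 : R) ^- j * 3 ^+ j = 1 by rewrite mulVf// expf_neq0.
have [q qE] : exists q, q = (3 : R) ^- j by eexists.
have [r rE] : exists r, r = (3 : R) ^+ j by eexists.
rewrite -qE -rE in ftj *; move=> qr o0 q0 or psj pa pb'.
have {}psj : q * (2 / 3 * op (nu j)) <= p (nu j) (s j.+1).
  by apply: le_trans psj; rewrite ler_pM2l.
have {}pa : p (nu j) (fun x => -1 * (f x - s j.+1 x)) <= op (nu j) * (1 / 2 * q).
  apply: le_trans pa _; rewrite ler_pM2l//; lra.
have : q * (6 * r * j.+1%:R) < q * op (nu j) by rewrite ltr_pM2l.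
have -> : q * (6 * r * j.+1%:R) = 6 * j.+1%:R by rewrite [6 * r]mulrC !mulrA qr mul1r.
lra.
Unshelve. all: done.
Qed.

End WeightedLimits.

(** * Monotonicity from a Dini condition *)

Section Dini.
Variable R : realType.

Lemma cvg_at_rightPdelta (f : R -> R) (t l : R) :
  f s @[s --> t^'+] --> l ->
  forall e, 0 < e -> exists2 d, 0 < d & forall s, t < s < t + d -> `|f s - l| < e.
Proof.
move=> /cvgrPdist_lt fl e e0; have := fl _ e0.
rewrite near_withinE => /nbhs_ballP[d /= d0 dP].
exists d => // s /andP[ts std]; rewrite distrC; apply: dP => //.
by rewrite /ball/= distrC gtr0_norm ?subr_gt0// ltrBlDl.
Qed.

Lemma cvg_at_leftPdelta (f : R -> R) (t l : R) :
  f s @[s --> t^'-] --> l ->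
  forall e, 0 < e -> exists2 d, 0 < d & forall s, t - d < s < t -> `|f s - l| < e.
Proof.
move=> /cvgrPdist_lt fl e e0; have := fl _ e0.
rewrite near_withinE => /nbhs_ballP[d /= d0 dP].
exists d => // s /andP[tds st]; rewrite distrC; apply: dP => //.
by rewrite /ball/= gtr0_norm ?subr_gt0// ltrBlDr -ltrBlDl.
Qed.

(** If A is the set of times t at which psi t <= psi 0 + e t, left continuity
    puts sup A in A and the step condition pushes past sup A. The step
    condition asks for one small s only, not for all of them; this is what
    allows generator estimates to be proved along a fixed sequence of step
    sizes. *)
Lemma dini_le (psi : R -> R) :
  (forall t, 0 <= t -> forall e, 0 < e -> forall eta, 0 < eta ->
    exists2 s, 0 < s < eta & psi (t + s) <= psi t + e * s) ->
  (forall t, 0 < t -> psi s @[s --> t^'-] --> psi t) ->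
  forall t, 0 <= t -> psi t <= psi 0.
Proof.
move=> dpsi lpsi T T0; apply/ler_addgt0Pr => e' e'0.
have [->|Tn0] := eqVneq T 0; first by rewrite lerDl ltW.
have {Tn0}T0 : 0 < T by rewrite lt_def Tn0.
pose e := e' / T.
have e0 : 0 < e by rewrite divr_gt0.
have eT : e' = e * T by rewrite /e divfK// gt_eqF.
rewrite eT.
pose A := [set t | 0 <= t <= T /\ psi t <= psi 0 + e * t].
have A0 : A 0 by rewrite /A/= lexx mulr0 addr0 ltW.
have supA : has_sup A.
  by split; [exists 0 | exists T => t [/andP[_ ?] _]].
pose t := sup A.
have t0 : 0 <= t by apply: ub_le_sup => //; exact: supA.2.
have tT : t <= T by apply: ge_sup; [exists 0 | move=> s [/andP[]]].
have At : psi t <= psi 0 + e * t.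
  have [t00|tn0] := eqVneq t 0; first by rewrite t00 mulr0 addr0.
  have {tn0}t0 : 0 < t by rewrite lt_def tn0.
  apply/ler_addgt0Pr => k k0.
  have [d d0 dP] := cvg_at_leftPdelta (lpsi _ t0) k0.
  have [s [/andP[s0 sT] As] ts] := sup_adherent d0 supA.
  have st : s <= t by apply: ub_le_sup; [exact: supA.2 | split => //; rewrite s0].
  have [<-|snt] := eqVneq s t; first by rewrite (le_trans As)// lerDl ltW.
  have := dP s; rewrite ts lt_neqAle snt st => /(_ isT); rewrite ltr_norml => /andP[+ _].
  have : e * s <= e * t by rewrite ler_pM2l.
  lra.
have [->//|tnT] := eqVneq T t.
have {tnT}tT : 0 < T - t by rewrite subr_gt0 lt_neqAle eq_sym tnT.
have [s /andP[s0 sT] ps] := dpsi t t0 e e0 _ tT.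
have : t + s <= t.
  apply: ub_le_sup; first exact: supA.2.
  split; last by rewrite mulrDr; lra.
  by apply/andP; split; lra.
lra.
Qed.

End Dini.

(** * Strongly continuous semigroups on X *)

Section Semigroup.
Variables (R : realType) (m M : R).
Local Notation leb := (@lebesgue_measure R).
Local Notation D := (half_line R).

Definition wX (x : R) := x `^ m + x `^ M.

Lemma wX_gt0 x : 0 < x -> 0 < wX x.
Proof. by move=> x0; rewrite addr_gt0// powR_gt0. Qed.

Lemma measurable_wX : measurable_fun D wX.
Proof. by apply: measurable_funD; apply: measurable_funTS; exact: measurable_powR. Qed.

Local Notation nX := (nrm wX).
Local Notation inX := (inX m M).
Local Notation normX := (normX m M).

Lemma normXE f : inX f -> normX f = (nX f)%:E.
Proof. by move=> If; rewrite (@EFin_nrm _ wX wX_gt0 measurable_wX). Qed.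

Variable S : R -> (R -> R) -> R -> R.
Hypothesis C0S : C0_semigroup m M S.

Lemma semigroup_inX t f : 0 <= t -> inX f -> inX (S t f).
Proof. by have [+ _ _ _ _] := C0S; exact. Qed.

Lemma semigroup_lin t a f g : 0 <= t -> inX f -> inX g ->
  eqX (S t (fun x => a * f x + g x)) (fun x => a * S t f x + S t g x).
Proof. by have [_ + _ _ _] := C0S; exact. Qed.

Lemma semigroup_bounded t : 0 <= t -> exists K, forall f, inX f ->
  nX (S t f) <= K * nX f.
Proof.
move=> t0; have [_ _ /(_ t t0)[K hK] _ _] := C0S.
exists K => f If; have := hK f If.
by rewrite !normXE// ?lee_fin//; exact: semigroup_inX.
Qed.

Lemma semigroup_add s t f : 0 <= s -> 0 <= t -> inX f ->
  eqX (S (s + t) f) (S s (S t f)).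
Proof. by have [_ _ _ [_ +] _] := C0S; exact. Qed.

Lemma semigroup0 f : inX f -> eqX (S 0 f) f.
Proof. by have [_ _ _ [+ _] _] := C0S; exact. Qed.

Lemma normX_cvg0 (u : R -> R -> R) : (forall t, 0 < t -> inX (u t)) ->
  normX (u t) @[t --> (0 : R)^'+] --> (0 : \bar R) <->
  forall e, 0 < e -> exists2 d, 0 < d & forall t, 0 < t < d -> nX (u t) < e.
Proof.
move=> Iu; split=> [cu e e0|cu].
  have : fine (normX (u t)) @[t --> (0 : R)^'+] --> (0 : R) by exact: (fine_cvg cu).
  move=> /cvg_at_rightPdelta /(_ _ e0)[d d0 dP].
  exists d => // t /andP[t0 td]; have := dP t; rewrite add0r t0 td subr0 => /(_ isT).
  move=> h; apply: le_lt_trans h; rewrite normXE ?ler_norm//; exact: Iu.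
have cE : nX (u t) @[t --> (0 : R)^'+] --> (0 : R).
  apply/cvgrPdist_lt => e e0; have [d d0 dP] := cu e e0.
  near=> t; rewrite sub0r normrN ger0_norm; last exact: (nrm_ge0 wX_gt0).
  by apply: dP; apply/andP; split; near: t; [exact: nbhs_right_gt | exact: nbhs_right_lt].
apply: (cvg_trans (G := (nX (u t))%:E @[t --> (0 : R)^'+])).
  apply: near_eq_cvg; near=> t; rewrite normXE//; apply: Iu.
  by near: t; exact: nbhs_right_gt.
by apply/cvg_EFin => //; near=> t.
Unshelve. all: by end_near.
Qed.

Lemma nX_ae_eq f g : inX f -> inX g -> eqX f g -> nX f = nX g.
Proof. exact: (nrm_ae_eq wX_gt0 measurable_wX). Qed.

Lemma nX_eq0 f : inX f -> eqX f (fun=> 0) -> nX f = 0.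
Proof.
move=> If /(nX_ae_eq If) ->; first exact: nrm0.
exact: inL0.
Qed.

Lemma semigroup_continuous0 f : inX f -> forall e, 0 < e ->
  exists2 d, 0 < d & forall t, 0 < t < d -> nX (fun x => S t f x - f x) < e.
Proof.
move=> If; have [_ _ _ _ /(_ f If)] := C0S.
move/normX_cvg0; apply => t t0.
by apply: inLB => //; apply: semigroup_inX => //; exact: ltW.
Qed.

Lemma semigroup_lin_nX t a f g : 0 <= t -> inX f -> inX g ->
  nX (S t (fun x => a * f x + g x)) = nX (fun x => a * S t f x + S t g x).
Proof.
move=> t0 If Ig; apply: nX_ae_eq; last exact: semigroup_lin.
  by apply: semigroup_inX => //; apply: inLD => //; exact: inLZ.
by apply: inLD; [apply: inLZ|]; exact: semigroup_inX.
Qed.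

Lemma semigroup_nXB t K f g : 0 <= t -> (forall f, inX f -> nX (S t f) <= K * nX f) ->
  inX f -> inX g -> nX (fun x => S t f x - S t g x) <= K * nX (fun x => f x - g x).
Proof.
move=> t0 hK If Ig.
rewrite (_ : (fun x => S t f x - S t g x) = (fun x => -1 * S t g x + S t f x)).
  rewrite -semigroup_lin_nX//.
  rewrite (_ : (fun x => -1 * g x + f x) = (fun x => f x - g x)).
    by apply: hK; exact: inLB.
  by apply/funext => x; ring.
by apply/funext => x; ring.
Qed.

(** Each S t is bounded with a constant that could a priori blow up as t tends
    to 0. Were it so along t_n, the seminorms f |-> |S t_n f| would still be
    bounded at each f by right continuity at 0, against the uniform
    boundedness principle. *)
Lemma semigroup_locally_bounded : exists d K, 0 < d /\ 0 <= K /\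
  forall t f, 0 <= t <= d -> inX f -> nX (S t f) <= K * nX f.
Proof.
apply: contrapT => nb.
have bad (n : nat) : exists tf : R * (R -> R), [/\ 0 <= tf.1 <= n.+1%:R^-1, inX tf.2 &
    n%:R * nX tf.2 < nX (S tf.1 tf.2)].
  apply: contrapT => nn; apply: nb; exists n.+1%:R^-1, n%:R; split=> //; split=> //.
  move=> t f tn If; rewrite leNgt; apply/negP => lt; apply: nn.
  by exists (t, f).
have /choice[tf htf] := bad.
pose p n f := nX (S (tf n).1 f).
have t0 n : 0 <= (tf n).1 by have [/andP[]] := htf n.
have [|||f If|K hK] := @uniform_boundedness _ _ wX_gt0 measurable_wX p.
- move=> n f g If Ig; rewrite /p.
  have := semigroup_lin_nX 1 (t0 n) If Ig.
  under eq_fun do rewrite mul1r.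
  under [in X in _ = X -> _]eq_fun do rewrite mul1r.
  move=> ->; apply: (nrmD wX_gt0 measurable_wX); exact: semigroup_inX.
- move=> n a f If; rewrite /p.
  have I0 : inX (fun=> 0) by exact: inL0.
  have SI0 : eqX (S (tf n).1 (fun=> 0)) (fun=> 0).
    have := semigroup_lin (-1) (t0 n) I0 I0.
    rewrite (_ : (fun x : R => -1 * 0 + 0) = (fun=> 0)); last first.
      by apply/funext => x; rewrite mulr0 addr0.
    by apply: ae_weaken => x h x0; rewrite h//; ring.
  have := semigroup_lin_nX a (t0 n) If I0.
  under eq_fun do rewrite addr0.
  move=> ->; rewrite -(nrmZ wX_gt0 measurable_wX _ (semigroup_inX (t0 n) If)).
  apply: nX_ae_eq.
  - by apply: inLD; [apply: inLZ|]; exact: semigroup_inX.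
  - by apply: inLZ; exact: semigroup_inX.
  - by apply: ae_weaken SI0 => x h x0; rewrite h// addr0.
- by move=> n; exact: semigroup_bounded.
- have [d d0 dP] := semigroup_continuous0 If ltr01.
  have [K0 hK0] := semigroup_bounded (lexx 0).
  have [n0 n0d] : exists n0 : nat, n0.+1%:R^-1 < d.
    exists (Num.truncn d^-1); rewrite invf_plt ?posrE//; exact: truncnS_gt.
  have fin : exists C, forall n, (n < n0)%N -> p n f <= C.
    elim: n0 {n0d} => [|k [C hC]]; first by exists 0.
    exists (Num.max C (p k f)) => n; rewrite ltnS leq_eqVlt => /predU1P[->|/hC h].
      by rewrite le_max lexx orbT.
    by rewrite le_max h.
  have [C hC] := fin.
  exists (Num.max C (Num.max (p 0%N f + K0 * nX f) (nX f + 1))) => n.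
  have [nn0|n0n] := ltnP n n0; first by rewrite le_max hC.
  have [t00|tn0] := eqVneq (tf n).1 0.
    rewrite !le_max; apply/orP; right; apply/orP; left.
    rewrite {1}/p t00 (le_trans (hK0 _ If))// lerDr; exact: (nrm_ge0 wX_gt0).
  rewrite !le_max; apply/orP; right; apply/orP; right.
  have td : 0 < (tf n).1 < d.
    rewrite lt_def tn0 t0/=; have [/andP[_ +] _ _] := htf n.
    move=> /le_lt_trans; apply; apply: le_lt_trans n0d.
    by rewrite lef_pV2 ?posrE// ler_nat.
  have := dP _ td.
  have := nrm_lipschitz wX_gt0 measurable_wX (semigroup_inX (t0 n) If) If.
  rewrite ler_norml => /andP[_]; rewrite -/(p n f); lra.
pose n := (Num.truncn K).+1.
have [_ In] := htf n; apply/negP; rewrite -leNgt.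
apply: le_trans (hK n _ In) _.
by rewrite ler_wpM2r ?(nrm_ge0 wX_gt0)// ltW// truncnS_gt.
Qed.

(** With g = S c f and c slightly smaller than t, S t f - S s f equals S (s -
    c) (S (t - s) g - g): right continuity at 0 becomes left continuity at t
    because the operators S (s - c) are uniformly bounded. *)
Lemma semigroup_cvg_left t f : 0 < t -> inX f -> forall e, 0 < e ->
  exists2 d, 0 < d & forall s, 0 <= s -> t - d < s < t ->
    nX (fun x => S t f x - S s f x) <= e.
Proof.
move=> t0 If e e0; have [d [K [d0 [K0 hK]]]] := semigroup_locally_bounded.
pose c := Num.max 0 (t - d).
have c0 : 0 <= c by rewrite le_max lexx.
have ct : c < t by rewrite gt_max t0/= ltrBlDr ltrDl.
have tcd : t - c <= d by rewrite lerBlDr -lerBlDl le_max lexx orbT.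
pose g := S c f.
have Ig : inX g by exact: semigroup_inX.
have eK0 : 0 < e / (K + 1) by rewrite divr_gt0// ltr_wpDl.
have [d1 d10 d1P] := semigroup_continuous0 Ig eK0.
exists (Num.min d1 (t - c)); first by rewrite lt_min d10 subr_gt0.
move=> s s0 /andP[tds st].
have cs : 0 <= s - c.
  rewrite subr_ge0 ltW//; apply: le_lt_trans tds.
  by rewrite lerBrDl addrC -lerBrDl ge_min lexx orbT.
have scd : 0 <= s - c <= d by rewrite cs (le_trans _ tcd)// lerB// ltW.
have ts0 : 0 < t - s < d1.
  rewrite subr_gt0 st/= ltrBlDr -ltrBlDl; apply: le_lt_trans tds.
  by rewrite lerB// ge_min lexx.
have ts0' : 0 <= t - s by rewrite ltW//; case/andP: ts0.
have tE : t = (s - c) + ((t - s) + c) by ring.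
have sE : s = (s - c) + c by ring.
have tsc0 : 0 <= (t - s) + c by rewrite addr_ge0.
have I1 := semigroup_inX tsc0 If.
have I2 := semigroup_inX ts0' Ig.
rewrite (@nX_ae_eq _ (fun x => S (s - c) (S ((t - s) + c) f) x - S (s - c) g x)).
- apply: le_trans (semigroup_nXB cs (fun f => hK _ f scd) I1 Ig) _.
  rewrite (@nX_ae_eq _ (fun x => S (t - s) g x - g x)).
  + have := d1P _ ts0 => /ltW lt.
    apply: le_trans (ler_wpM2l K0 lt) _.
    rewrite mulrCA ler_piMr// ?ltW// ltr_pdivrMr ?mul1r ?ltrDl//.
    by rewrite ltr_wpDl.
  + exact: inLB.
  + exact: inLB.
  + have := semigroup_add ts0' c0 If.
    by apply: ae_weaken => x h x0; rewrite h.
- by apply: inLB; apply: semigroup_inX => //; exact: ltW.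
- by apply: inLB; exact: semigroup_inX.
- have := semigroup_add cs c0 If; rewrite -sE.
  have := semigroup_add cs tsc0 If; rewrite -tE.
  by apply: ae_weaken2 => x h1 h2 x0; rewrite h1// h2.
Qed.

End Semigroup.

(** * Orbits of the semigroup generated by T *)

Section Orbits.
Variables (R : realType) (m M : R).
Local Notation leb := (@lebesgue_measure R).
Local Notation D := (half_line R).
Local Notation nX := (nrm (wX m M)).
Local Notation inX := (inX m M).
Local Notation normX := (normX m M).
Variables (b : R -> {measure set (measurableTypeR R) -> \bar R})
          (beta : R -> R -> R).
Local Notation T_graph := (T_graph b beta m M).

Variable S : R -> (R -> R) -> R -> R.
Hypothesis ST : semigroup_of_T b beta m M S.

Let C0S : C0_semigroup m M S. Proof. by case: ST. Qed.
Let w_gt0 := @wX_gt0 R m M.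
Let mw := @measurable_wX R m M.

Lemma semigroup_lin3 t a1 a2 a3 f g h : 0 <= t -> inX f -> inX g -> inX h ->
  eqX (S t (fun x => a1 * f x + (a2 * g x + a3 * h x)))
      (fun x => a1 * S t f x + (a2 * S t g x + a3 * S t h x)).
Proof.
move=> t0 If Ig Ih.
have I0 : inX (fun=> 0) by exact: inL0.
have I1 : inX (fun x => a3 * h x) by exact: inLZ.
have I2 : inX (fun x => a2 * g x + a3 * h x) by apply: inLD => //; exact: inLZ.
have := semigroup_lin C0S a1 t0 If I2.
have E0 := semigroup_lin C0S (-1) t0 I0 I0.
have E1 := semigroup_lin C0S a2 t0 Ig I1.
have := semigroup_lin C0S a3 t0 Ih I0.
rewrite (_ : (fun x : R => -1 * 0 + 0) = (fun=> 0)) in E0; last first.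
  by apply/funext => x; rewrite mulr0 addr0.
under eq_fun do rewrite addr0.
move=> E2 E3.
apply: ae_weaken2 (ae_weaken2 (fun x p q => conj p q) E0 E1) (ae_weaken2 (fun x p q => conj p q) E2 E3).
move=> x [e0 e1] [e2 e3] x0.
have {}e0 : S t (fun=> 0) x = 0 by rewrite e0//; ring.
by rewrite e3// e1// e2// e0 addr0.
Qed.

Lemma generatorP f h : inX f -> inX h -> T_graph f h <->
  forall e, 0 < e -> exists2 d, 0 < d & forall s, 0 < s < d ->
    nX (fun x => (S s f x - f x) / s - h x) < e.
Proof.
move=> If Ih; have [_ /(_ f h If Ih) <-] := ST.
apply: normX_cvg0 => t t0.
apply: inLB => //; apply: (@eq_inL _ _ (fun x => t^-1 * (S t f x - f x))).
  by move=> x _; rewrite mulrC.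
apply: inLZ; apply: inLB => //; apply: (semigroup_inX C0S) => //; exact: ltW.
Qed.

(** S t commutes with the difference quotients of the semigroup, so it maps
    the domain of the generator into itself. *)
Lemma orbit_graph t f h : 0 <= t -> inX h -> T_graph f h ->
  T_graph (S t f) (S t h).
Proof.
move=> t0 Ih Tfh; have If : inX f by case: Tfh.
apply/generatorP; try exact: (semigroup_inX C0S).
move=> e e0; have [K hK] := semigroup_bounded C0S t0.
have K0 : 0 < `|K| + 1 by rewrite ltr_wpDl.
have [d d0 dP] := (generatorP If Ih).1 Tfh _ (divr_gt0 e0 K0).
exists d => // s sd; have {}dP := dP s sd.
have s0 : 0 < s by case/andP: sd.
have Is : inX (S s f) by apply: (semigroup_inX C0S) => //; exact: ltW.
pose q x := s^-1 * S s f x + (- s^-1 * f x + (-1) * h x).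
have qE : q = (fun x => (S s f x - f x) / s - h x).
  by apply/funext => x; rewrite /q; ring.
have Iq : inX q by do ! (apply: inLD || apply: inLZ).
rewrite (@nX_ae_eq _ _ _ _ (S t q)).
- apply: le_lt_trans (hK _ Iq) _; rewrite qE.
  apply: (@le_lt_trans _ _ ((`|K| + 1) * nX (fun x => (S s f x - f x) / s - h x))).
    rewrite ler_wpM2r ?(nrm_ge0 w_gt0)//.
    by rewrite (le_trans (ler_norm K))// lerDl.
  by rewrite mulrC -ltr_pdivlMr.
- apply: inLB; last exact: (semigroup_inX C0S).
  apply: (@eq_inL _ _ (fun x => s^-1 * (S s (S t f) x - S t f x))).
    by move=> x _; rewrite mulrC.
  apply: inLZ; apply: inLB; last exact: (semigroup_inX C0S).
  by apply: (semigroup_inX C0S); [exact: ltW | exact: (semigroup_inX C0S)].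
- exact: (semigroup_inX C0S).
- have E1 := semigroup_add C0S (ltW s0) t0 If.
  have := semigroup_add C0S t0 (ltW s0) If; rewrite addrC => E2.
  have E3 := semigroup_lin3 s^-1 (- s^-1) (-1) t0 Is If Ih.
  apply: ae_weaken2 E3 (ae_weaken2 (fun x p q => conj p q) E1 E2) => x e3 [e1 e2] x0.
  by rewrite /q e3// -e1// e2//; ring.
Qed.

(** The orbit stays in the domain by orbit_graph, so its right derivative at
    time t is that of the orbit issued from S t f at time 0. *)
Lemma orbit_derivative t f h : 0 <= t -> inX h -> T_graph f h ->
  forall e, 0 < e -> exists2 d, 0 < d & forall s, 0 < s < d ->
    nX (fun x => S (t + s) f x - (S t f x + s * S t h x)) <= e * s.
Proof.
move=> t0 Ih Tfh e e0; have If : inX f by case: Tfh.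
have It := semigroup_inX C0S t0 If.
have Iht := semigroup_inX C0S t0 Ih.
have [d d0 dP] := (generatorP It Iht).1 (orbit_graph t0 Ih Tfh) _ e0.
exists d => // s sd; have {dP}/ltW := dP s sd.
have s0 : 0 < s by case/andP: sd.
have Is : inX (S s (S t f)) by apply: (semigroup_inX C0S) => //; exact: ltW.
rewrite -[e * s]mulrC -(ler_pM2l s0) => /(le_trans _); apply.
rewrite -{3}(gtr0_norm s0) -(nrmZ w_gt0 mw); last first.
  apply: inLB => //; apply: (@eq_inL _ _ (fun x => s^-1 * (S s (S t f) x - S t f x))).
    by move=> x _; rewrite mulrC.
  by apply: inLZ; exact: inLB.
apply: eq_imp_le.
apply: nX_ae_eq.
- apply: inLB; last by apply: inLD => //; exact: inLZ.
  by apply: (semigroup_inX C0S) => //; rewrite addr_ge0// ltW.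
- apply: inLZ; apply: inLB => //.
  apply: (@eq_inL _ _ (fun x => s^-1 * (S s (S t f) x - S t f x))).
    by move=> x _; rewrite mulrC.
  by apply: inLZ; exact: inLB.
- have := semigroup_add C0S (ltW s0) t0 If; rewrite addrC.
  apply: ae_weaken => x h1 x0; rewrite h1//; field; exact: lt0r_neq0.
Qed.

(** The function exp(a t) Phi(S t f) is nonincreasing by dini_le: the
    Lipschitz bound replaces S (t + s) f by the Euler step S t f + s S t h at
    a cost o(s), and exp(a s) (1 - a s) <= 1. *)
Lemma orbit_decay (Phi : (R -> R) -> R) (L a : R) f h :
  0 <= a ->
  (forall f, inX f -> 0 <= Phi f) ->
  (forall f g, inX f -> inX g -> `|Phi f - Phi g| <= L * nX (fun x => f x - g x)) ->
  inX h -> T_graph f h ->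
  (forall t, 0 <= t -> forall e, 0 < e -> forall eta, 0 < eta ->
    exists2 s, 0 < s < eta &
      Phi (fun x => S t f x + s * S t h x) <= (1 - a * s) * Phi (S t f) + e * s) ->
  forall t, 0 <= t -> Phi (S t f) <= expR (- (a * t)) * Phi f.
Proof.
move=> a0 Phi0 PhiL Ih Tfh step t t0; have If : inX f by case: Tfh.
have I t' : 0 <= t' -> inX (S t' f) by move=> ?; exact: (semigroup_inX C0S).
pose L1 := `|L| + 1.
have L10 : 0 < L1 by rewrite ltr_wpDl.
have {}PhiL u v : inX u -> inX v -> `|Phi u - Phi v| <= L1 * nX (fun x => u x - v x).
  move=> Iu Iv; apply: le_trans (PhiL _ _ Iu Iv) _.
  rewrite ler_wpM2r ?(nrm_ge0 w_gt0)//.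
  by rewrite (le_trans (ler_norm L))// lerDl.
pose psi s := expR (a * s) * Phi (S s f).
have psi0 : psi 0 = Phi f.
  rewrite /psi mulr0 expR0 mul1r; apply/eqP; rewrite -subr_eq0 -normr_le0.
  apply: le_trans (PhiL _ _ (I _ (lexx 0)) If) _.
  rewrite (@nX_eq0 _ m M) ?mulr0//; first by apply: inLB => //; exact: I.
  by have := semigroup0 C0S If; apply: ae_weaken => x h1 x0; rewrite h1// subrr.
suff : psi t <= psi 0.
  rewrite psi0 /psi => le; rewrite expRN mulrC ler_pdivlMr ?expR_gt0//.
  by rewrite mulrC.
apply: dini_le => // {t t0} t t0.
- move=> e e0 eta eta0.
  pose E := expR (a * (t + 1)).
  have E0 : 0 < E by exact: expR_gt0.
  have L2 : 0 < 1 + L1 by rewrite addr_gt0.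
  pose k := e / (2 * E * (1 + L1)).
  have den0 : 0 < 2 * E * (1 + L1) by rewrite !mulr_gt0.
  have k0 : 0 < k by rewrite divr_gt0.
  have [d d0 dP] := orbit_derivative t0 Ih Tfh k0.
  have m0 : 0 < Num.min (Num.min eta d) 1 by rewrite !lt_min eta0 d0 ltr01.
  have [s /andP[s0 sm] sP] := step t t0 k k0 _ m0.
  move: sm; rewrite !lt_min => /andP[/andP[se sd] s1].
  exists s; first by rewrite s0.
  have ts0 : 0 <= t + s by rewrite addr_ge0// ltW.
  have Iv : inX (fun x => S t f x + s * S t h x).
    by apply: inLD; [exact: I | apply: inLZ; exact: (semigroup_inX C0S)].
  have := PhiL _ _ (I _ ts0) Iv.
  move=> /(le_trans (ler_norm _)).
  have := dP s; rewrite s0 sd => /(_ isT); rewrite -(ler_pM2l L10) => le1 le2.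
  have {le1 le2} : Phi (S (t + s) f) <= (1 - a * s) * Phi (S t f) + k * (1 + L1) * s.
    lra.
  rewrite /psi [a * (t + s)]mulrDr expRD.
  set P := Phi (S t f); set Q := Phi _ => QP.
  have P0 : 0 <= P by apply: Phi0; exact: I.
  have e1 : expR (a * s) * (1 - a * s) <= 1.
    rewrite -ler_pdivlMl ?expR_gt0// mulr1 -expRN; exact: expR_ge1Dx.
  have at0 := expR_gt0 (a * t).
  have as0 := expR_gt0 (a * s).
  have EE : expR (a * t) * expR (a * s) <= E.
    rewrite -expRD -mulrDr ler_expR ler_wpM2l// lerD2l ltW//.
  apply: (@le_trans _ _ (expR (a * t) * expR (a * s) * ((1 - a * s) * P + k * (1 + L1) * s))).
    by rewrite ler_wpM2l// ltW// mulr_gt0.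
  rewrite mulrDr; apply: lerD.
    rewrite -mulrA ler_wpM2l ?(ltW at0)// mulrA ler_piMl//.
  apply: (@le_trans _ _ (E * (k * (1 + L1) * s))).
    have kls : 0 <= k * (1 + L1) * s by rewrite mulr_ge0 ?(ltW s0)// mulr_ge0 ?(ltW k0)// addr_ge0 ?(ltW L10).
    by rewrite ler_wpM2r.
  have kE : E * (k * (1 + L1)) = e / 2.
    by rewrite /k; field; rewrite !gt_eqF.
  rewrite mulrA kE ler_pM2r//; lra.
- apply: cvgM.
    apply: cvg_at_left_filter.
    apply: continuous_comp; last exact: continuous_expR.
    by apply: cvgM; [exact: cvg_cst | exact: cvg_id].
  apply/cvgrPdist_le => e e0.
  have [d d0 dP] := semigroup_cvg_left C0S t0 If (divr_gt0 e0 L10).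
  have t2 : t - t < t by rewrite subrr.
  near=> s.
  have s0 : 0 <= s by apply/ltW; near: s; apply: nbhs_left_gt.
  apply: le_trans (PhiL _ _ (I _ (ltW t0)) (I _ s0)) _.
  rewrite mulrC -ler_pdivlMr//; apply: dP => //.
  apply/andP; split; near: s; last exact: nbhs_left_lt.
  by apply: nbhs_left_gt; rewrite ltrBlDr ltrDl.
Unshelve. all: by end_near.
Qed.

End Orbits.

(** * Scaling and Fubini on the half line *)

Section Scaling.
Variable R : realType.
Local Notation leb := (@lebesgue_measure R).
Local Notation D := (half_line R).

Variable c : {nonneg R}.
Hypothesis c0 : 0 < c%:num.

Let phi : measurableTypeR R -> measurableTypeR R := fun x => c%:num * x.

Let mphi : measurable_fun setT phi. Proof. exact: measurable_funM. Qed.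

Let scaled : {measure set (measurableTypeR R) -> \bar R} :=
  mscale c (measure_function_pushforward__canonical__measure_function_Measure leb mphi).

Let scaledE A : measurable A -> leb A = scaled A.
Proof.
move=> mA; apply: lebesgue_measure_unique => //= _ [[a b]] _ <-.
rewrite /scaled/= /mscale/= /pushforward.
have -> : phi @^-1` `]a, b]%classic =
    `](a / c%:num), (b / c%:num)]%classic.
  by apply/seteqP; split => x /=; rewrite !in_itv/= /phi ltr_pdivrMr//
    ler_pdivlMr// mulrC.
rewrite !lebesgue_measure_itv/= !lte_fin ltr_pM2r ?invr_gt0//.
case: ifPn => ab; last by rewrite mule0.
rewrite -!EFinD -EFinM; congr _%:E; field; exact: lt0r_neq0.
Qed.

Lemma ge0_integral_scale_nonneg (f : R -> \bar R) :
  measurable_fun D f -> (forall x, D x -> 0 <= f x)%E ->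
  (\int[leb]_(x in D) f x = c%:num%:E * \int[leb]_(x in D) f (c%:num * x)%R)%E.
Proof.
move=> mf f0.
rewrite (eq_measure_integral scaled); last by move=> A mA _; exact: scaledE.
rewrite ge0_integral_mscale//=.
rewrite ge0_integral_pushforward//; last by move=> x /[!inE]; exact: f0.
congr (_ * _)%E; congr (integral _ _ _).
apply/seteqP; split => x /=; rewrite !in_itv/= !andbT /phi.
  by rewrite pmulr_rgt0.
by move=> x0; rewrite mulr_gt0.
Qed.

End Scaling.

(** Lebesgue measure is c times its image under multiplication by c, as one
    sees on intervals. *)
Lemma ge0_integral_scale (R : realType) (c : R) (f : R -> \bar R) : 0 < c ->
  measurable_fun (half_line R) f -> (forall x, half_line R x -> 0 <= f x)%E ->
  (\int[@lebesgue_measure R]_(x in half_line R) f (c * x)%R =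
   (c^-1)%:E * \int[@lebesgue_measure R]_(x in half_line R) f x)%E.
Proof.
move=> c0 mf f0.
by rewrite [in RHS](@ge0_integral_scale_nonneg R (NngNum (ltW c0)))//= muleA -EFinM
  mulVf ?mul1e// gt_eqF.
Qed.

Section Quadrant.
Variable R : realType.
Local Notation leb := (@lebesgue_measure R).
Local Notation D := (half_line R).
Implicit Types (F : R -> R -> R) (f w : R -> R).

Definition measurable_quadrant F :=
  measurable_fun (D `*` D) (fun p : R * R => F p.1 p.2).

Lemma measurable_quadrant_set : measurable (D `*` D : set (R * R)).
Proof. exact: measurableX. Qed.
Local Hint Resolve measurable_quadrant_set : core.

Lemma measurable_quadrant_fst f : measurable_fun D f ->
  measurable_quadrant (fun x _ => f x).
Proof.
move=> mf; apply: (@measurable_comp _ _ _ _ _ _ D f _ (fst : R * R -> R)) => //.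
  by move=> _ [p [Dp _] <-].
exact: measurable_funTS.
Qed.

Lemma measurable_quadrant_snd f : measurable_fun D f ->
  measurable_quadrant (fun _ y => f y).
Proof.
move=> mf; apply: (@measurable_comp _ _ _ _ _ _ D f _ (snd : R * R -> R)) => //.
  by move=> _ [p [_ Dp] <-].
exact: measurable_funTS.
Qed.

Lemma measurable_quadrantM F G : measurable_quadrant F -> measurable_quadrant G ->
  measurable_quadrant (fun x y => F x y * G x y).
Proof. exact: measurable_funM. Qed.

(** The extension by zero of F to the plane, to which the theorems on product
    measures apply. *)
Let cut F : R * R -> \bar R :=
  EFin \o ((fun p : R * R => F p.1 p.2) \_ (D `*` D)).

Let cutE F x y : cut F (x, y) = (if (0 < x) && (0 < y) then F x y else 0)%:E.
Proof.
rewrite /cut/= patchE; congr _%:E.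
case: ifPn => [|]; rewrite ?inE/=.
  by rewrite !in_itv/= !andbT => -[-> ->].
move=> h; case: ifPn => // /andP[x0 y0].
by move: h; rewrite notin_setE/= !in_itv/= x0 y0 => /(_ (conj isT isT)).
Qed.

Let measurable_cut F : measurable_quadrant F -> measurable_fun setT (cut F).
Proof.
move=> mF; apply: measurableT_comp => //.
apply/(measurable_restrictT _ _).1 => //; exact: mF.
Qed.

Let cut_ge0 F : (forall x y, 0 < x -> 0 < y -> 0 <= F x y) ->
  forall p, (0 <= cut F p)%E.
Proof.
by move=> F0 [x y]; rewrite cutE lee_fin; case: ifPn => // /andP[? ?]; exact: F0.
Qed.

Let cut_row F x : 0 < x ->
  (\int[leb]_(y in D) (F x y)%:E = \int[leb]_y cut F (x, y))%E.
Proof.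
move=> x0; rewrite integral_mkcond; apply: eq_integral => y _.
rewrite cutE x0/= patchE; case: ifPn; rewrite ?inE ?notin_setE half_lineE.
  by move=> ->.
by move=> /negP/negbTE ->.
Qed.

Let cut_col F y : 0 < y ->
  (\int[leb]_(x in D) (F x y)%:E = \int[leb]_x cut F (x, y))%E.
Proof.
move=> y0; rewrite integral_mkcond; apply: eq_integral => x _.
rewrite cutE y0/= patchE; case: ifPn; rewrite ?inE ?notin_setE half_lineE.
  by move=> ->.
by move=> /negP/negbTE ->.
Qed.

Let cut_row0 F x : ~~ (0 < x) -> (\int[leb]_y cut F (x, y) = 0)%E.
Proof.
by move=> /negbTE x0; apply: integral0_eq => y _; rewrite cutE x0.
Qed.

Let cut_col0 F y : ~~ (0 < y) -> (\int[leb]_x cut F (x, y) = 0)%E.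
Proof.
by move=> /negbTE x0; apply: integral0_eq => x _; rewrite cutE x0 andbF.
Qed.

Let cut_rowcol F : (\int[leb]_(x in D) \int[leb]_(y in D) (F x y)%:E =
  \int[leb]_x \int[leb]_y cut F (x, y))%E.
Proof.
rewrite integral_mkcond; apply: eq_integral => x _.
rewrite patchE; case: ifPn; rewrite ?inE ?notin_setE half_lineE.
  by move=> x0; exact: cut_row.
by move=> /negP/cut_row0 ->.
Qed.

Let cut_colrow F : (\int[leb]_(y in D) \int[leb]_(x in D) (F x y)%:E =
  \int[leb]_y \int[leb]_x cut F (x, y))%E.
Proof.
rewrite integral_mkcond; apply: eq_integral => x _.
rewrite patchE; case: ifPn; rewrite ?inE ?notin_setE half_lineE.
  by move=> x0; exact: cut_col.
by move=> /negP/cut_col0 ->.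
Qed.

Lemma tonelli_quadrant F : measurable_quadrant F ->
  (forall x y, 0 < x -> 0 < y -> 0 <= F x y) ->
  (\int[leb]_(x in D) \int[leb]_(y in D) (F x y)%:E =
   \int[leb]_(y in D) \int[leb]_(x in D) (F x y)%:E)%E.
Proof.
move=> mF F0; rewrite cut_rowcol cut_colrow.
apply: (@fubini_tonelli _ _ _ _ _ leb leb (cut F)).
  exact: measurable_cut.
exact: cut_ge0.
Qed.

Lemma measurable_tonelli_row F : measurable_quadrant F ->
  (forall x y, 0 < x -> 0 < y -> 0 <= F x y) ->
  measurable_fun D (fun x => \int[leb]_(y in D) (F x y)%:E)%E.
Proof.
move=> mF F0; apply: (@eq_measurable_fun _ _ _ _ D (fun x => \int[leb]_y cut F (x, y))%E).
  by move=> x /[!inE]; rewrite half_lineE => x0; rewrite cut_row.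
apply: measurable_funTS.
apply: (@measurable_fun_fubini_tonelli_F _ _ _ _ _ leb (cut F)).
  exact: measurable_cut.
exact: cut_ge0.
Qed.

Lemma measurable_row F x : 0 < x -> measurable_quadrant F -> measurable_fun D (F x).
Proof.
move=> x0 mF; apply/measurable_EFinP.
apply: (@eq_measurable_fun _ _ _ _ D (fun y => cut F (x, y))).
  by move=> y /[!inE]; rewrite half_lineE => y0; rewrite cutE x0 y0.
apply: measurable_funTS.
exact: (measurableT_comp (measurable_cut mF) (pair1_measurable x)).
Qed.

Lemma measurable_fubini_row F : measurable_quadrant F ->
  measurable_fun D (fun x => \int[leb]_(y in D) (F x y)).
Proof.
move=> mF; apply: (measurableT_comp (fine_measurable measurableT)).
have mpos : measurable_quadrant (fun x y => Num.max (F x y) 0).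
  exact: measurable_funrpos.
have mneg : measurable_quadrant (fun x y => Num.max (- F x y) 0).
  exact: measurable_funrneg.
apply: (@eq_measurable_fun _ _ _ _ D (fun x =>
    \int[leb]_(y in D) (Num.max (F x y) 0)%:E - \int[leb]_(y in D) (Num.max (- F x y) 0)%:E)%E).
  move=> x /[!inE]; rewrite half_lineE => x0; rewrite [RHS]integralE.
  congr (_ - _)%E; apply: eq_integral => y _.
    by rewrite funeposE EFin_max.
  by rewrite funenegE -EFinN EFin_max.
by apply: emeasurable_funB; apply: measurable_tonelli_row => // x y _ _;
  rewrite le_max lexx orbT.
Qed.

Lemma fubini_quadrant F : measurable_quadrant F ->
  (\int[leb]_(x in D) \int[leb]_(y in D) `|F x y|%:E < +oo)%E ->
  \int[leb]_(x in D) \int[leb]_(y in D) F x y =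
  \int[leb]_(y in D) \int[leb]_(x in D) F x y.
Proof.
move=> mF Foo.
have If : (leb \x leb)%E.-integrable setT (cut F).
  apply/integrable12ltyP; first exact: measurable_cut.
  move: Foo; rewrite cut_rowcol; apply: le_lt_trans.
  apply: eq_imp_le.
  apply: eq_integral => x _; apply: eq_integral => y _.
  by rewrite !cutE; case: ifPn => _ //; rewrite abse0.
have := @Fubini _ _ _ _ _ leb leb _ If.
have fin (g : R -> \bar R) : measurable_fun setT g ->
   {ae leb, forall x, g x \is a fin_num} ->
   ((\int[leb]_x g x = \int[leb]_x (fine (g x))%:E))%E.
  move=> mg gfin; apply: ae_eq_integral => //.
    apply/measurable_EFinP; apply: (measurableT_comp (fine_measurable measurableT)).
    exact: mg.
  by apply: ae_weaken gfin => x gx _; rewrite fineK.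
have fF := fin _ (measurable_fubini_F If) _.
have fG := fin _ (measurable_fubini_G If) _.
have {}fF := fF (ae_weaken (fun x => @integrable_fin_num _ _ _ leb _ measurableT _) (ae_integrable1 If)).
have {}fG := fG (ae_weaken (fun x => @integrable_fin_num _ _ _ leb _ measurableT _) (ae_integrable2 If)).
rewrite /fubini_F/= in fF; rewrite /fubini_G/= in fG.
rewrite fF fG => FG.
rewrite /Rintegral integral_mkcond [in RHS]integral_mkcond; congr fine.
apply: etrans (etrans FG _); apply: eq_integral => x _; rewrite patchE;
  case: ifPn; rewrite ?inE ?notin_setE half_lineE.
- by move=> x0; rewrite -cut_row.
- by move=> /negP/cut_row0 ->.
- by move=> x0; rewrite -cut_col.
- by move=> /negP/cut_col0 ->.
Qed.

End Quadrant.

(** * Positive integral operators *)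

Section KernelOperator.
Variable R : realType.
Local Notation leb := (@lebesgue_measure R).
Local Notation D := (half_line R).
Implicit Types (f : R -> R).

Definition kernel_op (k : R -> R -> R) f (x : R) : R :=
  \int[leb]_(y in D) (k x y * f y).

Variables (k : R -> R -> R).
Hypothesis mk : measurable_quadrant k.
Hypothesis k_ge0 : forall x y, 0 < x -> 0 < y -> 0 <= k x y.

Lemma measurable_kernel_op f : measurable_fun D f -> measurable_fun D (kernel_op k f).
Proof.
move=> mf; apply: (@measurable_fubini_row _ (fun x y => k x y * f y)).
by apply: measurable_quadrantM => //; exact: measurable_quadrant_snd.
Qed.

Lemma abse_fine_le (z : \bar R) : (`|fine z|%:E <= `|z|)%E.
Proof. by case: z => [r| |]//=; rewrite normr0 leey. Qed.

Variables (w v : R -> R).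
Hypothesis w_gt0 : forall x, 0 < x -> 0 < w x.
Hypothesis mw : measurable_fun D w.
Hypothesis v_gt0 : forall x, 0 < x -> 0 < v x.
Hypothesis mv : measurable_fun D v.
Hypothesis kwv : forall y, 0 < y ->
  (\int[leb]_(x in D) (w x * k x y)%:E <= (v y)%:E)%E.

Let measurable_wkf f : measurable_fun D f ->
  measurable_quadrant (fun x y => w x * (k x y * `|f y|)).
Proof.
move=> mf; apply: measurable_quadrantM; first exact: measurable_quadrant_fst.
apply: measurable_quadrantM => //; apply: measurable_quadrant_snd.
exact: measurableT_comp.
Qed.

Let wkf_ge0 f x y : 0 < x -> 0 < y -> 0 <= w x * (k x y * `|f y|).
Proof. by move=> x0 y0; rewrite !mulr_ge0// ?k_ge0// ltW// w_gt0. Qed.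

Let kernel_op_double f : inL v f ->
  (\int[leb]_(x in D) \int[leb]_(y in D) (w x * (k x y * `|f y|))%:E <= (nrm v f)%:E)%E.
Proof.
move=> If; have mf := inL_measurable v_gt0 mv If.
rewrite tonelli_quadrant; [|exact: measurable_wkf|exact: wkf_ge0].
rewrite EFin_nrm//; apply: ge0_le_integral => //.
- move=> y; rewrite half_lineE => y0; apply: integral_ge0 => x.
  by rewrite half_lineE => x0; rewrite lee_fin wkf_ge0.
- apply: (@measurable_tonelli_row _ (fun y x => w x * (k x y * `|f y|))).
    have mswap : measurable_fun (D `*` D) (fun p : R * R => (p.2, p.1)).
      by apply: measurable_funTS; exact: measurable_swap.
    apply: (measurable_comp (F := D `*` D) _ _ (measurable_wkf mf) mswap).
      exact: measurable_quadrant_set.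
    by move=> _ [p [p1 p2] <-].
  by move=> y x y0 x0; exact: wkf_ge0.
- apply/measurable_EFinP/measurable_funM => //; exact: measurableT_comp.
- move=> y; rewrite half_lineE => y0.
  have -> : (\int[leb]_(x in D) (w x * (k x y * `|f y|))%:E =
      \int[leb]_(x in D) ((`|f y|)%:E * (w x * k x y)%:E))%E.
    by apply: eq_integral => x _; rewrite -EFinM; congr _%:E; ring.
  rewrite ge0_integralZl_EFin//; last first.
    apply/measurable_EFinP/measurable_funM => //.
    have mswap : measurable_fun (D `*` D) (fun p : R * R => (p.2, p.1)).
      by apply: measurable_funTS; exact: measurable_swap.
    apply: (@measurable_row _ (fun y x => k x y)) => //.
    apply: (measurable_comp (F := D `*` D) _ _ mk mswap).
      exact: measurable_quadrant_set.
    by move=> _ [p [p1 p2] <-].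
  - by move=> x; rewrite half_lineE => x0; rewrite lee_fin mulr_ge0 ?k_ge0// ltW// w_gt0.
  by rewrite mulrC EFinM lee_wpmul2l ?lee_fin// kwv.
Qed.

Let kernel_op_le f x : measurable_fun D f -> 0 < x ->
  ((w x * `|kernel_op k f x|)%:E <= \int[leb]_(y in D) (w x * (k x y * `|f y|))%:E)%E.
Proof.
move=> mf x0.
have mkf : measurable_fun D (fun y => k x y * f y).
  by apply: measurable_funM => //; exact: measurable_row.
have -> : (\int[leb]_(y in D) (w x * (k x y * `|f y|))%:E =
    \int[leb]_(y in D) ((w x)%:E * (k x y * `|f y|)%:E))%E by [].
rewrite ge0_integralZl_EFin//; last 3 first.
- by move=> y; rewrite half_lineE => y0; rewrite lee_fin mulr_ge0// k_ge0.
- apply/measurable_EFinP/measurable_funM; first exact: measurable_row.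
  exact: measurableT_comp.
- exact/ltW/w_gt0.
rewrite EFinM lee_wpmul2l ?lee_fin ?(ltW (w_gt0 x0))//.
apply: le_trans (abse_fine_le _) _.
apply: le_trans (le_abse_integral _ _ _) _ => //; first exact/measurable_EFinP.
apply: eq_imp_le; apply: eq_integral => y /[!inE].
by rewrite half_lineE => y0; rewrite abse_EFin normrM ger0_norm// k_ge0.
Qed.

Let kernel_op_int f : inL v f ->
  (\int[leb]_(x in D) (w x * `|kernel_op k f x|)%:E <= (nrm v f)%:E)%E.
Proof.
move=> If; have mf := inL_measurable v_gt0 mv If.
apply: le_trans (kernel_op_double If); apply: ge0_le_integral => //.
- by move=> x; rewrite half_lineE => x0; rewrite lee_fin mulr_ge0// ltW// w_gt0.
- apply/measurable_EFinP/measurable_funM => //; apply: measurableT_comp => //.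
  exact: measurable_kernel_op.
- apply: (@measurable_tonelli_row _ (fun x y => w x * (k x y * `|f y|))).
    exact: measurable_wkf.
  exact: wkf_ge0.
- by move=> x; rewrite half_lineE => x0; exact: kernel_op_le.
Qed.

Lemma kernel_op_inL f : inL v f -> inL w (kernel_op k f).
Proof.
move=> If; have mf := inL_measurable v_gt0 mv If.
apply/integrableP; split.
  by apply/measurable_EFinP/measurable_funM => //; exact: measurable_kernel_op.
apply: le_lt_trans (ltry (nrm v f)).
apply: le_trans (kernel_op_int If); apply: eq_imp_le.
apply: eq_integral => y /[!inE]; rewrite half_lineE => y0.
by rewrite abse_EFin normrM gtr0_norm// w_gt0.
Qed.

(** By Tonelli, a bound on the weighted integral of each column x |-> k x y by
    v y bounds the operator from the weight v to the weight w. *)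
Lemma kernel_op_nrm f : inL v f -> nrm w (kernel_op k f) <= nrm v f.
Proof.
move=> If; rewrite -lee_fin EFin_nrm//; first exact: kernel_op_int.
exact: kernel_op_inL.
Qed.

Lemma kernel_op_fubini_le (z f : R -> R) : measurable_fun D z ->
  (forall x, 0 < x -> `|z x| <= w x) -> inL v f ->
  (forall x, 0 < x -> leb.-integrable D (EFin \o (fun y => k x y * f y))) ->
  \int[leb]_(x in D) (z x * kernel_op k f x) =
  \int[leb]_(y in D) \int[leb]_(x in D) (z x * (k x y * f y)).
Proof.
move=> mz zw If Ikf; have mf := inL_measurable v_gt0 mv If.
have mzkf : measurable_quadrant (fun x y => z x * (k x y * f y)).
  apply: measurable_quadrantM; first exact: measurable_quadrant_fst.
  by apply: measurable_quadrantM => //; apply: measurable_quadrant_snd.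
have mabs : measurable_quadrant (fun x y => `|z x * (k x y * f y)|).
  exact: measurableT_comp.
rewrite -(@fubini_quadrant _ (fun x y => z x * (k x y * f y)))//.
  apply: eq_Rintegral => x /[!inE]; rewrite half_lineE => x0.
  by rewrite RintegralZl//; exact: Ikf.
apply: le_lt_trans (ltry (nrm v f)).
apply: le_trans (kernel_op_double If).
apply: ge0_le_integral => //.
- by move=> x _; apply: integral_ge0 => y _; rewrite lee_fin.
- by apply: (measurable_tonelli_row mabs) => x y _ _.
- by apply: (measurable_tonelli_row (measurable_wkf mf)); exact: wkf_ge0.
move=> x; rewrite half_lineE => x0; apply: ge0_le_integral => //.
- by apply/measurable_EFinP; exact: (measurable_row x0 mabs).
- by apply/measurable_EFinP; exact: (measurable_row x0 (measurable_wkf mf)).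
move=> y; rewrite half_lineE => y0.
rewrite lee_fin (normrM (z x)) normrM (ger0_norm (k_ge0 x0 y0)).
by rewrite ler_wpM2r ?zw// mulr_ge0// k_ge0.
Qed.

Lemma kernel_op_fubini f : inL v f ->
  (forall x, 0 < x -> leb.-integrable D (EFin \o (fun y => k x y * f y))) ->
  \int[leb]_(x in D) (w x * kernel_op k f x) =
  \int[leb]_(y in D) \int[leb]_(x in D) (w x * (k x y * f y)).
Proof. by apply: kernel_op_fubini_le => // x x0; rewrite gtr0_norm// w_gt0. Qed.

End KernelOperator.

(** * Logarithmic averages *)

Section DilationWeights.
Variable R : realType.
Implicit Types (w : R -> R).

(** The weight varies by a bounded factor between points with ratio at most
    1/(1 - s). The exponent 4 covers all powers that occur: they are sums of
    an exponent below 2 and of gamma < 2. *)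
Definition dilation_weight w := forall s x y, 0 < s < 1 -> 0 < y ->
  y <= x <= y / (1 - s) -> w x <= (1 - s) ^- 4 * w y.

Lemma dilation_weight_pow (p : R) : 0 <= p <= 4 ->
  dilation_weight (fun x => x `^ p).
Proof.
move=> /andP[p0 p4] s x y /andP[s0 s1] y0 /andP[yx xy].
have r0 : 0 < 1 - s by rewrite subr_gt0.
have r1 : 1 <= (1 - s)^-1 by rewrite invf_ge1// lerBlDr lerDl ltW.
have x0 : 0 < x by exact: lt_le_trans yx.
apply: (@le_trans _ _ ((y / (1 - s)) `^ p)).
  by apply: ge0_ler_powR => //; rewrite nnegrE ltW// divr_gt0.
rewrite powRM ?(ltW y0) ?invr_ge0 ?(ltW r0)// mulrC ler_wpM2r ?powR_ge0//.
rewrite -exprVn -powR_mulrn ?invr_ge0 ?(ltW r0)//.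
by rewrite ler_powR.
Qed.

Lemma dilation_weightD w1 w2 : dilation_weight w1 -> dilation_weight w2 ->
  dilation_weight (fun x => w1 x + w2 x).
Proof.
by move=> h1 h2 s x y hs y0 yx; rewrite mulrDr lerD// ?h1// h2.
Qed.

Lemma dilation_weightZ w (c : R) : 0 <= c -> dilation_weight w ->
  dilation_weight (fun x => c * w x).
Proof.
by move=> c0 h s x y hs y0 yx; rewrite mulrCA ler_wpM2l// h.
Qed.

End DilationWeights.

Lemma measurable_inv d (T : measurableType d) (R : realType) (A : set T) (f : T -> R) :
  (forall x, A x -> 0 < f x) -> measurable_fun A f ->
  measurable_fun A (fun x => (f x)^-1).
Proof.
move=> f0 mf; apply: (@eq_measurable_fun _ _ _ _ A (fun x => f x `^ (-1))).
  by move=> x /[!inE] Ax; rewrite powR_inv1// ltW// f0.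
exact: (measurableT_comp (measurable_powR _)).
Qed.

Section Average.
Variable R : realType.
Local Notation leb := (@lebesgue_measure R).
Local Notation D := (half_line R).
Implicit Types (f : R -> R).

Definition logav_kernel (s x y : R) : R :=
  if ((1 - s) * x < y) && (y <= x) then (s * y)^-1 else 0.

(** The average over ](1 - s) x, x] against dy/y, normalized by 1/s. Applied
    to y f'(y) it is the difference quotient (f(x) - f((1 - s) x)) / s, so it
    links the transport operator x f' with dilations. *)
Definition logav (s : R) f := kernel_op (logav_kernel s) f.

Lemma measurable_logav_kernel s : 0 < s -> measurable_quadrant (logav_kernel s).
Proof.
move=> s0; have mfst : measurable_quadrant (fun x _ : R => x).
  by apply: measurable_quadrant_fst.
have msnd : measurable_quadrant (fun _ y : R => y).
  by apply: measurable_quadrant_snd.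
apply: measurable_fun_if => //; first exact: measurable_quadrant_set.
- apply: measurable_and.
    by apply: measurable_fun_ltr => //; exact: measurable_funM.
  by apply: measurable_fun_ler.
- apply: (@measurable_funS _ _ _ _ (D `*` D)).
  - exact: measurable_quadrant_set.
  - exact: subIsetl.
  - apply: measurable_inv; last by apply: measurable_funM.
    by move=> p [_]; rewrite half_lineE => p0; rewrite mulr_gt0.
Qed.

Variable w : R -> R.
Hypothesis w_gt0 : forall x, 0 < x -> 0 < w x.
Hypothesis mw : measurable_fun D w.
Hypothesis dw : dilation_weight w.

Section AverageBound.
Variable s : R.
Hypothesis s01 : 0 < s < 1.

Let s0 : 0 < s. Proof. by case/andP: s01. Qed.
Let s1 : 0 < 1 - s. Proof. by case/andP: s01 => _; rewrite subr_gt0. Qed.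

Lemma logav_kernel_ge0 x y : 0 < x -> 0 < y -> 0 <= logav_kernel s x y.
Proof. by move=> x0 y0; rewrite /logav_kernel; case: ifPn => // _; rewrite invr_ge0 mulr_ge0// ltW. Qed.

(** The column at y lives on [y, y/(1 - s)[. There the weight loses at most (1
    - s)^-4, and one more power comes from the length s y/(1 - s) of the
    interval divided by s y. *)
Let kwv y : 0 < y ->
  (\int[leb]_(x in D) (w x * logav_kernel s x y)%:E <= ((1 - s) ^- 5 * w y)%:E)%E.
Proof.
move=> y0; have ys0 : 0 < y / (1 - s) by rewrite divr_gt0.
pose I := `[y, (y / (1 - s))[%classic : set R.
pose C := (1 - s) ^- 4 * w y * (s * y)^-1.
have C0 : 0 <= C.
  by rewrite mulr_ge0 ?invr_ge0 ?mulr_ge0 ?exprn_ge0 ?invr_ge0// ?ltW// ?exprn_gt0// w_gt0.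
apply: (@le_trans _ _ (\int[leb]_(x in I) (cst C%:E) x)%E).
  rewrite integral_mkcond [leRHS]integral_mkcond.
  apply: ge0_le_integral => //.
  - move=> x _; rewrite patchE; case: ifPn => //; rewrite inE half_lineE => x0.
    by rewrite lee_fin mulr_ge0 ?logav_kernel_ge0// ltW// w_gt0.
  - apply/(measurable_restrictT _ _).1 => //.
    apply/measurable_EFinP/measurable_funM => //.
    apply: (@measurable_row _ (fun y x => logav_kernel s x y)) => //.
    have mswap : measurable_fun (D `*` D) (fun p : R * R => (p.2, p.1)).
      by apply: measurable_funTS; exact: measurable_swap.
    apply: (measurable_comp (F := D `*` D) _ _ (measurable_logav_kernel s0) mswap).
      exact: measurable_quadrant_set.
    by move=> _ [p [p1 p2] <-].
  - apply/(measurable_restrictT _ _).1 => //; exact: measurable_itv.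
  - move=> x _; rewrite patchE; case: ifPn => [|_]; last first.
      by rewrite patchE; case: ifPn => // _; rewrite lee_fin.
    rewrite inE half_lineE => x0; rewrite /logav_kernel; case: ifPn => [/andP[xy yx]|_]; last first.
      by rewrite mulr0 patchE; case: ifPn => // _; rewrite lee_fin.
    have xys : x < y / (1 - s) by rewrite ltr_pdivlMr// mulrC.
    rewrite patchE ifT; last by rewrite inE /I/= in_itv/= yx.
    rewrite lee_fin ler_wpM2r ?invr_ge0 ?mulr_ge0 ?(ltW s0) ?(ltW y0)//.
    by apply: dw => //; rewrite yx ltW.
rewrite integral_cst/=; last exact: measurable_itv.
rewrite lebesgue_measure_itv/= lte_fin.
have -> : y < y / (1 - s).
  by rewrite ltr_pdivlMr// -[ltRHS]mulr1 ltr_pM2l// ltrBlDr ltrDl.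
rewrite -EFinD -EFinM lee_fin; apply: eq_imp_le.
rewrite /C; field; apply/andP; split; first exact: lt0r_neq0.
by apply/andP; split; exact: lt0r_neq0.
Qed.

Let v y := (1 - s) ^- 5 * w y.

Let v_gt0 y : 0 < y -> 0 < v y.
Proof. by move=> y0; rewrite mulr_gt0 ?invr_gt0 ?exprn_gt0// w_gt0. Qed.

Let mv : measurable_fun D v.
Proof. exact: measurable_funM. Qed.

Let inLv f : inL w f -> inL v f.
Proof.
move=> If; have := inLZ ((1 - s) ^- 5) If.
rewrite /inL; apply: eq_integrable => // x _.
by rewrite /v mulrCA mulrA.
Qed.

Lemma logav_inL f : inL w f -> inL w (logav s f).
Proof.
move=> If; apply: (@kernel_op_inL _ _ (measurable_logav_kernel s0) logav_kernel_ge0 w v) => //.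
exact: inLv.
Qed.

Lemma logav_nrm f : inL w f -> nrm w (logav s f) <= (1 - s) ^- 5 * nrm w f.
Proof.
move=> If.
have := @kernel_op_nrm _ _ (measurable_logav_kernel s0) logav_kernel_ge0 w v w_gt0 mw v_gt0 mv kwv f (inLv If).
move=> /le_trans; apply; rewrite /nrm -RintegralZl//; last exact: (inL_int w_gt0 mw).
apply: eq_imp_le.
by apply: eq_Rintegral => x _; rewrite mulrA.
Qed.

Lemma logav_integrable f x : inL w f -> 0 < x ->
  leb.-integrable D (EFin \o (fun y => logav_kernel s x y * f y)).
Proof.
move=> If x0; have mf := inL_measurable w_gt0 mw If.
pose C := (s * ((1 - s) * x))^-1 * ((1 - s) ^- 4 * (w x)^-1).
have C0 : 0 <= C by rewrite !mulr_ge0 ?invr_ge0 ?mulr_ge0 ?exprn_ge0// ltW// w_gt0.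
have := inLZ C If; rewrite /inL; apply: le_integrable => //.
  apply/measurable_EFinP/measurable_funM => //.
  by apply: (@measurable_row _ (logav_kernel s)) => //; exact: measurable_logav_kernel.
move=> y; rewrite half_lineE => y0 /=.
rewrite lee_fin (normrM (w y)) (normrM C) (normrM (logav_kernel s x y)) (gtr0_norm (w_gt0 y0)) (ger0_norm C0).
rewrite (ger0_norm (logav_kernel_ge0 x0 y0)) mulrA ler_wpM2r//.
rewrite /logav_kernel; case: ifPn => [/andP[xy yx]|_]; last first.
  by rewrite mulr_ge0// ltW// w_gt0.
have x1 : 0 < (1 - s) * x by rewrite mulr_gt0.
have h : 1 <= w y * ((1 - s) ^- 4 * (w x)^-1).
  rewrite mulrA ler_pdivlMr ?w_gt0// mul1r mulrC.
  by apply: dw => //; rewrite yx ler_pdivlMr// mulrC ltW.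
rewrite /C mulrCA -[leLHS]mulr1 ler_pM ?invr_ge0 ?mulr_ge0 ?(ltW s0) ?(ltW y0)//.
by rewrite lef_pV2 ?posrE ?mulr_gt0// ler_pM2l// ltW.
Qed.

Lemma logav_fubini (z f : R -> R) : measurable_fun D z ->
  (forall x, 0 < x -> `|z x| <= w x) -> inL w f ->
  \int[leb]_(x in D) (z x * logav s f x) =
  \int[leb]_(y in D) \int[leb]_(x in D) (z x * (logav_kernel s x y * f y)).
Proof.
move=> mz zw If.
apply: (@kernel_op_fubini_le _ _ (measurable_logav_kernel s0) logav_kernel_ge0 w v) => //.
  exact: inLv.
by move=> x x0; exact: logav_integrable.
Qed.

Lemma logav_B f g x : inL w f -> inL w g -> 0 < x ->
  logav s (fun y => f y - g y) x = logav s f x - logav s g x.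
Proof.
move=> If Ig x0; rewrite /logav /kernel_op -RintegralB//; try exact: logav_integrable.
by apply: eq_Rintegral => y _; rewrite mulrBr.
Qed.

Lemma logavE f x : 0 < x ->
  logav s f x = \int[leb]_(y in `](1 - s) * x, x]) (f y / (s * y)).
Proof.
move=> x0; rewrite /logav /kernel_op Rintegral_mkcond [RHS]Rintegral_mkcond.
have x1 : 0 < (1 - s) * x by rewrite mulr_gt0.
apply: eq_Rintegral => y _; rewrite !patchE.
have [/[!inE]/= yI|] := boolP (y \in _); last first.
  move=> /negP yI; case: ifPn => // /[!inE]/=; rewrite in_itv/= => /andP[h _].
  by exfalso; apply: yI; rewrite inE half_lineE (lt_trans x1).
rewrite /logav_kernel; case: ifPn => [h|/negP h].
  by rewrite ifT ?inE/= ?in_itv//= mulrC.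
by rewrite mul0r; case: ifPn => // /[!inE]/=; rewrite in_itv/= => /h.
Qed.

End AverageBound.
End Average.

(** * Convergence of logarithmic averages *)

Section AverageLimit.
Variable R : realType.
Local Notation leb := (@lebesgue_measure R).
Local Notation D := (half_line R).
Implicit Types (f : R -> R).

(** One null sequence of step sizes is enough for dini_le. The shift by 2
    keeps the steps in ]0, 1/2]. *)
Definition step (n : nat) : R := n.+2%:R^-1.

Lemma step_gt0 n : 0 < step n.
Proof. by rewrite invr_gt0. Qed.

Lemma step_le_half n : step n <= 2^-1.
Proof. by rewrite lef_pV2 ?posrE// ler_nat. Qed.

Lemma step_itv n : 0 < step n < 1.
Proof. by rewrite step_gt0 (le_lt_trans (step_le_half n))// invf_lt1// ltr1n. Qed.

Lemma cvg_step : step n @[n --> \oo] --> (0 : R).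
Proof.
rewrite /step; have := @cvg_harmonic R.
by rewrite -(cvg_shiftS (@harmonic R)).
Qed.

Lemma step_lt (e : R) : 0 < e -> exists n0, forall n, (n0 <= n)%N -> step n < e.
Proof.
move=> e0; have /cvgrPdist_lt /(_ _ e0) [n0 _ h] := cvg_step.
exists n0 => n n0n; have := h n n0n; rewrite /= sub0r normrN ger0_norm//.
exact/ltW/step_gt0.
Qed.

(** Shrinking sets are required at every real x, also at x <= 0 where the
    interval ](1 - s) x, x] is useless; the default 1 keeps it nonempty there. *)
Let r (x : R) : R := if 0 < x then x else 1.
Let r_gt0 x : 0 < r x. Proof. by rewrite /r; case: ifPn. Qed.
Let E (x : R) (n : nat) : set R := `](x - step n * r x), x]%classic.

Let leb_E x n : leb (E x n) = (step n * r x)%:E.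
Proof.
rewrite /E lebesgue_measure_itv/= lte_fin ifT.
  by rewrite -EFinB; congr _%:E; ring.
by rewrite ltrBlDr ltrDl mulr_gt0// step_gt0.
Qed.

Let shrinkE x : nicely_shrinking x (E x).
Proof.
split; first by move=> n; exact: measurable_itv.
have p n : 0 < 2 * (step n * r x) by rewrite !mulr_gt0// step_gt0.
exists (4, fun n => PosNum (p n)); split => //=.
- have -> : (0 : R) = 2 * (0 * r x) by ring.
  apply: cvgM; first exact: cvg_cst.
  by apply: cvgM; [exact: cvg_step | exact: cvg_cst].
- move=> n y /=; rewrite /E/= in_itv/= => /andP[xy yx].
  rewrite /ball/= ger0_norm ?subr_ge0//.
  have := p n; move: xy; set q := step n * r x; lra.
- move=> n; rewrite lebesgue_measure_ball; last exact: ltW.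
  rewrite leb_E -EFinM lee_fin.
  by rewrite -mulr_natl; set q := step n * r x; lra.
Qed.

Variable w : R -> R.
Hypothesis w_gt0 : forall x, 0 < x -> 0 < w x.
Hypothesis mw : measurable_fun D w.
Hypothesis dw : dilation_weight w.

(** A compact exhaustion of the half line. Dilation weights are bounded from
    below on it, so that weighted integrability gives plain integrability
    there. *)
Definition window (j : nat) : set R := `[j.+2%:R^-1, j.+2%:R]%classic.

Lemma measurable_window j : measurable (window j).
Proof. exact: measurable_itv. Qed.

Lemma window_gt0 j x : window j x -> 0 < x.
Proof.
by rewrite /window/= in_itv/= => /andP[+ _]; apply: lt_le_trans; rewrite invr_gt0.
Qed.

Lemma weight_window j : exists2 C, 0 < C & forall y, window j y -> 1 <= C * w y.
Proof.
pose x : R := j.+2%:R.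
have x0 : 0 < x by rewrite /x.
have x1 : 1 < x by rewrite /x ltr1n.
have X2 : 1 < x ^+ 2 by rewrite exprn_egt1.
pose s := 1 - x ^- 2.
have s01 : 0 < s < 1.
  by rewrite /s subr_gt0 invf_lt1 ?exprn_gt0// X2/= ltrBlDr ltrDl invr_gt0 exprn_gt0.
exists ((1 - s) ^- 4 * (w x)^-1).
  by rewrite mulr_gt0 ?invr_gt0 ?w_gt0// exprn_gt0// subr_gt0; case/andP: s01.
move=> y yj; have y0 := window_gt0 yj.
move: yj; rewrite /window/= in_itv/= -/x => /andP[xy yx].
rewrite mulrAC ler_pdivlMr ?w_gt0// mul1r; apply: dw => //.
rewrite yx/= /s subKr invrK.
apply: (@le_trans _ _ (x^-1 * x ^+ 2)); first by rewrite expr2 mulKf ?gt_eqF.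
by rewrite ler_wpM2r// exprn_ge0// ltW.
Qed.

Lemma inL_window j f : inL w f -> leb.-integrable (window j) (EFin \o f).
Proof.
move=> If; have [C C0 hC] := weight_window j.
have jD : window j `<=` D by move=> y; rewrite half_lineE; exact: window_gt0.
have mj := measurable_window j.
have : leb.-integrable (window j) (fun y => (w y * (C * f y))%:E).
  by apply: (@integrableS _ _ _ leb D (window j)) => //; exact: (inLZ C If).
apply: le_integrable => //.
  apply/measurable_EFinP; apply: measurable_funS jD _ => //.
  exact: (inL_measurable w_gt0 mw).
move=> y jy /=; rewrite lee_fin (normrM (w y)) (normrM C) mulrA ler_peMl//.
by rewrite (gtr0_norm C0) gtr0_norm ?w_gt0 ?(window_gt0 jy)// mulrC hC.
Qed.

Lemma inL_window_div j f : inL w f ->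
  leb.-integrable (window j) (EFin \o (fun y => f y / y)).
Proof.
move=> If.
have jD : window j `<=` D by move=> y; rewrite half_lineE; exact: window_gt0.
have mj := measurable_window j.
have : leb.-integrable (window j) (fun y => (j.+2%:R)%:E * (f y)%:E)%E.
  by apply: integrableZl => //; exact: inL_window.
apply: le_integrable => //.
  apply/measurable_EFinP; apply: measurable_funS jD _ => //.
  apply: measurable_funM; first exact: (inL_measurable w_gt0 mw).
  by apply: (@measurable_inv _ _ _ D (fun y => y)) => [y|]; [rewrite half_lineE | exact: measurable_id].
move=> y jy /=; rewrite lee_fin normrM [leRHS]normrM mulrC ler_wpM2r//.
have y0 := window_gt0 jy.
rewrite gtr0_norm ?invr_gt0// ger0_norm// -[leRHS]invrK lef_pV2 ?posrE//.
by move: jy; rewrite /window/= in_itv/= => /andP[].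
Qed.

Lemma window_cover (x : R) : 0 < x -> exists j : nat, 2 * (j.+2%:R : R)^-1 < x < j.+2%:R.
Proof.
move=> x0; pose j := (Num.truncn (2 / x) + Num.truncn x)%N.
have h1 := truncnS_gt (2 / x); have h2 := truncnS_gt x.
exists j; apply/andP; split.
  rewrite ltr_pdivrMr// mulrC -ltr_pdivrMr//; apply: lt_le_trans h1 _.
  by rewrite ler_nat !ltnS /j -addnS leq_addr.
by apply: lt_le_trans h2 _; rewrite ler_nat /j !ltnS -addSn leqW// leq_addl.
Qed.

(** The intervals ](1 - s) x, x] shrink nicely to x, so the averages of f(y)/y
    over them converge at Lebesgue points. *)
Lemma logav_cvg_ae f : inL w f ->
  {ae leb, forall x, 0 < x -> logav (step n) f x @[n --> \oo] --> f x}.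
Proof.
move=> If; pose phi (y : R) := f y / y.
have loc j : locally_integrable setT (phi \_ (window j)).
  apply: integrable_locally_restrict; first exact: measurable_window.
  exact: inL_window_div.
have all_pt : {ae leb, forall x (j : nat), lebesgue_pt (phi \_ (window j)) x}.
  apply/ae_foralln => j; exact: lebesgue_differentiation.
apply: ae_weaken all_pt => x hx x0.
have [j /andP[jx xj]] := window_cover x0.
have := nice_lebesgue_differentiation shrinkE (loc j) (hx j).
have Ej n : E x n `<=` window j.
  move=> y; rewrite /E /window/= !in_itv/= /r x0 => /andP[xy yx].
  rewrite (le_trans yx (ltW xj)) andbT ltW//.
  apply: le_lt_trans xy.
  have : step n * x <= 2^-1 * x by rewrite ler_pM2r// step_le_half.
  by move: jx; set q := j.+2%:R^-1; move: (step n * x) => p; lra.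
have -> : (fun n => ((leb (E x n))^-1 * \int[leb]_(y in E x n) ((phi \_ (window j)) y)%:E)%E)
    = (fun n => ((step n * x)^-1 * \int[leb]_(y in E x n) phi y)%:E).
  apply/funext => n; rewrite leb_E /r x0 inver gt_eqF ?mulr_gt0 ?step_gt0//.
  rewrite EFinM; congr (_ * _)%E.
  rewrite /Rintegral fineK; last first.
    apply: integrable_fin_num; first exact: measurable_itv.
    apply: integrableS (inL_window_div j If) => //; exact: measurable_itv.
  apply: eq_integral => y /[!inE] yE; rewrite patchE ifT// inE; exact: Ej yE.
have -> : (phi \_ (window j)) x = phi x.
  rewrite patchE ifT// inE /window/= in_itv/= (ltW xj) andbT.
  by apply: le_trans (ltW jx); rewrite ler_peMl ?ler1n.
move=> /fine_cvg/= cphi.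
have -> : f x = x * phi x by rewrite /phi mulrC divfK// gt_eqF.
have -> : (fun n => logav (step n) f x) =
    (fun n => x * ((step n * x)^-1 * \int[leb]_(y in E x n) phi y)).
  apply/funext => n; rewrite logavE//; last exact: step_itv.
  rewrite invfM [_^-1 * x^-1]mulrC -mulrA mulVKf ?gt_eqF//.
  rewrite -RintegralZl//; last 2 first.
  - exact: measurable_itv.
  - apply: integrableS (inL_window_div j If) => //; exact: measurable_itv.
  have -> : E x n = `](1 - step n) * x, x]%classic.
    by rewrite /E /r x0 mulrBl mul1r.
  by apply: eq_Rintegral => y _; rewrite /phi invfM mulrCA mulrA.
by apply: cvgM; [exact: cvg_cst | exact: cphi].
Qed.

End AverageLimit.

Section Scheffe.
Variable R : realType.
Local Notation leb := (@lebesgue_measure R).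
Local Notation D := (half_line R).
Variable w : R -> R.
Hypothesis w_gt0 : forall x, 0 < x -> 0 < w x.
Hypothesis mw : measurable_fun D w.

(** For nonnegative functions |h - f| + f = 2 max(f - h, 0) + h. The function
    max(f - h, 0) is dominated by f and tends to 0 in norm, so the asymptotic
    bound on the norm of h alone forces norm convergence. *)
Lemma nrm_scheffe (h : nat -> R -> R) (f : R -> R) (eta : nat -> R) :
  (forall n, inL w (h n)) -> inL w f ->
  (forall n x, 0 < x -> 0 <= h n x) -> (forall x, 0 < x -> 0 <= f x) ->
  {ae leb, forall x, 0 < x -> h n x @[n --> \oo] --> f x} ->
  (forall n, nrm w (h n) <= (1 + eta n) * nrm w f) ->
  eta n @[n --> \oo] --> (0 : R) ->
  nrm w (fun x => h n x - f x) @[n --> \oo] --> (0 : R).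
Proof.
move=> Ih If h0 f0 hf hn cn.
have mh n : measurable_fun D (h n) by exact: (inL_measurable w_gt0 mw).
have mf : measurable_fun D f by exact: (inL_measurable w_gt0 mw).
pose k n x := Num.max (f x - h n x) 0.
have mk n : measurable_fun D (k n).
  by apply: measurable_funrpos; exact: measurable_funB.
have kf n x : 0 < x -> `|k n x| <= f x.
  move=> x0; rewrite ger0_norm /k; last by rewrite le_max lexx orbT.
  by rewrite ge_max f0// lerBlDr lerDl h0.
have Ik n : inL w (k n).
  by apply: (inL_le mw (mk n) If) => x x0; rewrite (ger0_norm (f0 _ x0)) kf.
have [_ ck] : inL w (fun=> 0) /\ nrm w (fun x => k n x - (fun=> 0) x) @[n --> \oo] --> (0 : R).
  apply: (nrm_dominated w_gt0 mw _ mk _ If kf); first exact: measurable_cst.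
  apply: ae_weaken hf => x hf x0.
  have c1 : f x - h n x @[n --> \oo] --> f x - f x.
    by apply: cvgB; [exact: cvg_cst | exact: hf].
  rewrite subrr in c1.
  apply/cvgrPdist_lt => e e0; move/cvgrPdist_lt/(_ _ e0) : c1.
  apply: filterS => n; rewrite !sub0r !normrN; apply: le_lt_trans.
  rewrite /k; have [le|lt] := lerP (f x - h n x) 0.
    by rewrite normr0.
  by [].
have main n : nrm w (fun x => h n x - f x) <= 2 * nrm w (fun x => k n x - 0) + eta n * nrm w f.
  have e1 := nrmDE w_gt0 mw (inLB (Ih n) If) If.
  have e2 := nrmDE w_gt0 mw (inLZ 2 (Ik n)) (Ih n).
  have e3 : nrm w (fun x => `|h n x - f x| + `|f x|) = nrm w (fun x => `|2 * k n x| + `|h n x|).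
    apply: eq_nrm => x x0; rewrite (ger0_norm (f0 _ x0)) (ger0_norm (h0 n _ x0)).
    rewrite normrM (ger0_norm (ltW _))// /k; have [le|lt] := lerP (f x - h n x) 0.
      by rewrite normr0 ger0_norm; lra.
    by rewrite distrC !gtr0_norm//; lra.
  have e4 := nrmZ w_gt0 mw 2 (Ik n).
  have e5 := hn n.
  have e6 : nrm w (fun x => k n x - 0) = nrm w (k n) by apply: eq_nrm => x _; rewrite subr0.
  rewrite e6; move: e1 e2 e3 e4 e5; rewrite (@ger0_norm _ 2)//.
  lra.
apply: (@squeeze_cvgr _ _ _ _ (fun=> 0)
  (fun n => 2 * nrm w (fun x => k n x - 0) + eta n * nrm w f)).
- by apply: nearW => n; rewrite main andbT; exact: (nrm_ge0 w_gt0).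
- exact: cvg_cst.
- rewrite -[X in _ --> X](_ : 2 * 0 + 0 * nrm w f = 0); last by ring.
  exact: (cvgD (cvgM (cvg_cst (2 : R)) ck) (cvgM cn (cvg_cst (nrm w f)))).
Qed.

Hypothesis dw : dilation_weight w.

Lemma cvg_step_pow : (1 - step R n) ^- 5 - 1 @[n --> \oo] --> (0 : R).
Proof.
rewrite (_ : 0 = (1 - 0) ^- 5 - 1); last by rewrite subr0 expr1n invr1 subrr.
apply: cvgB; last exact: cvg_cst.
apply: cvgV; first by rewrite subr0 expr1n oner_neq0.
have c1 : 1 - step R n @[n --> \oo] --> (1 - 0 : R).
  by apply: cvgB; [exact: cvg_cst | exact: cvg_step].
exact: (cvg_comp _ _ c1 (@exprn_continuous R 5 (1 - 0))).
Qed.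

Lemma inL_pos f : inL w f -> inL w (fun x => Num.max (f x) 0).
Proof.
move=> If; apply: (inL_le mw _ If).
  by apply: measurable_funrpos; exact: (inL_measurable w_gt0 mw).
move=> x _; rewrite ger0_norm; last by rewrite le_max lexx orbT.
by rewrite ge_max ler_norm normr_ge0.
Qed.

Let logav_cvg_ge0 f : inL w f -> (forall x, 0 < x -> 0 <= f x) ->
  nrm w (fun x => logav (step R n) f x - f x) @[n --> \oo] --> (0 : R).
Proof.
move=> If f0.
apply: (@nrm_scheffe (fun n => logav (step R n) f) f (fun n => (1 - step R n) ^- 5 - 1)) => //.
- by move=> n; apply: (logav_inL w_gt0 mw dw (step_itv R n)).
- move=> n x x0; apply: Rintegral_ge0 => y; rewrite half_lineE => y0.
  by rewrite mulr_ge0 ?f0//; exact: (logav_kernel_ge0 (step_itv R n)).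
- exact: (logav_cvg_ae w_gt0 mw dw).
- by move=> n; rewrite addrC subrK; exact: (logav_nrm w_gt0 mw dw (step_itv R n)).
- exact: cvg_step_pow.
Qed.

(** Almost everywhere convergence is upgraded by nrm_scheffe: the operator
    norm (1 - s)^-5 of the averages tends to 1. Scheffe needs a sign, hence
    the splitting into positive and negative parts. *)
Lemma logav_cvg f : inL w f ->
  nrm w (fun x => logav (step R n) f x - f x) @[n --> \oo] --> (0 : R).
Proof.
move=> If.
pose p x := Num.max (f x) 0; pose q x := Num.max (- f x) 0.
have Ip : inL w p by exact: inL_pos.
have Iq : inL w q by exact/inL_pos/inLN.
have fE : f = (fun x => p x - q x).
  apply/funext => x; rewrite /p /q; have [le|lt] := lerP (f x) 0.
    by have [|] := lerP (- f x) 0; lra.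
  by have [|] := lerP (- f x) 0; lra.
have cp : nrm w (fun x => logav (step R n) p x - p x) @[n --> \oo] --> (0 : R).
  by apply: logav_cvg_ge0 => // x _; rewrite /p le_max lexx orbT.
have cq : nrm w (fun x => logav (step R n) q x - q x) @[n --> \oo] --> (0 : R).
  by apply: logav_cvg_ge0 => // x _; rewrite /q le_max lexx orbT.
apply: (@squeeze_cvgr _ _ _ _ (fun=> 0)
  (fun n => nrm w (fun x => logav (step R n) p x - p x) + nrm w (fun x => logav (step R n) q x - q x))).
- apply: nearW => n; apply/andP; split; first exact: (nrm_ge0 w_gt0).
  have IA g : inL w g -> inL w (fun x => logav (step R n) g x - g x).
    by move=> Ig; apply: inLB => //; exact: (logav_inL w_gt0 mw dw (step_itv R n)).
  apply: le_trans (nrmB w_gt0 mw (IA _ Ip) (IA _ Iq)).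
  apply: eq_imp_le; apply: eq_nrm => x x0.
  rewrite {1}fE (logav_B w_gt0 mw dw (step_itv R n))// {1}fE; ring.
- exact: cvg_cst.
- by rewrite -[X in _ --> X](addr0 (0 : R)); exact: cvgD.
Qed.

End Scheffe.

(** * Cut-off functions of class C1 *)

Section SmoothStep.
Variable R : realType.

Let sqp (x : R) : R := Num.max x 0 ^+ 2.
Let pos (x : R) : R := Num.max x 0.

Let sqp_taylor x h : `|sqp (x + h) - sqp x - 2 * pos x * h| <= h ^+ 2.
Proof.
rewrite /sqp /pos ler_norml; have [|] := lerP x 0; have [|] := lerP (x + h) 0 => h1 h2.
- by apply/andP; split; nra.
- by apply/andP; split; nra.
- by apply/andP; split; nra.
- by apply/andP; split; nra.
Qed.

(** A quadratic error bound valid for every increment identifies the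
    derivative of a spline without treating its knots separately. *)
Lemma is_derive_of_quadratic (f : R -> R) (x l C : R) : 0 < C ->
  (forall h, `|f (x + h) - f x - l * h| <= C * h ^+ 2) -> is_derive x 1 f l.
Proof.
move=> C0 fl.
have c : h^-1 *: (f (h *: 1 + x) - f x) @[h --> (0:R)^'] --> l.
  apply/cvgrPdist_lt => e e0; near=> h.
  have h0 : h != 0 by near: h; exact: nbhs_dnbhs_neq.
  rewrite /GRing.scale/= mulr1 distrC [h + x]addrC.
  have -> : h^-1 * (f (x + h) - f x) - l = h^-1 * (f (x + h) - f x - l * h) by field.
  rewrite normrM normfV ltr_pdivrMl ?normr_gt0//.
  apply: le_lt_trans (fl h) _; rewrite -(real_normK (num_real h)) expr2 mulrA [ltRHS]mulrC ltr_pM2r ?normr_gt0//.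
  rewrite mulrC -ltr_pdivlMr//.
  near: h; apply: dnbhs0_lt; exact: divr_gt0.
split; last exact: cvg_lim c.
by apply/cvg_ex; exists l; exact: c.
Unshelve. all: by end_near. Qed.

(** The quadratic spline of class C1 that rises from 0 to 1 on [0, 1]; tent is
    its derivative. *)
Definition smoothstep (x : R) : R := 2 * sqp x - 4 * sqp (x - 2^-1) + 2 * sqp (x - 1).
Definition tent (x : R) : R := 4 * pos x - 8 * pos (x - 2^-1) + 4 * pos (x - 1).

Lemma smoothstep_taylor x h : `|smoothstep (x + h) - smoothstep x - tent x * h| <= 8 * h ^+ 2.
Proof.
have := sqp_taylor x h; have := sqp_taylor (x - 2^-1) h; have := sqp_taylor (x - 1) h.
rewrite /smoothstep /tent (addrAC x (- 2^-1)) (addrAC x (- 1)) !ler_norml.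
move: (sqp _) (sqp _) (sqp _) (sqp _) (sqp _) (sqp _) (pos _) (pos _) (pos _) => s1 s2 s3 s4 s5 s6 p1 p2 p3.
move: (h ^+ 2) => q /andP[a1 a2] /andP[a3 a4] /andP[a5 a6]; apply/andP; split; lra.
Qed.

Lemma smoothstep_le0 x : x <= 0 -> smoothstep x = 0.
Proof.
move=> x0; rewrite /smoothstep /sqp !max_r//; [by ring | lra | lra].
Qed.

Lemma smoothstep_ge1 x : 1 <= x -> smoothstep x = 1.
Proof.
move=> x0; rewrite /smoothstep /sqp !max_l//; [by field | lra | lra | lra].
Qed.

Lemma smoothstep_itv x : 0 <= smoothstep x <= 1.
Proof.
rewrite /smoothstep /sqp; have [|] := lerP x 0 => h1.
  by rewrite !max_r; lra.
have [|] := lerP (x - 2^-1) 0 => h2.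
  by rewrite max_r; [apply/andP; split; nra | lra].
have [|] := lerP (x - 1) 0 => h3; by apply/andP; split; nra.
Qed.

Lemma tent_itv x : 0 <= tent x <= 2.
Proof.
rewrite /tent /pos; have [|] := lerP x 0 => h1; have [|] := lerP (x - 2^-1) 0 => h2;
 have [|] := lerP (x - 1) 0 => h3; by apply/andP; split; lra.
Qed.

Lemma tent_out x : ~~ (0 <= x <= 1) -> tent x = 0.
Proof.
rewrite negb_and -!ltNge => h; rewrite /tent /pos; move: h.
have [|] := lerP x 0 => h1; have [|] := lerP (x - 2^-1) 0 => h2;
 have [|] := lerP (x - 1) 0 => h3; case/orP => ?; lra.
Qed.

Lemma continuous_tent : continuous tent.
Proof.
have cpos (c : R) : continuous (fun x => pos (x - c)).
  move=> x; apply: (@continuous_max R R (fun x => x - c) (fun=> 0) x).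
    by apply: cvgB; [exact: cvg_id | exact: cvg_cst].
  exact: cvg_cst.
move=> x; apply: cvgD; [apply: cvgB|]; apply: cvgM; try exact: cvg_cst; try exact: cpos.
by have := cpos 0 x; under eq_fun do rewrite subr0.
Qed.

Definition ramp (a k x : R) : R := smoothstep ((x - a) * k).
Definition bump (a k x : R) : R := k * tent ((x - a) * k).

Lemma is_derive_ramp (a k x : R) : 0 < k -> is_derive x 1 (ramp a k) (bump a k x).
Proof.
move=> k0; apply: (@is_derive_of_quadratic _ _ _ (8 * k ^+ 2)).
  by rewrite mulr_gt0// exprn_gt0.
move=> h; have := smoothstep_taylor ((x - a) * k) (h * k).
rewrite /ramp /bump.
have -> : (x - a) * k + h * k = (x + h - a) * k by ring.
have -> : tent ((x - a) * k) * (h * k) = k * tent ((x - a) * k) * h by ring.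
by have -> : 8 * (h * k) ^+ 2 = 8 * k ^+ 2 * h ^+ 2 by ring.
Qed.

Lemma continuous_bump (a k : R) : continuous (bump a k).
Proof.
move=> x; apply: cvgM; first exact: cvg_cst.
apply: (@continuous_comp _ _ _ (fun x : R => (x - a) * k) tent); last exact: continuous_tent.
by apply: cvgM; [apply: cvgB; [exact: cvg_id | exact: cvg_cst] | exact: cvg_cst].
Qed.

Lemma bump_itv (a k x : R) : 0 < k -> 0 <= bump a k x <= 2 * k.
Proof.
move=> k0; have /andP[t0 t2] := tent_itv ((x - a) * k).
by rewrite /bump mulr_ge0 ?(ltW k0)//= mulrC ler_pM2r.
Qed.

Lemma bump_out (a k x : R) : 0 < k -> ~~ (a <= x <= a + k^-1) -> bump a k x = 0.
Proof.
move=> k0 h; rewrite /bump tent_out ?mulr0//; apply: contra h => /andP[h1 h2].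
apply/andP; split; first by move: h1; rewrite pmulr_lge0// subr_ge0.
by rewrite -lerBlDl -[k^-1]mul1r ler_pdivlMr.
Qed.

Lemma Rintegral_bump (a k : R) : 0 < k ->
  \int[@lebesgue_measure R]_(x in `[a, a + k^-1]) bump a k x = 1.
Proof.
move=> k0; have ak : a < a + k^-1 by rewrite ltrDl invr_gt0.
rewrite /Rintegral (@continuous_FTC2 _ (bump a k) (ramp a k) a (a + k^-1))//.
- rewrite -EFinB/= /ramp; have -> : a + k^-1 - a = k^-1 by ring.
  rewrite mulVf ?gt_eqF// subrr mul0r.
  by rewrite smoothstep_ge1// smoothstep_le0// subr0.
- by apply: continuous_subspaceT => x; exact: continuous_bump.
- have cr : continuous (ramp a k).
    move=> x; apply: differentiable_continuous; apply/derivable1_diffP.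
    exact: (@ex_derive _ _ _ _ _ _ _ (is_derive_ramp a x k0)).
  split.
  + by move=> x _; exact: (@ex_derive _ _ _ _ _ _ _ (is_derive_ramp a x k0)).
  + by apply: cvg_at_right_filter; exact: cr.
  + by apply: cvg_at_left_filter; exact: cr.
- move=> x _; rewrite derive1E.
  by rewrite (@derive_val _ _ _ _ _ _ _ (is_derive_ramp a x k0)).
Qed.

(** A test function close to the indicator of ]a, b], with derivative close to
    the difference of the Dirac masses at a and at b. *)
Definition plateau (a b k x : R) : R := ramp a k x - ramp b k x.

Lemma is_derive_plateau (a b k x : R) : 0 < k ->
  is_derive x 1 (plateau a b k) (bump a k x - bump b k x).
Proof. by move=> k0; apply: is_deriveB; exact: is_derive_ramp. Qed.

Lemma derive1_plateau (a b k : R) : 0 < k ->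
  derive1 (plateau a b k) = (fun x => bump a k x - bump b k x).
Proof.
move=> k0; apply/funext => x; rewrite derive1E.
by rewrite (@derive_val _ _ _ _ _ _ _ (is_derive_plateau a b x k0)).
Qed.

Lemma plateau_out (a b k x : R) : a < b -> 1 <= k -> ~~ (a <= x <= b + 1) -> plateau a b k x = 0.
Proof.
move=> ab k1; have k0 : 0 < k by exact: lt_le_trans k1.
rewrite negb_and -!ltNge => /orP[xa|bx]; rewrite /plateau /ramp.
  by rewrite !smoothstep_le0 ?subrr// pmulr_lle0// subr_le0 ltW// (lt_trans xa).
have bx1 : 1 <= x - b by rewrite lerBrDl ltW.
rewrite !smoothstep_ge1 ?subrr//.
  by rewrite -[leLHS]mulr1 ler_pM.
by rewrite -[leLHS]mulr1 ler_pM// (le_trans bx1)// lerB// ltW.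
Qed.

Lemma plateau_le1 (a b k x : R) : `|plateau a b k x| <= 1.
Proof.
rewrite /plateau /ramp ler_norml.
have /andP[h1 h2] := smoothstep_itv ((x - a) * k).
have /andP[h3 h4] := smoothstep_itv ((x - b) * k).
by apply/andP; split; lra.
Qed.

Lemma test_function_plateau (a b k : R) : 0 < a < b -> 1 <= k ->
  test_function (plateau a b k).
Proof.
move=> /andP[a0 ab] k1; have k0 : 0 < k by exact: lt_le_trans k1.
split.
- by move=> x; exact: (@ex_derive _ _ _ _ _ _ _ (is_derive_plateau a b x k0)).
- rewrite derive1_plateau// => x; apply: cvgB; exact: continuous_bump.
- exists a, (b + 1); split; first by rewrite a0/= (lt_trans ab)// ltrDl.
  by move=> x; exact: plateau_out.
Qed.

Lemma cvg_ramp (a x : R) : ramp a n.+1%:R x @[n --> \oo] --> (if a < x then 1 else 0 : R).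
Proof.
case: ifPn => [ax|].
  apply: cvg_near_cst; near=> n; rewrite /ramp smoothstep_ge1//.
  have xa0 : 0 < x - a by rewrite subr_gt0.
  rewrite mulrC -ler_pdivrMr// mul1r.
  apply: (@le_trans _ _ n%:R); last by rewrite ler_nat.
  by near: n; exact: nbhs_infty_ger.
rewrite -leNgt => xa; apply: cvg_near_cst; apply: nearW => n.
by rewrite /ramp smoothstep_le0// pmulr_lle0// subr_le0.
Unshelve. all: by end_near. Qed.

End SmoothStep.

(** * Weak derivatives as difference quotients *)

Section WeakDerivative.
Variable R : realType.
Local Notation leb := (@lebesgue_measure R).
Local Notation D := (half_line R).
Implicit Types (f d : R -> R).

Lemma ae_scale (c : R) (P : R -> Prop) : 0 < c -> {ae leb, forall x, P x} ->
  {ae leb, forall x, 0 < x -> P (c * x)}.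
Proof.
move=> c0 [N [mN N0 PN]].
have mc : measurable_fun setT (fun x : R => c * x) by exact: measurable_funM.
have mB : measurable ([set x | N (c * x)] : set R).
  by have := mc measurableT _ mN; rewrite setTI.
exists (D `&` [set x | N (c * x)]); split.
- exact: measurableI.
- have : (\int[leb]_(x in D) (\1_N (c * x))%:E = (c^-1)%:E * \int[leb]_(x in D) (\1_N x)%:E)%E.
    apply: (@ge0_integral_scale R c (fun x => (\1_N x)%:E)) => //.
    by apply/measurable_EFinP; apply: measurable_funTS.
  rewrite [X in (_ * X)%E]integral_indic//.
  have ND : leb (N `&` D) = 0%E.
    by apply: (subset_measure0 _ mN _ N0); [exact: measurableI | exact: subIsetl].
  rewrite [X in (_ * X)%E]ND mule0 => h; rewrite -[RHS]h setIC.
  by rewrite -(integral_indic leb measurable_half_line mB).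
- move=> x /= /not_implyP[x0 nP]; split; first by rewrite in_itv/= x0.
  exact: PN.
Qed.

(** A bump has integral 1, height at most 2 k and support in [a, a + 1/k], so
    its error is at most 8 times the mean oscillation of f over the ball of
    radius 2/k, which tends to 0 at a Lebesgue point. *)
Lemma cvg_bump_lebesgue_pt (f : R -> R) (a : R) : 0 < a ->
  locally_integrable setT f -> lebesgue_pt f a ->
  \int[leb]_(x in D) (f x * bump a n.+1%:R x) @[n --> \oo] --> f a.
Proof.
move=> a0 [mf _ lf] fa.
pose k n : R := n.+1%:R.
have k0 n : 0 < k n by rewrite /k.
pose I n : set R := `[a, a + (k n)^-1]%classic.
have mI n : measurable (I n) by exact: measurable_itv.
have If n : leb.-integrable (I n) (EFin \o f).
  apply/integrableP; split; first by apply/measurable_EFinP; exact: measurable_funTS.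
  by apply: lf => //; exact: segment_compact.
have mb n : measurable_fun setT (bump a (k n)).
  by apply: continuous_measurable_fun => x; exact: continuous_bump.
have bnd n (g : R -> R) : leb.-integrable (I n) (EFin \o g) ->
    leb.-integrable (I n) (EFin \o (fun x => g x * bump a (k n) x)).
  move=> Ig.
  have : leb.-integrable (I n) (fun x => (2 * k n)%:E * (EFin \o g) x)%E.
    by apply: integrableZl; [exact: mI | exact: Ig].
  apply: le_integrable; first exact: mI.
    apply/measurable_EFinP/measurable_funM.
      by apply/measurable_EFinP; case/integrableP: Ig.
    by apply: measurable_funTS; exact: mb.
  move=> x _ /=; rewrite lee_fin normrM [leRHS]normrM mulrC ler_wpM2r//.
  have /andP[b0 b2] := bump_itv a x (k0 n).
  have kk : 0 <= 2 * k n by rewrite mulr_ge0// ltW// k0.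
  by rewrite (ger0_norm b0) (ger0_norm kk).
have Icst n (c : R) : leb.-integrable (I n) (EFin \o cst c).
  apply: continuous_compact_integrable; first exact: segment_compact.
  by apply: continuous_subspaceT => x; exact: cvg_cst.
have diffI n : \int[leb]_(x in D) (f x * bump a (k n) x) - f a =
    \int[leb]_(x in I n) ((f x - f a) * bump a (k n) x).
  have -> : \int[leb]_(x in D) (f x * bump a (k n) x) = \int[leb]_(x in I n) (f x * bump a (k n) x).
    rewrite Rintegral_mkcond [RHS]Rintegral_mkcond; apply: eq_Rintegral => x _.
    rewrite !patchE; case: ifPn; case: ifPn => //; rewrite !(inE, notin_setE) half_lineE.
      move=> xI _; rewrite bump_out ?mulr0//; apply/negP => h; apply: xI.
      by rewrite /I/= in_itv.
    move=> xI x0; exfalso; apply: x0; move: xI; rewrite /I/= in_itv/= => /andP[+ _].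
    exact: lt_le_trans.
  under [RHS]eq_Rintegral do rewrite mulrBl.
  rewrite RintegralB; [|exact: mI|exact: bnd|exact: (bnd _ _ (Icst n _))].
  congr (_ - _); rewrite RintegralZl; [|exact: mI|].
    by rewrite Rintegral_bump// mulr1.
  by have := bnd n _ (Icst n 1); apply: eq_integrable; [exact: mI | move=> x _ /=; rewrite mul1r].
(* Radius 2/k rather than 1/k, so that the open ball contains the closed
    support of the bump; height 2 k times length 4/k gives the factor 8. *)
pose r n := 2 * (k n)^-1.
have r0 n : 0 < r n by rewrite mulr_gt0// invr_gt0.
have key n : ((`|\int[leb]_(x in D) (f x * bump a (k n) x) - f a|)%:E <= 8%:E * davg f a (r n))%E.
  have mIn := mI n; rewrite diffI.
  have Id : leb.-integrable (I n) (EFin \o (fun x => f x - f a)).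
    have : leb.-integrable (I n) ((EFin \o f) \- (EFin \o cst (f a)))%E.
      by apply: integrableB; [exact: mI | exact: If | exact: (Icst n (f a))].
    by apply: eq_integrable; [exact: mI | move=> x _ /=; rewrite EFinB].
  rewrite EFin_normr_Rintegral//; last exact: bnd.
  apply: le_trans (le_abse_integral _ _ _) _ => //.
    by have /integrableP[] := bnd _ _ Id.
  have mfa : measurable_fun setT (fun x => f x - f a) by exact: measurable_funB.
  apply: (@le_trans _ _ ((2 * k n)%:E * \int[leb]_(x in I n) `|(f x - f a)%:E|)%E).
    rewrite -ge0_integralZl//; last 2 first.
    - by apply/measurable_EFinP; apply: measurable_funTS; exact: measurableT_comp.
    - by rewrite lee_fin mulr_ge0// ltW.
    apply: ge0_le_integral => //.
    - apply/measurable_EFinP; apply: measurable_funTS; apply: measurableT_comp => //.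
      by apply: measurable_funM; [exact: mfa | exact: mb].
    - apply/measurable_EFinP; apply: measurable_funTS.
      by apply: measurable_funM => //; exact: measurableT_comp.
    - move=> x _; rewrite -EFinM lee_fin normrM mulrC ler_wpM2r//.
      by have /andP[b0 b2] := bump_itv a x (k0 n); rewrite ger0_norm.
  have mball : measurable (ball a (r n)) by exact: measurable_ball.
  apply: (@le_trans _ _ ((2 * k n)%:E * \int[leb]_(x in ball a (r n)) `|(f x - f a)%:E|)%E).
    rewrite lee_wpmul2l ?lee_fin ?mulr_ge0 ?(ltW (k0 n))//.
    apply: ge0_subset_integral => //.
      by apply/measurable_EFinP; apply: measurable_funTS; exact: measurableT_comp.
    move=> x; rewrite /I/= in_itv/= /ball/= => /andP[ax xk].
    rewrite ler0_norm ?subr_le0// opprB.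
    have kn0 : 0 < (k n)^-1 by rewrite invr_gt0.
    by move: ax xk kn0; rewrite /r; set q := (k n)^-1; lra.
  rewrite /davg /iavg lebesgue_measure_ball; last exact: ltW.
  rewrite inver gt_eqF; last by rewrite pmulrn_lgt0.
  rewrite [leRHS]muleA -EFinM lee_wpmul2r ?integral_ge0// lee_fin.
  rewrite /r -mulr_natl; apply: eq_imp_le; field.
  exact: lt0r_neq0.
have cr : r n @[n --> \oo] --> (0 : R).
  rewrite -[X in _ --> X](mulr0 2); apply: cvgM; first exact: cvg_cst.
  exact: cvg_harmonic.
have cd : davg f a (r n) @[n --> \oo] --> 0%E.
  by move/cvge_at_rightP: fa => /(_ r); apply; split.
have c8 : (8%:E * davg f a (r n))%E @[n --> \oo] --> 0%E.
  by rewrite -[X in _ --> X](mule0 8%:E); apply: cvgeM => //; exact: cvg_cst.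
apply/cvgrPdist_lt => e e0.
have : \forall n \near \oo, (8%:E * davg f a (r n) < e%:E)%E.
  have e0' : (0 < e%:E)%E by rewrite lte_fin.
  exact: (c8 _ (open_ereal_lt' e0')).
apply: filterS => n lt; rewrite distrC -lte_fin.
exact: le_lt_trans (key n) lt.
Qed.

Lemma integrable_mul_bounded (A : set R) (g h : R -> R) (C : R) :
  measurable A -> leb.-integrable A (EFin \o g) -> measurable_fun A h ->
  (forall x, A x -> `|h x| <= C) ->
  leb.-integrable A (EFin \o (fun x => g x * h x)).
Proof.
move=> mA Ig mh hC.
have : leb.-integrable A (fun x => C%:E * (EFin \o g) x)%E by exact: integrableZl.
apply: le_integrable => //.
  apply/measurable_EFinP/measurable_funM => //.
  by apply/measurable_EFinP; case/integrableP: Ig.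
move=> x Ax /=; rewrite lee_fin normrM [leRHS]normrM mulrC ler_wpM2r//.
by rewrite (le_trans (hC _ Ax))// ler_norm.
Qed.

(** The identity defining the weak derivative is tested on plateaus. On one
    side the two bumps pick the values of f at the Lebesgue points a and b, on
    the other the plateaus converge boundedly to the indicator of ]a, b]. *)
Lemma weak_derivative_ftc f d (a b : R) (j : nat) : 0 < a < b ->
  (forall x, a <= x <= b + 1 -> @window R j x) ->
  leb.-integrable (@window R j) (EFin \o f) ->
  leb.-integrable (@window R j) (EFin \o d) ->
  weak_derivative f d ->
  lebesgue_pt (f \_ (@window R j)) a -> lebesgue_pt (f \_ (@window R j)) b ->
  \int[leb]_(x in `]a, b]) d x = f b - f a.
Proof.
move=> /andP[a0 ab] abW If Id fd pa pb.
have b0 : 0 < b by exact: lt_trans ab.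
have mW := @measurable_window R j.
pose fW := f \_ (@window R j); pose dW := d \_ (@window R j).
pose k n : R := n.+1%:R.
have k1 n : 1 <= k n by rewrite /k ler1n.
have k0 n : 0 < k n by rewrite /k.
have ki n : (k n)^-1 <= 1 by rewrite invf_le1.
have W_D (g : R -> R) : leb.-integrable (@window R j) (EFin \o g) ->
    leb.-integrable D (EFin \o (g \_ (@window R j))).
  move=> Ig; apply: (@integrableS _ _ _ leb setT) => //.
  have := (@integrable_mkcond _ _ _ leb _ (EFin \o g) mW).1 Ig.
  by apply: eq_integrable => // x _; rewrite /= restrict_EFin.
have IfW : leb.-integrable D (EFin \o fW) by exact: W_D.
have IdW : leb.-integrable D (EFin \o dW) by exact: W_D.
have cut (g h : R -> R) : (forall x, ~~ (a <= x <= b + 1) -> h x = 0) ->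
    \int[leb]_(x in D) (g x * h x) = \int[leb]_(x in D) ((g \_ (@window R j)) x * h x).
  move=> h0; apply: eq_Rintegral => x _; rewrite patchE.
  have [xab|xab] := boolP (a <= x <= b + 1); last by rewrite h0// !mulr0.
  by rewrite ifT// inE; exact: abW.
have bumpa n x : ~~ (a <= x <= b + 1) -> bump a (k n) x = 0.
  move=> h; apply: bump_out => //; apply: contra h => /andP[-> h]/=.
  by rewrite (le_trans h)// lerD// ltW.
have bumpb n x : ~~ (a <= x <= b + 1) -> bump b (k n) x = 0.
  move=> h; apply: bump_out => //; apply: contra h => /andP[h1 h2]/=.
  by rewrite (le_trans (ltW ab) h1)/= (le_trans h2)// lerD.
have mbump c n : measurable_fun setT (bump c (k n)).
  by apply: continuous_measurable_fun => x; exact: continuous_bump.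
have Ibump c n : leb.-integrable D (EFin \o (fun x => fW x * bump c (k n) x)).
  apply: (integrable_mul_bounded (C := 2 * k n)) => //.
    by apply: measurable_funTS; exact: mbump.
  move=> x _; have /andP[h1 h2] := bump_itv c x (k0 n).
  by rewrite ger0_norm.
have locf : locally_integrable setT fW by exact: integrable_locally_restrict.
have ca := cvg_bump_lebesgue_pt a0 locf pa.
have cb := cvg_bump_lebesgue_pt b0 locf pb.
have fWa : fW a = f a.
  by rewrite /fW patchE ifT// inE; apply: abW; rewrite lexx ltW// (lt_trans ab)// ltrDl.
have fWb : fW b = f b.
  by rewrite /fW patchE ifT// inE; apply: abW; rewrite (ltW ab) lerDl ler01.
have c1 : \int[leb]_(x in D) (f x * derive1 (plateau a b (k n)) x) @[n --> \oo] --> f a - f b.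
  rewrite -fWa -fWb.
  rewrite (_ : (fun n => _) = (fun n => \int[leb]_(x in D) (fW x * bump a n.+1%:R x) -
      \int[leb]_(x in D) (fW x * bump b n.+1%:R x))); first exact: cvgB.
  apply/funext => n; rewrite derive1_plateau//.
  rewrite -[LHS]/(\int[leb]_(x in D) (f x * (bump a (k n) x - bump b (k n) x))).
  rewrite (cut f); last by move=> x xab; rewrite bumpa// bumpb// subrr.
  rewrite -RintegralB//; [|exact: Ibump|exact: Ibump].
  by apply: eq_Rintegral => x _; rewrite mulrBr.
pose L x : R := (if a < x then 1 else 0) - (if b < x then 1 else 0).
have mL : measurable_fun setT L.
  have m1 (c : R) : measurable_fun setT (fun x : R => if c < x then 1 else 0 : R).
    apply: measurable_fun_ifT; [|exact: measurable_cst|exact: measurable_cst].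
    by apply: measurable_fun_ltr; [exact: measurable_cst|exact: measurable_id].
  by apply: measurable_funB; exact: m1.
have mdW : measurable_fun D dW by apply/measurable_EFinP; case/integrableP: IdW.
have mp n : measurable_fun setT (plateau a b (k n)).
  apply: continuous_measurable_fun => x.
  apply: differentiable_continuous; apply/derivable1_diffP.
  exact: (@ex_derive _ _ _ _ _ _ _ (is_derive_plateau a b x (k0 n))).
have c2 : \int[leb]_(x in D) (d x * plateau a b (k n) x) @[n --> \oo] -->
    \int[leb]_(x in `]a, b]) d x.
  have -> : \int[leb]_(x in `]a, b]) d x = \int[leb]_(x in D) (dW x * L x).
    rewrite Rintegral_mkcond [RHS]Rintegral_mkcond; apply: eq_Rintegral => x _.
    rewrite !patchE; case: ifPn.
      rewrite inE/= in_itv/= => /andP[ax xb].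
      have xW : x \in @window R j.
        by rewrite inE; apply: abW; rewrite (ltW ax)/= (le_trans xb)// lerDl.
      have xD : x \in D by rewrite inE half_lineE (lt_trans a0).
      rewrite xD /dW patchE xW.
      by rewrite /L ax ltNge xb/= subr0 mulr1.
    rewrite notin_setE/= in_itv/= => /negP h; case: ifPn => // _.
    rewrite /L; move: h; rewrite negb_and -!leNgt -!ltNge => /orP[xa|bx].
      rewrite ltNge xa/= ltNge (le_trans xa (ltW ab))/= subrr mulr0//.
    by rewrite bx (lt_trans ab bx) subrr mulr0.
  have Idp n : leb.-integrable D (EFin \o (fun x => dW x * plateau a b (k n) x)).
    apply: (integrable_mul_bounded (C := 1)) => //.
      by apply: measurable_funTS; exact: mp.
    by move=> x _; exact: plateau_le1.
  have m1 n : measurable_fun D (fun x => (dW x * plateau a b (k n) x)%:E).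
    by have /integrableP[] := Idp n.
  have m2 : measurable_fun D (fun x => (dW x * L x)%:E).
    by apply/measurable_EFinP/measurable_funM => //; exact: measurable_funTS.
  have h1 : {ae leb, forall x, D x ->
      (dW x * plateau a b (k n) x)%:E @[n --> \oo] --> (dW x * L x)%:E}.
    apply: aeW => x _; apply/cvg_EFin; first by near=> n.
    apply: cvgM; first exact: cvg_cst.
    by apply: cvgB; exact: cvg_ramp.
  have h2 : leb.-integrable D (abse \o (EFin \o dW)) by exact: integrable_abse.
  have h3 : {ae leb, forall x n, D x -> (`|(dW x * plateau a b (k n) x)%:E| <=
      (abse \o (EFin \o dW)) x)%E}.
    apply: aeW => x n _ /=; rewrite lee_fin normrM ler_piMr//; exact: plateau_le1.
  have [I3 _ c] := @dominated_convergence _ _ _ leb D measurable_half_line _ _ _ m1 m2 h1 h2 h3.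
  have fin : (\int[leb]_(x in D) (dW x * L x)%:E)%E \is a fin_num.
    by apply: integrable_fin_num => //; exact: I3.
  rewrite -(fineK fin) in c.
  move/fine_cvg : c; rewrite /comp/=; apply: cvg_trans; apply: near_eq_cvg; near=> n.
  rewrite (cut d)//; last by move=> x; exact: plateau_out.
have c3 : \int[leb]_(x in D) (f x * derive1 (plateau a b (k n)) x) @[n --> \oo] -->
    - \int[leb]_(x in `]a, b]) d x.
  rewrite (_ : (fun n => _) = (fun n => - \int[leb]_(x in D) (d x * plateau a b (k n) x))).
    exact: cvgN.
  apply/funext => n; apply: fd; apply: test_function_plateau => //.
  by rewrite a0.
by rewrite -[LHS]opprK -(cvg_unique (@Rhausdorff R) c1 c3) opprB.
Unshelve. all: by end_near. Qed.

Variable w : R -> R.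
Hypothesis w_gt0 : forall x, 0 < x -> 0 < w x.
Hypothesis mw : measurable_fun D w.
Hypothesis dw : dilation_weight w.

(** Almost every x is such that both x and (1 - s) x are Lebesgue points of f,
    and then weak_derivative_ftc applies between them. *)
Lemma weak_derivative_average f d s : 0 < s < 1 ->
  inL w f -> inL w (fun x => x * d x) -> weak_derivative f d ->
  {ae leb, forall x, 0 < x -> f x - f ((1 - s) * x) = s * logav s (fun y => y * d y) x}.
Proof.
move=> s01 If Id fd; have /andP[s0 s1] := s01.
have r0 : 0 < 1 - s by rewrite subr_gt0.
have IdW j : leb.-integrable (@window R j) (EFin \o d).
  have := inL_window_div w_gt0 mw dw j Id.
  apply: eq_integrable; first exact: measurable_window.
  move=> x /[!inE] /window_gt0 x0; congr _%:E.
  by rewrite mulrAC divff ?gt_eqF// mul1r.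
have IfW j := inL_window w_gt0 mw dw j If.
have loc j : locally_integrable setT (f \_ (@window R j)).
  by apply: integrable_locally_restrict; [exact: measurable_window | exact: IfW].
have pt : {ae leb, forall x (j : nat), lebesgue_pt (f \_ (@window R j)) x}.
  by apply/ae_foralln => j; exact: lebesgue_differentiation.
apply: ae_weaken2 pt (ae_scale r0 pt) => x p1 p2 x0.
have {}p2 := p2 x0.
have sx0 : 0 < (1 - s) * x by rewrite mulr_gt0.
have sxx : (1 - s) * x < x by rewrite gtr_pMl// ltrBlDr ltrDl.
have [j jW] : exists j, forall y, (1 - s) * x <= y <= x + 1 -> @window R j y.
  have [j1 /andP[h1 _]] := window_cover sx0.
  have x10 : 0 < x + 1 by rewrite addr_gt0.
  have [j2 /andP[_ h2]] := window_cover x10.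
  exists (j1 + j2)%N => y /andP[y1 y2]; rewrite /window/= in_itv/=; apply/andP; split.
    apply: le_trans y1; apply: le_trans (ltW h1).
    apply: (@le_trans _ _ (j1.+2%:R^-1)).
      by rewrite lef_pV2 ?posrE// ler_nat !ltnS leq_addr.
    by rewrite ler_peMl// ler1n.
  apply: le_trans y2 _; apply: le_trans (ltW h2) _.
  by rewrite ler_nat !ltnS leq_addl.
have absx : 0 < (1 - s) * x < x by rewrite sx0.
rewrite -(weak_derivative_ftc absx jW (IfW j) (IdW j) fd (p2 j) (p1 j)).
rewrite logavE// -RintegralZl//; last first.
  have : leb.-integrable `](1 - s) * x, x] (fun y => s^-1%:E * (EFin \o d) y)%E.
    apply: integrableZl; first exact: measurable_itv.
    apply: integrableS (IdW j) => //; first exact: measurable_window.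
    move=> y /=; rewrite in_itv/= => /andP[h1 h2]; apply: jW.
    by rewrite (ltW h1) (le_trans h2)// lerDl.
  apply: eq_integrable; first exact: measurable_itv.
  move=> y /[!inE]/=; rewrite in_itv/= => /andP[h1 h2]; rewrite -EFinM; congr _%:E.
  by field; rewrite !gt_eqF// (lt_trans sx0).
apply: eq_Rintegral => y /[!inE]/=; rewrite in_itv/= => /andP[h1 h2].
by field; rewrite !gt_eqF// (lt_trans sx0).
Qed.

End WeakDerivative.

(** * Comparison of weights, powers and dilations *)

Section WeightComparison.
Variable R : realType.
Local Notation leb := (@lebesgue_measure R).
Local Notation D := (half_line R).
Implicit Types (w f : R -> R).

Lemma inL_weight_le w1 w2 f (C : R) :
  (forall x, 0 < x -> 0 < w2 x) -> measurable_fun D w2 ->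
  (forall x, 0 < x -> 0 < w1 x) -> measurable_fun D w1 ->
  (forall x, 0 < x -> w1 x <= C * w2 x) -> inL w2 f -> inL w1 f.
Proof.
move=> w20 mw2 w10 mw1 w12 If.
have mf := inL_measurable w20 mw2 If.
have := inLZ C If; rewrite /inL; apply: le_integrable => //.
  by apply/measurable_EFinP/measurable_funM.
move=> x; rewrite half_lineE => x0.
rewrite lee_fin !normrM mulrA ler_wpM2r// (gtr0_norm (w10 _ x0)).
rewrite -normrM (le_trans (w12 _ x0))// mulrC; exact: ler_norm.
Qed.

Lemma inL_weightD w1 w2 f : inL w1 f -> inL w2 f -> inL (fun x => w1 x + w2 x) f.
Proof.
move=> I1 I2; apply: eq_integrable (integrableD _ I1 I2) => // x _.
by rewrite -EFinD mulrDl.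
Qed.

Lemma nrm_weightD w1 w2 f :
  (forall x, 0 < x -> 0 < w1 x) -> measurable_fun D w1 ->
  (forall x, 0 < x -> 0 < w2 x) -> measurable_fun D w2 ->
  inL w1 f -> inL w2 f -> nrm (fun x => w1 x + w2 x) f = nrm w1 f + nrm w2 f.
Proof.
move=> w10 mw1 w20 mw2 I1 I2.
rewrite -RintegralD//; [|exact: inL_int|exact: inL_int].
by apply: eq_Rintegral => x _; rewrite mulrDl.
Qed.

Lemma nrm_weight_le w1 w2 f :
  (forall x, 0 < x -> 0 < w2 x) -> measurable_fun D w2 ->
  (forall x, 0 < x -> 0 < w1 x) -> measurable_fun D w1 ->
  (forall x, 0 < x -> w1 x <= w2 x) -> inL w2 f -> nrm w1 f <= nrm w2 f.
Proof.
move=> w20 mw2 w10 mw1 w12 If.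
have I1 : inL w1 f.
  by apply: (@inL_weight_le w1 w2 f 1) => // x x0; rewrite mul1r w12.
apply: le_Rintegral => //; try exact: inL_int.
by move=> x; rewrite half_lineE => x0; rewrite ler_wpM2r// w12.
Qed.

Lemma inL_weightM w k f : inL (fun x => w x * k x) f <-> inL w (fun x => k x * f x).
Proof.
by split; apply: eq_integrable => // x _; rewrite mulrA.
Qed.

End WeightComparison.

Section PowerWeight.
Variable R : realType.
Local Notation leb := (@lebesgue_measure R).
Local Notation D := (half_line R).
Implicit Types (f d : R -> R).

Definition pw (p x : R) : R := x `^ p.

Lemma pw_gt0 p x : 0 < x -> 0 < pw p x. Proof. exact: powR_gt0. Qed.

Lemma measurable_pw p : measurable_fun D (pw p).
Proof. by apply: measurable_funTS; exact: measurable_powR. Qed.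

Let pw_ge0 p x : 0 <= pw p x. Proof. exact: powR_ge0. Qed.

Lemma pw1 x : 0 < x -> pw 1 x = x.
Proof. by move=> x0; rewrite /pw powRr1// ltW. Qed.

Lemma pwM p x y : 0 < x -> 0 < y -> pw p (x * y) = pw p x * pw p y.
Proof. by move=> x0 y0; rewrite /pw powRM// ltW. Qed.

Lemma pwD p q x : 0 < x -> pw (p + q) x = pw p x * pw q x.
Proof. by move=> x0; rewrite /pw powRD// (gt_eqF x0) implybT. Qed.

Lemma pw_pred p x : 0 < x -> pw p x = pw (p - 1) x * x.
Proof. by move=> x0; rewrite -[X in _ * X](pw1 x0) -pwD// subrK. Qed.

Section Dilation.
Variables (c p : R) (f : R -> R).
Hypothesis c0 : 0 < c.
Hypothesis If : inL (pw p) f.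

Let mf : measurable_fun D f.
Proof. exact: (inL_measurable (@pw_gt0 p) (measurable_pw p) If). Qed.

Lemma measurable_dilation : measurable_fun D (fun x => f (c * x)).
Proof.
apply: (@measurable_comp _ _ _ _ _ _ D f _ (fun x : R => c * x)) => //.
  by move=> _ [x + <-]; rewrite !half_lineE => x0; rewrite mulr_gt0.
by apply: measurable_funTS; exact: measurable_funM.
Qed.

Let dil_int : (\int[leb]_(x in D) (pw p x * `|f (c * x)|)%:E =
   ((pw (p + 1) c)^-1 * nrm (pw p) f)%:E)%E.
Proof.
have cp0 : 0 < pw p c by exact: pw_gt0.
have -> : (\int[leb]_(x in D) (pw p x * `|f (c * x)|)%:E =
    \int[leb]_(x in D) ((pw p c)^-1%:E * (pw p (c * x) * `|f (c * x)|)%:E))%E.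
  apply: eq_integral => x /[!inE]; rewrite half_lineE => x0.
  by rewrite -EFinM mulrA pwM// mulKf// gt_eqF.
have mpf : measurable_fun D (fun x => (pw p x * `|f x|)%:E).
  apply/measurable_EFinP/measurable_funM; first exact: measurable_pw.
  exact: measurableT_comp.
rewrite ge0_integralZl_EFin//; last 3 first.
- by move=> x _; rewrite lee_fin mulr_ge0.
- apply/measurable_EFinP/measurable_funM; last first.
    by apply: measurableT_comp => //; exact: measurable_dilation.
  apply: (@eq_measurable_fun _ _ _ _ D (fun x => pw p c * pw p x)).
    by move=> x /[!inE]; rewrite half_lineE => x0; rewrite pwM.
  by apply: measurable_funM => //; exact: measurable_pw.
- by rewrite invr_ge0 ltW.
rewrite (@ge0_integral_scale R c (fun x => (pw p x * `|f x|)%:E))//; last first.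
  by move=> x _; rewrite lee_fin mulr_ge0.
rewrite -(EFin_nrm (@pw_gt0 p) (measurable_pw p) If) -!EFinM; congr _%:E.
by rewrite mulrA -invfM pwD// pw1.
Qed.

Lemma inL_dilation : inL (pw p) (fun x => f (c * x)).
Proof.
apply/integrableP; split.
  apply/measurable_EFinP/measurable_funM; first exact: measurable_pw.
  exact: measurable_dilation.
apply: le_lt_trans (ltry ((pw (p + 1) c)^-1 * nrm (pw p) f)).
rewrite -dil_int; apply: eq_imp_le.
apply: eq_integral => x _; rewrite abse_EFin normrM; congr (_ * _)%:E.
by rewrite ger0_norm.
Qed.

Lemma nrm_dilation : nrm (pw p) (fun x => f (c * x)) = (pw (p + 1) c)^-1 * nrm (pw p) f.
Proof.
by apply: EFin_inj; rewrite -dil_int (EFin_nrm (@pw_gt0 p) (measurable_pw p) inL_dilation).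
Qed.

End Dilation.

(** Splitting into positive and negative parts transfers formulas for norms,
    such as that of nrm_dilation, to the signed integral. *)
Lemma mass_nrm f : inL (pw 1) f ->
  mass f = nrm (pw 1) (fun x => Num.max (f x) 0) - nrm (pw 1) (fun x => Num.max (- f x) 0).
Proof.
move=> If.
have mp := measurable_pw 1; have p0 := @pw_gt0 1.
have I1 := inL_pos (@pw_gt0 1) mp If; have I2 := inL_pos (@pw_gt0 1) mp (inLN If).
rewrite -RintegralB//; [|exact: inL_int|exact: inL_int].
apply: eq_Rintegral => x /[!inE]; rewrite half_lineE => x0.
rewrite pw1// -mulrBr; congr (_ * _).
by have [|] := lerP (f x) 0; have [|] := lerP (- f x) 0 => h1 h2;
  rewrite ?normr0 ?gtr0_norm//; lra.
Qed.

Lemma mass_dilation c f : 0 < c -> inL (pw 1) f ->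
  mass (fun x => f (c * x)) = c ^- 2 * mass f.
Proof.
move=> c0 If; have mp := measurable_pw 1.
rewrite mass_nrm; last exact: inL_dilation.
rewrite (nrm_dilation c0 (inL_pos (@pw_gt0 1) mp If)) (nrm_dilation c0 (inL_pos (@pw_gt0 1) mp (inLN If))).
rewrite -mulrBr -mass_nrm// pwD// pw1//.
Qed.

Lemma massD f g : inL (pw 1) f -> inL (pw 1) g -> mass (fun x => f x + g x) = mass f + mass g.
Proof.
have e h : inL (pw 1) h -> leb.-integrable D (EFin \o (fun x => x * h x)).
  apply: eq_integrable => // x /[!inE]; rewrite half_lineE => x0.
  by rewrite pw1.
move=> If Ig; rewrite /mass -RintegralD//; [|exact: e|exact: e].
by apply: eq_Rintegral => x _; rewrite mulrDr.
Qed.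

Lemma massZ a f : inL (pw 1) f -> mass (fun x => a * f x) = a * mass f.
Proof.
move=> If; rewrite /mass -RintegralZl//; last first.
  apply: eq_integrable If => // x /[!inE]; rewrite half_lineE => x0.
  by rewrite pw1.
by apply: eq_Rintegral => x _; rewrite mulrCA.
Qed.

Lemma massB f g : inL (pw 1) f -> inL (pw 1) g -> mass (fun x => f x - g x) = mass f - mass g.
Proof.
move=> If Ig; have := massD If (inLZ (-1) Ig); rewrite massZ// mulN1r => <-.
by congr mass; apply/funext => x; rewrite mulN1r.
Qed.

Lemma mass_le_nrm f : inL (pw 1) f -> `|mass f| <= nrm (pw 1) f.
Proof.
move=> If; apply: le_trans (le_normr_Rintegral _ _) _ => //.
  apply: eq_integrable If => // x /[!inE]; rewrite half_lineE => x0.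
  by rewrite pw1.
apply: eq_imp_le.
apply: eq_Rintegral => x /[!inE]; rewrite half_lineE => x0.
by rewrite normrM pw1// gtr0_norm.
Qed.

Lemma mass_ae_eq f g : inL (pw 1) f -> inL (pw 1) g -> eqX f g -> mass f = mass g.
Proof.
move=> If Ig fg; apply/eqP; rewrite -subr_eq0 -massB// -normr_le0.
apply: le_trans (mass_le_nrm (inLB If Ig)) _.
rewrite (@nrm_ae_eq _ _ (@pw_gt0 1) (measurable_pw 1) _ (fun=> 0)) ?nrm0//.
- exact: inLB.
- exact: inL0.
- by apply: ae_weaken fg => x fg x0; rewrite fg// subrr.
Qed.

(** First order expansion at s = 0, from exp(z) >= 1 + z with z = q ln(1 - s). *)
Lemma pow_expansion (q e : R) : 0 <= q -> 0 < e -> exists2 d, 0 < d &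
  forall s, 0 < s < d -> s < 1 /\ (pw q (1 - s))^-1 <= 1 + (q + e) * s.
Proof.
move=> q0 e0; pose d := Num.min 2^-1 (e / ((q + e + 1) * (q + 1 + 1))).
have d0 : 0 < d by rewrite lt_min invr_gt0 ltr0n/= divr_gt0// mulr_gt0//; lra.
exists d => // s /andP[s0]; rewrite lt_min => /andP[s2 sd].
have h2 : (2 : R)^-1 < 1 by lra.
have s1 : s < 1 by lra.
split => //.
have den : 0 < (q + e + 1) * (q + 1 + 1) by apply: mulr_gt0; lra.
move: sd; rewrite ltr_pdivlMr// => sd.
have r0 : 0 < 1 - s by lra.
have qs : 0 < 1 - (q + 1) * s.
  have : (q + 1) * s * (q + e + 1) <= e by nra.
  move=> h; have : (q + 1) * s * (q + e + 1) < 1 * (q + e + 1) by lra.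
  by rewrite ltr_pM2r; lra.
have l0 : 1 - q * s / (1 - s) <= pw q (1 - s).
  rewrite /pw /powR (gt_eqF r0).
  have h := expR_ge1Dx (q * ln (1 - s)); apply: le_trans h.
  rewrite lerD2l -mulrA -mulrN ler_wpM2l//.
  have r1 : 0 < (1 - s)^-1 by rewrite invr_gt0.
  have := @le_ln1Dx R ((1 - s)^-1 - 1).
  have -> : 1 + ((1 - s)^-1 - 1) = (1 - s)^-1 by ring.
  rewrite lnV ?posrE// => h1.
  have h3 : -1 < (1 - s)^-1 - 1 by lra.
  have := h1 h3; have -> : (1 - s)^-1 - 1 = s / (1 - s) by field; rewrite gt_eqF.
  lra.
have e1 : 1 - q * s / (1 - s) = (1 - (q + 1) * s) / (1 - s) by field; rewrite gt_eqF.
have p0 : 0 < pw q (1 - s) by exact: pw_gt0.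
have g0 : 0 < (1 - (q + 1) * s) / (1 - s) by rewrite divr_gt0.
rewrite -[leRHS]invrK lef_pV2 ?posrE//; last by rewrite invr_gt0; nra.
apply: le_trans l0; rewrite e1 -[leLHS]mul1r ler_pdivlMr//.
have t0 : 0 < 1 + (q + e) * s by nra.
rewrite mulrAC ler_pdivrMr// mul1r.
have : (q + 1) * (q + e) * s <= e by nra.
nra.
Qed.

End PowerWeight.

(** * The transport term *)

Section Transport.
Variable R : realType.
Local Notation leb := (@lebesgue_measure R).
Local Notation D := (half_line R).
Implicit Types (f d : R -> R).

Section TransportNorm.
Variables (p : R) (f d : R -> R).
Hypothesis p04 : 0 <= p <= 4.
Hypothesis If : inL (pw p) f.
Hypothesis Id : inL (pw p) (fun x => x * d x).
Hypothesis fd : weak_derivative f d.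

Let w0 := @pw_gt0 R p.
Let mw := @measurable_pw R p.
Let dw : dilation_weight (pw p) := dilation_weight_pow p04.

Lemma transport_ae n : {ae leb, forall x, 0 < x ->
  f x - step R n * (x * d x) = f ((1 - step R n) * x) +
    step R n * (logav (step R n) (fun y => y * d y) x - x * d x)}.
Proof.
have := weak_derivative_average w0 mw dw (step_itv R n) If Id fd.
by apply: ae_weaken => x h x0; rewrite mulrBr -h//; ring.
Qed.

(** The Euler step of f |-> - x f' is a dilation up to s times logav(x f') - x
    f', which tends to 0 in norm. The norm of the dilated function is (1 -
    s)^-(p + 1) times that of f, whence the growth rate p + 1. *)
Lemma transport_nrm (e : R) : 0 < e -> exists n0, forall n, (n0 <= n)%N ->
  nrm (pw p) (fun x => f x - step R n * (x * d x)) <=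
    (1 + (p + 1) * step R n) * nrm (pw p) f + e * step R n.
Proof.
move=> e0; have p0 : 0 <= p by case/andP: p04.
have N0 : 0 <= nrm (pw p) f by exact: (nrm_ge0 w0).
have e1 : 0 < e / (2 * (nrm (pw p) f + 1)) by rewrite divr_gt0// mulr_gt0// ltr_wpDl.
have [del del0 delP] := pow_expansion (addr_ge0 p0 ler01) e1.
have [n1 hn1] := step_lt del0.
have := logav_cvg w0 mw dw Id => /cvgrPdist_lt /(_ _ (divr_gt0 e0 (ltr0n R 2)))[n2 _ hn2].
exists (maxn n1 n2) => n; rewrite geq_max => /andP[n1n n2n].
have s0 := step_gt0 R n.
have [s1 sP] := delP (step R n) (introT andP (conj s0 (hn1 _ n1n))).
have r0 : 0 < 1 - step R n by rewrite subr_gt0.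
have := hn2 n n2n; rewrite /= sub0r normrN => /(le_lt_trans (ler_norm _)) hA.
have IA : inL (pw p) (fun x => logav (step R n) (fun y => y * d y) x - x * d x).
  by apply: inLB => //; exact: (logav_inL w0 mw dw (step_itv R n)).
have Idil := inL_dilation r0 If.
rewrite (nrm_ae_eq w0 mw _ _ (transport_ae n)); last 2 first.
- by apply: inLB => //; exact: inLZ.
- by apply: inLD => //; exact: inLZ.
apply: le_trans (nrmD w0 mw Idil (inLZ _ IA)) _.
rewrite (nrm_dilation r0 If) (nrmZ w0 mw)// (gtr0_norm s0).
have : (pw (p + 1) (1 - step R n))^-1 * nrm (pw p) f <=
   (1 + (p + 1 + e / (2 * (nrm (pw p) f + 1))) * step R n) * nrm (pw p) f.
  by rewrite ler_wpM2r.
have : step R n * nrm (pw p) (fun x => logav (step R n) (fun y => y * d y) x - x * d x) <= step R n * (e / 2).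
  by rewrite ler_pM2l// ltW.
set X := nrm _ _; set Y := (pw _ _)^-1 * _; move: (nrm (pw p) f) N0 e1 => N N0 e1 hX hY.
have hN : e / (2 * (N + 1)) * N <= e / 2.
  rewrite mulrAC ler_pdivrMr ?mulr_gt0 ?ltr_wpDl//.
  have -> : e / 2 * (2 * (N + 1)) = e * N + e by field.
  by rewrite lerDl ltW.
have : e / (2 * (N + 1)) * N * step R n <= e / 2 * step R n by rewrite ler_pM2r.
move: (e / (2 * (N + 1))) hY => E; lra.
Qed.

End TransportNorm.

(** The mass of f - f((1 - s) x) is (1 - (1 - s)^-2) mass f, and it is also s
    times the mass of the average of x f'. Divide by s and let s tend to 0. *)
Lemma mass_transport f d : inL (pw 1) f -> inL (pw 1) (fun x => x * d x) ->
  weak_derivative f d -> mass (fun x => x * d x) = - 2 * mass f.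
Proof.
move=> If Id fd.
have p04 : 0 <= (1 : R) <= 4 by lra.
have w0 := @pw_gt0 R 1; have mw := @measurable_pw R 1.
have dw := dilation_weight_pow p04.
have IA n : inL (pw 1) (logav (step R n) (fun y => y * d y)).
  exact: (logav_inL w0 mw dw (step_itv R n)).
have c1 : mass (logav (step R n) (fun y => y * d y)) @[n --> \oo] --> mass (fun x => x * d x).
  have cA := logav_cvg w0 mw dw Id.
  apply/cvgrPdist_lt => e e0; move/cvgrPdist_lt/(_ _ e0) : cA.
  apply: filterS => n; rewrite sub0r normrN => /(le_lt_trans (ler_norm _)).
  rewrite distrC -massB//; apply: le_lt_trans.
  exact: mass_le_nrm (inLB (IA n) Id).
have c2 : - (2 - step R n) * (1 - step R n) ^- 2 * mass f @[n --> \oo] --> - (2 - 0) * (1 - 0) ^- 2 * mass f.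
  have cs := @cvg_step R.
  have c3 : 1 - step R n @[n --> \oo] --> (1 - 0 : R) by apply: cvgB => //; exact: cvg_cst.
  apply: cvgM; last exact: cvg_cst.
  apply: cvgM; first by apply: cvgN; apply: cvgB => //; exact: cvg_cst.
  apply: cvgV; first by rewrite subr0 expr1n oner_neq0.
  exact: (cvg_comp _ _ c3 (@exprn_continuous R 2 (1 - 0))).
have e1 n : mass (logav (step R n) (fun y => y * d y)) = - (2 - step R n) * (1 - step R n) ^- 2 * mass f.
  have s01 := step_itv R n; have /andP[s0 s1] := s01.
  have r0 : 0 < 1 - step R n by rewrite subr_gt0.
  have := weak_derivative_average w0 mw dw s01 If Id fd => h.
  have : mass (fun x => f x - f ((1 - step R n) * x)) =
         mass (fun x => step R n * logav (step R n) (fun y => y * d y) x).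
    apply: mass_ae_eq => //; last exact: inLZ.
    by apply: inLB => //; exact: inL_dilation.
  rewrite massB//; last exact: inL_dilation.
  rewrite mass_dilation// massZ// => E.
  apply: (@mulfI _ (step R n)); first by rewrite gt_eqF.
  by rewrite -E; field; rewrite gt_eqF.
have e2 : (fun n => mass (logav (step R n) (fun y => y * d y))) =
    (fun n => - (2 - step R n) * (1 - step R n) ^- 2 * mass f).
  by apply/funext => n; exact: e1.
rewrite e2 in c1.
by rewrite -(cvg_unique (@Rhausdorff R) c2 c1); rewrite !subr0 expr1n invr1 mulr1.
Qed.

End Transport.

(** * The fragmentation kernel and its moments *)

Section Density.
Variable R : realType.
Local Notation leb := (@lebesgue_measure R).

(** The change of variables formula holds for the Radon-Nikodym derivative;
    having the same integrals over all measurable sets, it agrees with rho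
    almost everywhere. *)
Lemma integral_of_density (nu : {measure set (measurableTypeR R) -> \bar R})
    (rho f : R -> R) :
  leb.-integrable setT (EFin \o rho) -> (forall x, 0 <= rho x) ->
  (forall A : set R, measurable A -> nu A = (\int[leb]_(x in A) (rho x)%:E)%E) ->
  measurable_fun setT f -> (forall x, 0 <= f x) ->
  (\int[nu]_x (f x)%:E = \int[leb]_x (f x * rho x)%:E)%E.
Proof.
move=> Irho rho0 nuE mf f0.
have mrho : measurable_fun setT rho by apply/measurable_EFinP; case/integrableP: Irho.
have nufin : fin_num_fun nu.
  move=> A mA; rewrite nuE//; apply: integrable_fin_num => //.
  exact: integrableS Irho.
have nuT : (nu setT < +oo)%E by rewrite ltey_eq nufin.
pose nu' : {finite_measure set (measurableTypeR R) -> \bar R} := mfrestr measurableT nuT.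
have nu'E A : nu' A = nu A by rewrite /nu'/= /mfrestr/= /mrestr setIT.
have dom : nu' `<< leb.
  apply/null_content_dominatesP => A mA A0; rewrite nu'E nuE//.
  by apply: null_set_integral => //; apply/measurable_EFinP; exact: measurable_funTS.
rewrite (eq_measure_integral nu'); last by move=> A _ _; exact: (esym (nu'E A)).
have := @Radon_Nikodym_SigmaFinite.change_of_variables _ _ _ nu' leb dom
  (EFin \o f) setT (fun x => f0 x) measurableT.
have mfE : measurable_fun setT (EFin \o f) by exact/measurable_EFinP.
move=> /(_ mfE) <-.
have IRN := Radon_Nikodym_SigmaFinite.f_integrable dom.
have RNE : ae_eq leb setT (Radon_Nikodym_SigmaFinite.f nu' leb) (EFin \o rho).
  apply: integral_ae_eq => //.
    by case/integrableP: Irho.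
  move=> A _ mA; rewrite -(Radon_Nikodym_SigmaFinite.f_integral dom)// nu'E; exact: nuE.
apply: ae_eq_integral => //.
- apply: emeasurable_funM => //; exact: (measurable_int leb).
- by apply/measurable_EFinP/measurable_funM.
- by apply: ae_weaken RNE => x /[apply] /= ->; rewrite EFinM.
Qed.
End Density.

Section Kernel.
Variable R : realType.
Local Notation leb := (@lebesgue_measure R).
Local Notation D := (half_line R).
Variables (b : R -> {measure set (measurableTypeR R) -> \bar R})
          (beta : R -> R -> R) (Bm BM gamma : R).
Hypothesis density : frag_density b beta.
Hypothesis Bm_gt0 : 0 < Bm.
Hypothesis BmM : Bm < BM.
Hypothesis gamma02 : 0 < gamma < 2.
Hypothesis bounds : forall x y, 0 < y < x ->
  2 * Bm * x `^ (gamma - 1) <= beta x y <= 2 * BM * x `^ (gamma - 1).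

(** The rate b(y, x) at which clusters of size y produce fragments of size x,
    extended by zero to y <= x, so that the gain term is an integral operator
    over the whole quadrant. *)
Definition frag_kernel (x y : R) : R := if x < y then beta y x else 0.

Let BM_gt0 : 0 < BM. Proof. exact: lt_trans BmM. Qed.

Lemma frag_kernel_bounds x y : 0 < x < y ->
  2 * Bm * pw (gamma - 1) y <= frag_kernel x y <= 2 * BM * pw (gamma - 1) y.
Proof. by move=> /andP[x0 xy]; rewrite /frag_kernel xy; apply: bounds; rewrite x0. Qed.

Lemma frag_kernel_out x y : y <= x -> frag_kernel x y = 0.
Proof. by move=> yx; rewrite /frag_kernel ltNge yx. Qed.

Lemma frag_kernel_ge0 x y : 0 < x -> 0 < y -> 0 <= frag_kernel x y.
Proof.
move=> x0 y0; have [xy|/frag_kernel_out ->//] := ltP x y.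
have xy0 : 0 < x < y by rewrite x0.
have /andP[+ _] := frag_kernel_bounds xy0; apply: le_trans.
by rewrite !mulr_ge0 ?powR_ge0// ltW.
Qed.

Lemma frag_kernel_le x y : 0 < x -> 0 < y -> frag_kernel x y <= 2 * BM * pw (gamma - 1) y.
Proof.
move=> x0 y0; have [xy|/frag_kernel_out ->] := ltP x y.
  have xy0 : 0 < x < y by rewrite x0.
  by have /andP[_] := frag_kernel_bounds xy0.
by rewrite !mulr_ge0 ?powR_ge0// ltW.
Qed.

Lemma measurable_frag_kernel : measurable_quadrant frag_kernel.
Proof.
have [mb _] := density.
have mfst : measurable_fun setT (fst : R * R -> R) by exact: measurable_fst.
have msnd : measurable_fun setT (snd : R * R -> R) by exact: measurable_snd.
have mT : measurable ([set p | 0 < p.2 < p.1] : set (R * R)).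
  have mbool : measurable_fun setT (fun p : R * R => 0 < p.2 < p.1).
    apply: measurable_and; apply: measurable_fun_ltr => //.
  rewrite (_ : [set p | _] = setT `&` (fun p : R * R => 0 < p.2 < p.1) @^-1` [set true]).
    exact: mbool.
  by rewrite setTI; apply/seteqP; split => p.
apply: measurable_fun_if => //; first exact: measurable_quadrant_set.
  by apply: measurable_fun_ltr; exact: measurable_funTS.
have mswap : measurable_fun setT (fun p : R * R => (p.2, p.1)) by exact: measurable_swap.
apply: (measurable_comp mT _ mb (measurable_funTS mswap)).
move=> _ [p [[p1 p2] p12] <-] /=.
by move: p1; rewrite half_lineE => ->.
Qed.

Lemma frag_gainE g x : 0 < x -> frag_gain beta g x = kernel_op frag_kernel g x.
Proof.
move=> x0; rewrite /frag_gain /kernel_op Rintegral_mkcond [RHS]Rintegral_mkcond.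
apply: eq_Rintegral => y _; rewrite !patchE /frag_kernel.
case: ifPn => [|]; rewrite ?inE ?notin_setE/= in_itv/= andbT.
  by move=> xy; rewrite ifT ?xy// inE half_lineE (lt_trans x0).
by move=> /negP/negbTE ->; rewrite mul0r; case: ifPn.
Qed.

Section Column.
Variable y : R.
Hypothesis y0 : 0 < y.

Lemma measurable_frag_kernel_col : measurable_fun D (fun x => frag_kernel x y).
Proof.
apply: (@measurable_row _ (fun y x => frag_kernel x y)) => //.
have mswap : measurable_fun (D `*` D) (fun p : R * R => (p.2, p.1)).
  by apply: measurable_funTS; exact: measurable_swap.
apply: (measurable_comp (F := D `*` D) _ _ measurable_frag_kernel mswap).
  exact: measurable_quadrant_set.
by move=> _ [p [p1 p2] <-].
Qed.

Lemma frag_kernel_col_integrable (g : R -> R) (C : R) : measurable_fun D g ->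
  (forall x, 0 < x < y -> `|g x| <= C) ->
  leb.-integrable D (EFin \o (fun x => g x * frag_kernel x y)).
Proof.
move=> mg gC; pose I : set R := `]0, y[%classic.
have mI : measurable I by exact: measurable_itv.
have IC : leb.-integrable D (EFin \o (cst (C * (2 * BM * pw (gamma - 1) y)) \_ I)).
  have h : leb.-integrable I (EFin \o cst (C * (2 * BM * pw (gamma - 1) y))).
    have h : leb.-integrable `[0, y]%classic (EFin \o cst (C * (2 * BM * pw (gamma - 1) y))).
      apply: continuous_compact_integrable; first exact: segment_compact.
      by apply: continuous_subspaceT => x; exact: cvg_cst.
    apply: integrableS h; [exact: measurable_itv|exact: mI|].
    by move=> x; rewrite /I/= !in_itv/= => /andP[h1 h2]; rewrite !ltW.
  apply: (@integrableS _ _ _ leb setT) => //.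
  have := (@integrable_mkcond _ _ _ leb _ _ mI).1 h.
  by apply: eq_integrable => // x _; rewrite /= restrict_EFin.
apply: le_integrable IC => //.
  by apply/measurable_EFinP/measurable_funM => //; exact: measurable_frag_kernel_col.
move=> x; rewrite half_lineE => x0 /=; rewrite lee_fin patchE.
have [xy|yx] := ltP x y; last by rewrite frag_kernel_out// mulr0 normr0.
rewrite ifT; last by rewrite inE /I/= in_itv/= x0.
have xy0 : 0 < x < y by rewrite x0.
rewrite normrM (ger0_norm (frag_kernel_ge0 x0 y0)).
apply: le_trans (ler_norm _); apply: ler_pM => //; first exact: frag_kernel_ge0.
  exact: gC.
exact: frag_kernel_le.
Qed.

Definition moment (p : R) : R := \int[leb]_(x in D) (pw p x * frag_kernel x y).

Lemma moment_integrable p : 0 <= p ->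
  leb.-integrable D (EFin \o (fun x => pw p x * frag_kernel x y)).
Proof.
move=> p0; apply: (@frag_kernel_col_integrable _ (pw p y)); first exact: measurable_pw.
move=> x /andP[x0 xy]; rewrite ger0_norm ?powR_ge0//.
by apply: ge0_ler_powR => //; rewrite ?nnegrE ltW.
Qed.

Lemma EFin_moment p : 0 <= p ->
  (moment p)%:E = (\int[leb]_(x in D) (pw p x * frag_kernel x y)%:E)%E.
Proof.
move=> p0; rewrite /moment /Rintegral fineK//.
by apply: integrable_fin_num => //; exact: moment_integrable.
Qed.

Lemma frag_kernel_col_le (g : R -> R) (C : R) : 0 <= C -> measurable_fun D g ->
  (forall x, 0 < x < y -> `|g x| <= C) ->
  \int[leb]_(x in D) (g x * frag_kernel x y) <= 2 * BM * C * pw gamma y.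
Proof.
move=> C0 mg gC; pose I : set R := `]0, y[%classic.
have mI : measurable I by exact: measurable_itv.
have -> : 2 * BM * C * pw gamma y = \int[leb]_(x in I) (C * (2 * BM * pw (gamma - 1) y)).
  rewrite Rintegral_cst; last exact: mI.
  rewrite /I /= lebesgue_measure_itv/= lte_fin y0/= subr0.
  have -> : pw gamma y = pw (gamma - 1) y * y.
    by exact: pw_pred.
  by ring.
have Ig := frag_kernel_col_integrable mg gC.
have -> : \int[leb]_(x in D) (g x * frag_kernel x y) = \int[leb]_(x in I) (g x * frag_kernel x y).
  rewrite Rintegral_mkcond [RHS]Rintegral_mkcond; apply: eq_Rintegral => x _.
  rewrite !patchE; case: ifPn; case: ifPn => //; rewrite !(inE, notin_setE) half_lineE /I/= in_itv/=.
    by move=> /negP h x0; rewrite frag_kernel_out ?mulr0//; move: h; rewrite x0/= -leNgt.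
  by move=> /andP[].
have IDs : I `<=` D by move=> x; rewrite half_lineE /I/= in_itv/= => /andP[].
apply: le_Rintegral.
- exact: mI.
- by apply: integrableS Ig; [|exact: mI|exact: IDs].
- have h : leb.-integrable `[0, y]%classic (EFin \o cst (C * (2 * BM * pw (gamma - 1) y))).
    apply: continuous_compact_integrable; first exact: segment_compact.
    by apply: continuous_subspaceT => x; exact: cvg_cst.
  apply: integrableS h; [exact: measurable_itv|exact: mI|].
  by move=> x; rewrite /I/= !in_itv/= => /andP[h1 h2]; rewrite !ltW.
- move=> x; rewrite /I/= in_itv/= => xy0; have /andP[x0 xy] := xy0.
  apply: le_trans (ler_norm _) _; rewrite normrM (ger0_norm (frag_kernel_ge0 x0 y0)).
  by apply: ler_pM => //; [exact: frag_kernel_ge0 | exact: gC | exact: frag_kernel_le].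
Qed.

(** The interval [y/4, y/2] stays away from 0 and from y; on it the kernel is
    at least 2 Bm y^(gamma - 1), and its length is y/4. *)
Lemma frag_kernel_col_ge (g : R -> R) (c : R) : 0 <= c ->
  leb.-integrable D (EFin \o (fun x => g x * frag_kernel x y)) ->
  (forall x, 0 < x < y -> 0 <= g x) ->
  (forall x, y / 4 <= x <= y / 2 -> c <= g x) ->
  c * Bm / 2 * pw gamma y <= \int[leb]_(x in D) (g x * frag_kernel x y).
Proof.
move=> c0 Ig g0 gc; pose I : set R := `[(y / 4), (y / 2)]%classic.
have mI : measurable I by exact: measurable_itv.
have IDs : I `<=` D.
  by move=> x; rewrite half_lineE /I/= in_itv/= => /andP[h _]; apply: lt_le_trans h; rewrite divr_gt0.
pose cc := c * (2 * Bm * pw (gamma - 1) y).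
have -> : c * Bm / 2 * pw gamma y = \int[leb]_(x in I) cc.
  rewrite Rintegral_cst; last exact: mI.
  rewrite /I /= lebesgue_measure_itv/= lte_fin ifT; last by rewrite ltr_pM2l// ltf_pV2 ?posrE// ltr_nat.
  have -> : pw gamma y = pw (gamma - 1) y * y.
    by exact: pw_pred.
  by rewrite /cc /=; field.
have Icc : leb.-integrable I (EFin \o cst cc).
  apply: continuous_compact_integrable; first exact: segment_compact.
  by apply: continuous_subspaceT => x; exact: cvg_cst.
have IgI : leb.-integrable I (EFin \o (fun x => g x * frag_kernel x y)).
  by apply: integrableS Ig; [|exact: mI|exact: IDs].
apply: (@le_trans _ _ (\int[leb]_(x in I) (g x * frag_kernel x y))).
  apply: le_Rintegral; [exact: mI|exact: Icc|exact: IgI|].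
  move=> x; rewrite /I/= in_itv/= => xI.
  have xy : 0 < x < y.
    move: (xI) => /andP[h1 h2]; rewrite (lt_le_trans _ h1) ?divr_gt0//=.
    by apply: le_lt_trans h2 _; rewrite ltr_pdivrMr// ltr_pMr// ltr1n.
  have /andP[kx _] := frag_kernel_bounds xy.
  apply: ler_pM => //; first by rewrite !mulr_ge0 ?powR_ge0// ltW.
  exact: gc.
rewrite -lee_fin /Rintegral !fineK; last 2 first.
- by apply: integrable_fin_num => //; exact: Ig.
- by apply: integrable_fin_num; [exact: mI|exact: IgI].
apply: ge0_subset_integral => //.
  by case/integrableP: Ig.
move=> x; rewrite half_lineE => x0; rewrite lee_fin.
have [xy|yx] := ltP x y; last by rewrite frag_kernel_out// mulr0.
by rewrite mulr_ge0 ?frag_kernel_ge0// g0// x0.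
Qed.

Lemma moment_le p : 0 <= p -> moment p <= 2 * BM * pw (gamma + p) y.
Proof.
move=> p0; apply: le_trans (@frag_kernel_col_le (pw p) (pw p y) _ _ _) _.
- exact: powR_ge0.
- exact: measurable_pw.
- move=> x /andP[x0 xy]; rewrite ger0_norm ?powR_ge0//.
  by apply: ge0_ler_powR => //; rewrite ?nnegrE ltW.
- by rewrite pwD// -mulrA [pw p y * _]mulrC.
Qed.

Lemma moment_gt0 p : 0 <= p -> 0 < moment p.
Proof.
move=> p0; have y40 : 0 < y / 4 by rewrite divr_gt0.
apply: (@lt_le_trans _ _ (pw p (y / 4) * Bm / 2 * pw gamma y)).
  by rewrite !mulr_gt0 ?pw_gt0.
apply: frag_kernel_col_ge; first exact: powR_ge0.
- exact: moment_integrable.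
- by move=> x _; exact: powR_ge0.
- move=> x /andP[yx _]; apply: ge0_ler_powR => //; rewrite ?nnegrE ?ltW//.
  exact: lt_le_trans yx.
Qed.

Lemma frag_rateE : frag_rate b y = moment 1 / y.
Proof.
have [_ /(_ y y0) bE] := density.
pose I : set R := `]0, y[%classic.
have mI : measurable I by exact: measurable_itv.
have ID : I `<=` D by move=> x; rewrite half_lineE /I/= in_itv/= => /andP[].
have betaE x : I x -> beta y x = frag_kernel x y.
  by rewrite /I/= in_itv/= => /andP[_ xy]; rewrite /frag_kernel xy.
have mbeta : measurable_fun I (beta y).
  apply: (@eq_measurable_fun _ _ _ _ I (fun x => frag_kernel x y)).
    by move=> x /[!inE] /betaE ->.
  by apply: (@measurable_funS _ _ _ _ D) => //; exact: measurable_frag_kernel_col.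
have Ibeta : leb.-integrable I (EFin \o beta y).
  have h : leb.-integrable I (EFin \o (fun x => cst 1 x * frag_kernel x y)).
    apply: (@integrableS _ _ _ leb D) => //.
    by apply: (@frag_kernel_col_integrable (cst 1) 1) => // x _; rewrite normr1.
  by apply: eq_integrable h => // x /[!inE] Ix; rewrite /= betaE// mul1r.
pose J : set R := `[0, y]%classic.
have mJ : measurable J by exact: measurable_itv.
pose rho : R -> R := beta y \_ I.
pose f : R -> R := (fun x => x / y) \_ J.
rewrite /frag_rate /Rintegral integral_mkcond.
have -> : ((fun x : R => (x / y)%:E) \_ `[0, y]%classic) = (fun x => (f x)%:E).
  by apply/funext => x; rewrite !patchE /f patchE; case: ifPn.
rewrite (@integral_of_density _ (b y) rho f).
- transitivity (fine (\int[leb]_(x in D) (y^-1%:E * (pw 1 x * frag_kernel x y)%:E))%E).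
    rewrite [in RHS]integral_mkcond; congr fine; apply: eq_integral => x _.
    rewrite /rho /f !patchE; case: ifPn; case: ifPn; case: ifPn;
      rewrite !(inE, notin_setE) ?half_lineE /I /J/= !in_itv/=.
    + move=> x0 xI _; rewrite -EFinM pw1// betaE; last by rewrite /I/= in_itv/= xI.
      by congr _%:E; ring.
    + by move=> x0 /andP[h _] _; exfalso; apply: x0.
    + move=> x0 /negP; rewrite x0/= -leNgt => yx _.
      by rewrite frag_kernel_out// !mulr0 mule0.
    + by move=> _ _ _; rewrite mulr0.
    + by move=> x0 /andP[h1 h2] h; exfalso; apply: h; rewrite !ltW.
    + by move=> _ _ _; rewrite mul0r.
    + move=> x0 /negP; rewrite x0/= -leNgt => yx _.
      by rewrite frag_kernel_out// !mulr0 mule0.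
    + by move=> _ _ _; rewrite mulr0.
  rewrite integralZl//; last exact: moment_integrable.
  rewrite fineM//; last by apply: integrable_fin_num => //; exact: moment_integrable.
  by rewrite mulrC.
- apply: (@eq_integrable _ _ _ leb setT _ ((EFin \o beta y) \_ I)) => //.
    by move=> x _; rewrite /rho /= restrict_EFin.
  exact: (@integrable_mkcond _ _ _ leb _ _ mI).1.
- move=> x; rewrite /rho patchE; case: ifPn => // /[!inE] Ix.
  have x0 : 0 < x by have := ID _ Ix; rewrite half_lineE.
  by rewrite betaE// frag_kernel_ge0.
- move=> A mA; rewrite bE// integral_mkcondr; apply: eq_integral => x _.
  by rewrite /rho !patchE; case: ifPn.
- apply/(measurable_restrictT _ _).1 => //.
  by apply: measurable_funTS; exact: measurable_funM.
- move=> x; rewrite /f patchE; case: ifPn => //; rewrite inE /J/= in_itv/= => /andP[x0 _].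
  by rewrite divr_ge0// ltW.
Qed.

Lemma frag_rate_gt0 : 0 < frag_rate b y.
Proof. by rewrite frag_rateE divr_gt0// moment_gt0. Qed.

Lemma frag_rate_le : frag_rate b y <= 2 * BM * pw gamma y.
Proof.
rewrite frag_rateE ler_pdivrMr//; apply: le_trans (moment_le _) _ => //.
by rewrite pwD// pw1// mulrA.
Qed.

(** Each fragment x < y satisfies x^M <= y^(M - 1) x, and the right-hand side
    integrates to y^M times the rate. For x in [y/4, y/2] the gap between the
    two sides is at least (y^(M - 1) - (y/2)^(M - 1)) y/4; this strict gain,
    proportional to y^(gamma + M), is what confines large clusters. *)
Lemma moment_gt1 M : 1 < M -> moment M <= frag_rate b y * pw M y -
  (1 - pw (M - 1) 2^-1) * Bm / 8 * pw (gamma + M) y.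
Proof.
move=> M1; have M0 : 0 <= M by lra.
have M10 : 0 <= M - 1 by lra.
have h2 : pw (M - 1) 2^-1 < 1.
  have : (2^-1 : R) `^ (M - 1) < 1 `^ (M - 1).
    by apply: gt0_ltr_powR; rewrite ?subr_gt0 ?nnegrE// invf_lt1// ltr1n.
  by rewrite powR1.
have Ig1 : leb.-integrable D (EFin \o (fun x => (pw (M - 1) y * pw 1 x) * frag_kernel x y)).
  have : leb.-integrable D (fun x => (pw (M - 1) y)%:E * (EFin \o (fun x => pw 1 x * frag_kernel x y)%R) x)%E.
    by apply: integrableZl => //; exact: moment_integrable.
  by apply: eq_integrable => // x _; rewrite /= -EFinM mulrA.
have IgM := moment_integrable M0.
have e1 : frag_rate b y * pw M y = \int[leb]_(x in D) ((pw (M - 1) y * pw 1 x) * frag_kernel x y).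
  under eq_Rintegral do rewrite -mulrA.
  rewrite RintegralZl//; last exact: moment_integrable.
  rewrite -/(moment 1) frag_rateE.
  have -> : pw M y = pw (M - 1) y * y by exact: pw_pred.
  by field; rewrite gt_eqF.
rewrite lerBrDl -lerBrDr e1 /moment -RintegralB//.
pose c := pw M y * (1 - pw (M - 1) 2^-1) / 4.
have c0 : 0 <= c by rewrite !mulr_ge0 ?powR_ge0// subr_ge0 ltW.
have := @frag_kernel_col_ge (fun x => pw (M - 1) y * pw 1 x - pw M x) c c0.
have -> : c * Bm / 2 * pw gamma y = (1 - pw (M - 1) 2^-1) * Bm / 8 * pw (gamma + M) y.
  by rewrite /c (pwD gamma)//; field.
move=> h; apply: le_trans (h _ _ _) _.
- have : leb.-integrable D ((EFin \o (fun x => (pw (M - 1) y * pw 1 x) * frag_kernel x y)%R) \-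
      (EFin \o (fun x => pw M x * frag_kernel x y)%R))%E by exact: integrableB.
  by apply: eq_integrable => // x _; rewrite /= -EFinB mulrBl.
- move=> x /andP[x0 xy]; rewrite subr_ge0 pw1//.
  have -> : pw M x = pw (M - 1) x * x by exact: pw_pred.
  rewrite ler_pM2r//; apply: ge0_ler_powR => //; rewrite ?nnegrE ltW//.
- move=> x /andP[yx xy].
  have x0 : 0 < x by apply: lt_le_trans yx; rewrite divr_gt0.
  have -> : pw M x = pw (M - 1) x * x by exact: pw_pred.
  rewrite pw1// -mulrBl /c.
  have -> : pw M y * (1 - pw (M - 1) 2^-1) / 4 =
     (pw (M - 1) y - pw (M - 1) (y / 2)) * (y / 4).
    have -> : pw M y = pw (M - 1) y * y by exact: pw_pred.
    rewrite (pwM _ y0 (_ : 0 < 2^-1))//; by field.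
  have y2 : 0 < y / 2 by rewrite divr_gt0.
  apply: ler_pM.
  + rewrite subr_ge0; apply: ge0_ler_powR; rewrite ?nnegrE ?(ltW y2) ?(ltW y0)//.
    by rewrite ler_pdivrMr// ler_peMr ?(ltW y0)// ler1n.
  + by rewrite ltW// divr_gt0.
  + by rewrite lerD2l lerN2; apply: ge0_ler_powR; rewrite ?nnegrE ?(ltW y2) ?(ltW x0).
  + exact: yx.
- apply: eq_imp_le.
  by apply: eq_Rintegral => x _; rewrite mulrBl.
Qed.

End Column.
End Kernel.

(** * Gain and loss terms *)

Section Gain.
Variable R : realType.
Local Notation leb := (@lebesgue_measure R).
Local Notation D := (half_line R).
Variables (b : R -> {measure set (measurableTypeR R) -> \bar R})
          (beta : R -> R -> R) (Bm BM gamma : R).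
Hypothesis density : frag_density b beta.
Hypothesis Bm_gt0 : 0 < Bm.
Hypothesis BmM : Bm < BM.
Hypothesis gamma02 : 0 < gamma < 2.
Hypothesis bounds : forall x y, 0 < y < x ->
  2 * Bm * x `^ (gamma - 1) <= beta x y <= 2 * BM * x `^ (gamma - 1).

Local Notation frag_kernel := (frag_kernel beta).
Local Notation rate := (frag_rate b).
Local Notation moment := (moment beta).
Local Notation gain := (kernel_op frag_kernel).

Let BM_gt0 : 0 < BM. Proof. exact: lt_trans BmM. Qed.
Let gamma0 : 0 < gamma. Proof. by case/andP: gamma02. Qed.
Let mk : measurable_quadrant frag_kernel := measurable_frag_kernel density.
Let k0 x y : 0 < x -> 0 < y -> 0 <= frag_kernel x y.
Proof. exact: (frag_kernel_ge0 Bm_gt0 bounds). Qed.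

Let rateE y : 0 < y -> rate y = moment y 1 / y.
Proof. exact: (frag_rateE density Bm_gt0 BmM bounds). Qed.

Let rate_gt0 y : 0 < y -> 0 < rate y.
Proof. exact: (frag_rate_gt0 density Bm_gt0 BmM bounds). Qed.

Lemma measurable_moment p : measurable_fun D (fun y => moment y p).
Proof.
apply: (@measurable_fubini_row _ (fun y x => pw p x * frag_kernel x y)).
have mswap : measurable_fun (D `*` D) (fun q : R * R => (q.2, q.1)).
  by apply: measurable_funTS; exact: measurable_swap.
apply: measurable_quadrantM; first by apply: measurable_quadrant_snd; exact: measurable_pw.
apply: (measurable_comp (F := D `*` D) _ _ mk mswap).
  exact: measurable_quadrant_set.
by move=> _ [q [p1 p2] <-].
Qed.

Lemma measurable_rate : measurable_fun D rate.
Proof.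
apply: (@eq_measurable_fun _ _ _ _ D (fun y => moment y 1 * y^-1)).
  by move=> y /[!inE]; rewrite half_lineE => y0; rewrite rateE.
apply: measurable_funM; first exact: measurable_moment.
by apply: (@measurable_inv _ _ _ D (fun y => y)) => [y|]; [rewrite half_lineE | exact: measurable_id].
Qed.

Lemma rate_ge y : 0 < y -> Bm / 8 * pw gamma y <= rate y.
Proof.
move=> y0; rewrite rateE// ler_pdivlMr//.
have y4 : 0 < y / 4 by rewrite divr_gt0.
have := @frag_kernel_col_ge R beta Bm BM gamma Bm_gt0 bounds y y0 (pw 1) (y / 4) (ltW y4).
move=> /(_ (moment_integrable density Bm_gt0 BmM bounds y0 ler01)) h.
apply: le_trans (h _ _).
- by apply: eq_imp_le; field.
- by move=> x _; exact: powR_ge0.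
- by move=> x /andP[yx _]; rewrite pw1//; exact: lt_le_trans yx.
Qed.

Let pw0 := @pw_gt0 R.
Let mpw := @measurable_pw R.

(** The rate is bounded from below by a multiple of x^gamma, so a loss term in
    the space gives gamma additional powers. *)
Lemma inL_of_rate p f : inL (pw p) (fun x => rate x * f x) -> inL (pw (gamma + p)) f.
Proof.
move=> /inL_weightM Irf.
have wpos x : 0 < x -> 0 < pw p x * rate x by move=> x0; rewrite mulr_gt0 ?pw0 ?rate_gt0.
apply: (@inL_weight_le _ (pw (gamma + p)) (fun x => pw p x * rate x) f (8 / Bm)) => //.
- by apply: measurable_funM => //; exact: measurable_rate.
- by move=> x x0; exact: pw0.
- move=> x x0; rewrite pwD// [leLHS]mulrC [leRHS]mulrCA ler_pM2l ?pw0//.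
  rewrite -ler_pdivrMl ?divr_gt0// invf_div; exact: rate_ge.
Qed.

Lemma inL_rate p f : inL (pw (gamma + p)) f -> inL (pw p) (fun x => rate x * f x).
Proof.
move=> If; apply/inL_weightM.
have wpos x : 0 < x -> 0 < pw p x * rate x by move=> x0; rewrite mulr_gt0 ?pw0 ?rate_gt0.
apply: (@inL_weight_le _ (fun x => pw p x * rate x) (pw (gamma + p)) f (2 * BM)) => //.
- by move=> x x0; exact: pw0.
- by apply: measurable_funM => //; exact: measurable_rate.
- move=> x x0; rewrite pwD// mulrA mulrC ler_wpM2r ?powR_ge0//.
  exact: (frag_rate_le density Bm_gt0 BmM bounds).
Qed.

Section GainOf.
Variable f : R -> R.

Lemma gain_integrable p x : 0 <= p -> 0 < x -> inL (pw (gamma + p)) f ->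
  leb.-integrable D (EFin \o (fun y => frag_kernel x y * f y)).
Proof.
move=> p0 x0 If; have mf := inL_measurable (pw0 _) (mpw _) If.
have := inLZ (2 * BM * (pw (p + 1) x)^-1) If; rewrite /inL; apply: le_integrable => //.
  by apply/measurable_EFinP/measurable_funM => //; exact: measurable_row.
move=> y; rewrite half_lineE => y0 /=.
rewrite lee_fin normrM (normrM (pw _ _)) (normrM (_ * _^-1)) mulrA ler_wpM2r//.
rewrite (ger0_norm (k0 x0 y0)) (gtr0_norm (pw0 _ y0)).
have C0 : 0 < 2 * BM * (pw (p + 1) x)^-1 by rewrite !mulr_gt0 ?invr_gt0 ?pw0.
rewrite (gtr0_norm C0).
have [xy|yx] := ltP x y; last by rewrite frag_kernel_out// mulr_ge0 ?powR_ge0// ltW.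
apply: le_trans (frag_kernel_le Bm_gt0 BmM bounds x0 y0) _.
rewrite mulrCA ler_pM2l ?mulr_gt0//.
have -> : gamma + p = (gamma - 1) + (p + 1) by ring.
rewrite (pwD (gamma - 1))// -mulrA ler_peMr ?powR_ge0//.
rewrite ler_pdivlMr ?pw0// mul1r.
by apply: ge0_ler_powR; rewrite ?nnegrE ?addr_ge0// ltW.
Qed.

Lemma gain_inL p : 0 <= p -> inL (pw (gamma + p)) f -> inL (pw p) (gain f).
Proof.
move=> p0 If.
have I1 : inL (fun y => 2 * BM * pw (gamma + p) y) f.
  have := inLZ (2 * BM) If; rewrite /inL; apply: eq_integrable => // x _.
  by congr _%:E; ring.
apply: (@kernel_op_inL _ _ mk k0 (pw p) (fun y => 2 * BM * pw (gamma + p) y) (pw0 p) (mpw p)) => //.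
- by move=> y y0; rewrite !mulr_gt0 ?pw0.
- by apply: measurable_funM => //; exact: mpw.
- move=> y y0; rewrite -(EFin_moment density Bm_gt0 BmM bounds y0 p0) lee_fin.
  exact: (moment_le density Bm_gt0 BmM bounds).
Qed.

Lemma gain_nrm p : 0 <= p -> inL (pw (gamma + p)) f ->
  nrm (pw p) (gain f) <= 2 * BM * nrm (pw (gamma + p)) f.
Proof.
move=> p0 If.
have I1 : inL (fun y => 2 * BM * pw (gamma + p) y) f.
  have := inLZ (2 * BM) If; rewrite /inL; apply: eq_integrable => // x _.
  by congr _%:E; ring.
apply: (@le_trans _ _ (nrm (fun y => 2 * BM * pw (gamma + p) y) f)).
  apply: (@kernel_op_nrm _ _ mk k0 (pw p) (fun y => 2 * BM * pw (gamma + p) y) (pw0 p) (mpw p)) => //.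
  - by move=> y y0; rewrite !mulr_gt0 ?pw0.
  - by apply: measurable_funM => //; exact: mpw.
  - move=> y y0; rewrite -(EFin_moment density Bm_gt0 BmM bounds y0 p0) lee_fin.
    exact: (moment_le density Bm_gt0 BmM bounds).
rewrite /nrm -RintegralZl//; last exact: (inL_int (pw0 _) (mpw _)).
by apply: eq_imp_le; apply: eq_Rintegral => x _; rewrite mulrA.
Qed.

Lemma gain_nrm_gt1 M : 1 < M -> inL (pw (gamma + M)) f ->
  nrm (pw M) (gain f) <= nrm (pw M) (fun x => rate x * f x) -
    (1 - pw (M - 1) 2^-1) * Bm / 8 * nrm (pw (gamma + M)) f.
Proof.
move=> M1 If; have M0 : 0 <= M by lra.
set c2 := _ * Bm / 8.
pose v y := rate y * pw M y - c2 * pw (gamma + M) y.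
have vM y : 0 < y -> moment y M <= v y.
  by move=> y0; exact: (moment_gt1 density Bm_gt0 BmM bounds).
have v0 y : 0 < y -> 0 < v y.
  move=> y0; apply: lt_le_trans (vM y y0).
  exact: (moment_gt0 density Bm_gt0 BmM bounds).
have mv : measurable_fun D v.
  apply: measurable_funB; apply: measurable_funM => //; try exact: mpw.
  exact: measurable_rate.
have Ir : inL (pw M) (fun x => rate x * f x) by exact: inL_rate.
have IvE : forall x, 0 < x -> v x * f x = pw M x * (rate x * f x) - pw (gamma + M) x * (c2 * f x).
  by move=> x x0; rewrite /v; ring.
have Iv : inL v f.
  have : leb.-integrable D ((fun x => (pw M x * (rate x * f x))%:E) \-
     (fun x => (pw (gamma + M) x * (c2 * f x))%:E))%E.
    by apply: integrableB => //; exact: (inLZ c2 If).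
  apply: eq_integrable => // x /[!inE]; rewrite half_lineE => x0.
  by rewrite IvE.
apply: (@le_trans _ _ (nrm v f)).
  apply: (@kernel_op_nrm _ _ mk k0 (pw M) v (pw0 M) (mpw M)) => // y y0.
  rewrite -(EFin_moment density Bm_gt0 BmM bounds y0 M0) lee_fin.
  exact: vM.
have IfM := inL_int (pw0 _) (mpw _) If.
have IrM := inL_int (pw0 _) (mpw _) Ir.
rewrite /nrm -RintegralZl// -RintegralB//; last first.
  have : leb.-integrable D (fun x => c2%:E * (EFin \o (fun x => (pw (gamma + M) x * `|f x|)%R)) x)%E.
    exact: integrableZl.
  by apply: eq_integrable.
apply: eq_imp_le.
apply: eq_Rintegral => x /[!inE]; rewrite half_lineE => x0.
by rewrite /v normrM (gtr0_norm (rate_gt0 x0)); ring.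
Qed.

(** By Fubini, because the first moment of the fragments of y is y times the
    rate: fragmentation conserves mass. *)
Lemma mass_gain : inL (pw (gamma + 1)) f -> mass (gain f) = mass (fun x => rate x * f x).
Proof.
move=> If.
have I1 : inL (fun y => 2 * BM * pw (gamma + 1) y) f.
  have := inLZ (2 * BM) If; rewrite /inL; apply: eq_integrable => // x _.
  by congr _%:E; ring.
have := @kernel_op_fubini _ _ mk k0 (pw 1) (fun y => 2 * BM * pw (gamma + 1) y) (pw0 1) (mpw 1).
move=> h.
have -> : mass (gain f) = \int[leb]_(x in D) (pw 1 x * gain f x).
  by apply: eq_Rintegral => x /[!inE]; rewrite half_lineE => x0; rewrite pw1.
rewrite h//.
- apply: eq_Rintegral => y /[!inE]; rewrite half_lineE => y0.
  under eq_Rintegral do rewrite mulrA mulrC.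
  rewrite RintegralZl//; last exact: (moment_integrable density Bm_gt0 BmM bounds).
  by rewrite rateE// -/(moment y 1); field; rewrite gt_eqF.
- by move=> y y0; rewrite !mulr_gt0 ?pw0.
- by apply: measurable_funM => //; exact: mpw.
- move=> y y0; rewrite -(EFin_moment density Bm_gt0 BmM bounds y0 ler01) lee_fin.
  exact: (moment_le density Bm_gt0 BmM bounds).
- by move=> x x0; exact: (@gain_integrable 1).
Qed.

End GainOf.
End Gain.

(** * The Doeblin estimate *)

Section Doeblin.
Variable R : realType.
Local Notation leb := (@lebesgue_measure R).
Local Notation D := (half_line R).
Variables (b : R -> {measure set (measurableTypeR R) -> \bar R})
          (beta : R -> R -> R) (Bm BM gamma : R).
Hypothesis density : frag_density b beta.
Hypothesis Bm_gt0 : 0 < Bm.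
Hypothesis BmM : Bm < BM.
Hypothesis gamma02 : 0 < gamma < 2.
Hypothesis bounds : forall x y, 0 < y < x ->
  2 * Bm * x `^ (gamma - 1) <= beta x y <= 2 * BM * x `^ (gamma - 1).

Local Notation frag_kernel := (frag_kernel beta).
Local Notation rate := (frag_rate b).
Local Notation moment := (moment beta).
Local Notation gain := (kernel_op frag_kernel).

Variables (del r : R).
Hypothesis del_gt0 : 0 < del.
Hypothesis del_r : del < r.

(** Clusters with size y in [del, r] all produce fragments of each size below
    del, at a rate at least proportional to y; this is the weight with which
    they enter the part of the fragments common to all of them. *)
Definition core (y : R) : R := if (del <= y) && (y <= r) then y else 0.

Let e (x : R) : R := if x < del then 1 else 0.
Let c' := Bm * pw (gamma - 2) r.
Let r0 : 0 < r. Proof. exact: lt_trans del_r. Qed.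
Let c'0 : 0 < c'. Proof. by rewrite mulr_gt0// pw_gt0. Qed.

Lemma core_itv y : 0 < y -> 0 <= core y <= y.
Proof. by move=> y0; rewrite /core; case: ifPn => _; rewrite lexx ltW. Qed.

Lemma measurable_core : measurable_fun setT core.
Proof.
apply: measurable_fun_ifT; [|exact: measurable_id|exact: measurable_cst].
apply: measurable_and; apply: measurable_fun_ler;
  by [exact: measurable_cst|exact: measurable_id].
Qed.

Let measurable_e : measurable_fun setT e.
Proof.
apply: measurable_fun_ifT; [|exact: measurable_cst|exact: measurable_cst].
by apply: measurable_fun_ltr; [exact: measurable_id|exact: measurable_cst].
Qed.

Let e_ge0 x : 0 <= e x. Proof. by rewrite /e; case: ifPn. Qed.

Let frag_kernel_minor x y : 0 < x -> 0 < y -> 2 * (c' * (e x * core y)) <= frag_kernel x y.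
Proof.
move=> x0 y0; have k0 := frag_kernel_ge0 Bm_gt0 bounds x0 y0.
rewrite /e /core; case: ifPn => [xd|_]; last by rewrite mul0r !mulr0.
case: ifPn => [/andP[dy yr]|_]; last by rewrite !mulr0.
have xy : 0 < x < y by rewrite x0 (lt_le_trans xd).
have /andP[+ _] := frag_kernel_bounds bounds xy; apply: le_trans.
have -> : 2 * (c' * (1 * y)) = 2 * Bm * (pw (gamma - 2) r * y) by rewrite /c'; ring.
rewrite ler_pM2l; last by rewrite mulr_gt0.
have -> : pw (gamma - 1) y = pw (gamma - 2) y * y.
  by rewrite -[X in _ * X](pw1 y0) -pwD//; congr pw; ring.
rewrite ler_pM2r//.
(* Here gamma < 2 matters: the lower bound of the kernel, divided by y, is
    smallest at the largest size y = r. *)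
have g2 x' : pw (gamma - 2) x' = (pw (2 - gamma) x')^-1.
  by rewrite /pw -powRN opprB.
rewrite !g2 lef_pV2 ?posrE ?pw_gt0//.
apply: ge0_ler_powR => //; rewrite ?nnegrE; [|exact: ltW|exact: ltW].
by case/andP: gamma02 => _ h; rewrite subr_ge0 ltW.
Qed.

Let Ie : inL (pw 1) e.
Proof.
pose I : set R := `[0, del]%classic.
have mI : measurable I by exact: measurable_itv.
have h : leb.-integrable D (EFin \o (cst del \_ I)).
  have h : leb.-integrable I (EFin \o cst del).
    apply: continuous_compact_integrable; first exact: segment_compact.
    by apply: continuous_subspaceT => x; exact: cvg_cst.
  apply: (@integrableS _ _ _ leb setT) => //.
  have := (@integrable_mkcond _ _ _ leb _ _ mI).1 h.
  by apply: eq_integrable => // x _; rewrite /= restrict_EFin.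
apply: le_integrable h => //.
  apply/measurable_EFinP/measurable_funM; first exact: measurable_pw.
  by apply: measurable_funTS; exact: measurable_e.
move=> x; rewrite half_lineE => x0 /=; rewrite lee_fin patchE /e.
case: ifPn => [xd|_]; last by rewrite mulr0 normr0.
rewrite ifT; last by rewrite inE /I/= in_itv/= !ltW.
by rewrite mulr1 pw1// !gtr0_norm// ltW.
Qed.

Let q := nrm (pw 1) e.

Let q0 : 0 < q.
Proof.
pose I : set R := `[(del / 3), (del / 2)]%classic.
have mI : measurable I by exact: measurable_itv.
have d3 : 0 < del / 3 by rewrite divr_gt0.
have Icst : leb.-integrable I (EFin \o cst (del / 3)).
  apply: continuous_compact_integrable; first exact: segment_compact.
  by apply: continuous_subspaceT => x; exact: cvg_cst.
have ID : I `<=` D.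
  by move=> x; rewrite half_lineE /I/= in_itv/= => /andP[h _]; exact: lt_le_trans h.
have Ia := inL_int (@pw_gt0 R 1) (measurable_pw 1) Ie.
have IaI : leb.-integrable I (EFin \o (fun x => pw 1 x * `|e x|)).
  by apply: integrableS Ia; [|exact: mI|exact: ID].
apply: (@lt_le_trans _ _ (\int[leb]_(x in I) (del / 3))).
  rewrite Rintegral_cst; last exact: mI.
  rewrite /I /= lebesgue_measure_itv/= lte_fin ifT; last first.
    by rewrite ltr_pM2l// ltf_pV2 ?posrE// ltr_nat.
  rewrite /= mulr_gt0// subr_gt0.
  by rewrite ltr_pM2l// ltf_pV2 ?posrE// ltr_nat.
apply: (@le_trans _ _ (\int[leb]_(x in I) (pw 1 x * `|e x|))).
  apply: le_Rintegral; [exact: mI|exact: Icst|exact: IaI|].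
  move=> x; rewrite /I/= in_itv/= => /andP[x1 x2].
  have xd : x < del.
    by apply: le_lt_trans x2 _; rewrite ltr_pdivrMr// ltr_pMr// ltr1n.
  by rewrite /e xd normr1 mulr1 pw1//; exact: lt_le_trans x1.
rewrite -lee_fin /q (EFin_nrm (@pw_gt0 R 1) (measurable_pw 1) Ie) /Rintegral fineK; last first.
  by apply: integrable_fin_num; [exact: mI|exact: IaI].
apply: ge0_subset_integral => //; first by case/integrableP: Ia.
by move=> x _; rewrite lee_fin mulr_ge0// powR_ge0.
Qed.

(** Split the kernel as k1 + c' e(x) core(y), with k1 >= 0. The k1 part
    contributes at most the loss minus c' q int core |f|, in absolute value
    and without cancellation. The product part contributes c' q |int core f|,
    and int core f differs from mass f only by the clusters outside [del, r],
    so it is at most |mass f| + int (y - core) |f|. *)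
Lemma doeblin : exists2 c, 0 < c & forall f,
  inL (pw (gamma + 1)) f -> inL (pw 1) f ->
  nrm (pw 1) (gain f) <= nrm (pw 1) (fun x => rate x * f x) +
    c * (`|mass f| + \int[leb]_(y in D) ((y - 2 * core y) * `|f y|)).
Proof.
exists (c' * q); first by rewrite mulr_gt0.
move=> f Ig If.
have w0 := @pw_gt0 R 1; have mw := @measurable_pw R 1.
have mf := inL_measurable w0 mw If.
have mcore : measurable_fun D core by apply: measurable_funTS; exact: measurable_core.
have me : measurable_fun D e by apply: measurable_funTS; exact: measurable_e.
pose k1 x y := frag_kernel x y - c' * (e x * core y).
have k10 x y : 0 < x -> 0 < y -> 0 <= k1 x y.
  move=> x0 y0; have := frag_kernel_minor x0 y0; rewrite /k1.
  have : 0 <= c' * (e x * core y).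
    by rewrite mulr_ge0 ?(ltW c'0)// mulr_ge0//; have /andP[] := core_itv y0.
  lra.
have mk1 : measurable_quadrant k1.
  have h : measurable_quadrant (fun x y => e x * core y).
    apply: (@measurable_quadrantM _ (fun x _ => e x) (fun _ y => core y)).
      exact: measurable_quadrant_fst.
    exact: measurable_quadrant_snd.
  apply: measurable_funB; first exact: (measurable_frag_kernel density).
  by apply: measurable_funM; [exact: measurable_cst | exact: h].
pose v y := y * rate y - c' * q * core y.
have mv : measurable_fun D v.
  apply: measurable_funB; apply: measurable_funM => //.
  exact: (measurable_rate density Bm_gt0 BmM bounds).
have yrate y : 0 < y -> y * rate y = moment y 1.
  by move=> y0; rewrite (frag_rateE density Bm_gt0 BmM bounds y0) mulrC divfK// gt_eqF.
have k1int y : 0 < y -> \int[leb]_(x in D) (pw 1 x * k1 x y) = v y /\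
    leb.-integrable D (EFin \o (fun x => pw 1 x * k1 x y)).
  move=> y0; have I1 := moment_integrable density Bm_gt0 BmM bounds y0 (@ler01 R).
  have I2 : leb.-integrable D (EFin \o (fun x => (c' * core y) * (pw 1 x * e x))).
    have := inLZ (c' * core y) Ie; rewrite /inL; apply: eq_integrable => // x _.
    by congr _%:E; ring.
  have E : forall x, pw 1 x * k1 x y = pw 1 x * frag_kernel x y - (c' * core y) * (pw 1 x * e x).
    by move=> x; rewrite /k1; ring.
  split.
    under eq_Rintegral do rewrite E.
    rewrite RintegralB; [|exact: measurable_half_line|exact: I1|exact: I2].
    rewrite RintegralZl; [|exact: measurable_half_line|exact: Ie].
    rewrite /v yrate// /moment; congr (_ - _).
    have -> : \int[leb]_(x in D) (pw 1 x * e x) = q.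
      by apply: eq_Rintegral => x _; rewrite ger0_norm.
    by ring.
  have : leb.-integrable D ((EFin \o (fun x => pw 1 x * frag_kernel x y)%R) \-
      (EFin \o (fun x => c' * core y * (pw 1 x * e x))%R))%E by exact: integrableB.
  by apply: eq_integrable => // x _; rewrite /= -EFinB E.
have v0 y : 0 < y -> 0 < v y.
  move=> y0; have [<- Ik] := k1int y y0.
  have m0 := moment_gt0 density Bm_gt0 BmM bounds y0 (@ler01 R).
  have I1 := moment_integrable density Bm_gt0 BmM bounds y0 (@ler01 R).
  have I2 : leb.-integrable D (EFin \o (fun x => 2^-1 * (pw 1 x * frag_kernel x y))).
    have : leb.-integrable D (fun x => 2^-1%:E * (EFin \o (fun x => (pw 1 x * frag_kernel x y)%R)) x)%E.
      exact: integrableZl.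
    by apply: eq_integrable.
  apply: (@lt_le_trans _ _ (2^-1 * moment y 1)); first by rewrite mulr_gt0.
  rewrite /moment -RintegralZl//; apply: le_Rintegral => // x; rewrite half_lineE => x0.
  rewrite mulrCA ler_pM2l ?w0// /k1.
  have := frag_kernel_minor x0 y0; set t := c' * _; lra.
have IvE x : 0 < x -> v x * f x = pw 1 x * (rate x * f x) - c' * q * (core x * f x).
  by move=> x0; rewrite /v pw1//; ring.
have Icf : leb.-integrable D (EFin \o (fun x => core x * f x)).
  have := If; rewrite /inL; apply: le_integrable => //.
    by apply/measurable_EFinP/measurable_funM.
  move=> x; rewrite half_lineE => x0 /=; rewrite lee_fin !normrM ler_wpM2r// pw1//.
  have /andP[h1 h2] := core_itv x0.
  by rewrite (ger0_norm h1) gtr0_norm.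
have Ir : inL (pw 1) (fun x => rate x * f x).
  exact: (inL_rate density Bm_gt0 BmM bounds).
have Iv : inL v f.
  have h2 : leb.-integrable D (fun x => (c' * q)%:E * (EFin \o (fun x => (core x * f x)%R)) x)%E.
    exact: integrableZl.
  have : leb.-integrable D ((fun x => (pw 1 x * (rate x * f x))%:E) \-
     (fun x => (c' * q)%:E * (EFin \o (fun x => (core x * f x)%R)) x))%E by exact: integrableB.
  apply: eq_integrable => // x /[!inE]; rewrite half_lineE => x0.
  by rewrite IvE// EFinB EFinM.
have I1f := kernel_op_inL mk1 k10 w0 mw v0 mv _ Iv.
have kwv y : 0 < y -> (\int[leb]_(x in D) (pw 1 x * k1 x y)%:E <= (v y)%:E)%E.
  move=> y0; have [<- Ik] := k1int y y0; rewrite /Rintegral fineK//.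
  by apply: integrable_fin_num => //; exact: Ik.
have n1 := kernel_op_nrm mk1 k10 w0 mw v0 mv kwv Iv.
have {}I1f := I1f kwv.
pose A := \int[leb]_(y in D) (core y * f y).
have Igain x : 0 < x -> leb.-integrable D (EFin \o (fun y => frag_kernel x y * f y)).
  by move=> x0; exact: (gain_integrable density Bm_gt0 BmM bounds ler01 x0 Ig).
have gainE x : 0 < x -> gain f x = kernel_op k1 f x + A * c' * e x.
  move=> x0; rewrite /kernel_op.
  have E y : k1 x y * f y = frag_kernel x y * f y - (c' * e x) * (core y * f y) by rewrite /k1; ring.
  under [X in _ = X + _]eq_Rintegral do rewrite E.
  rewrite RintegralB//; [|exact: Igain|]; last first.
    have : leb.-integrable D (fun y => (c' * e x)%:E * (EFin \o (fun y => (core y * f y)%R)) y)%E.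
      exact: integrableZl.
    by apply: eq_integrable.
  by rewrite RintegralZl// -/A; ring.
have Ige : inL (pw 1) (gain f).
  exact: (gain_inL density Bm_gt0 BmM bounds ler01 Ig).
have n2 : nrm (pw 1) (gain f) <= nrm v f + `|A| * c' * q.
  apply: (@le_trans _ _ (nrm (pw 1) (fun x => kernel_op k1 f x + A * c' * e x))).
    by apply: eq_imp_le; exact: eq_nrm.
  apply: le_trans (nrmD w0 mw I1f (inLZ _ Ie)) _.
  by rewrite nrmZ// normrM (gtr0_norm c'0) -/q lerD.
have Icaf : leb.-integrable D (EFin \o (fun x => core x * `|f x|)).
  have := integrable_abse Icf; apply: eq_integrable => // x /[!inE]; rewrite half_lineE => x0.
  by rewrite /= normrM ger0_norm//; have /andP[] := core_itv x0.
have n3 : nrm v f = nrm (pw 1) (fun x => rate x * f x) - c' * q * \int[leb]_(y in D) (core y * `|f y|).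
  rewrite /nrm -RintegralZl// -RintegralB//; last 2 first.
  - exact: (inL_int w0 mw).
  - have : leb.-integrable D (fun y => (c' * q)%:E * (EFin \o (fun y => (core y * `|f y|)%R)) y)%E.
      exact: integrableZl.
    by apply: eq_integrable.
  apply: eq_Rintegral => x /[!inE]; rewrite half_lineE => x0.
  rewrite normrM (gtr0_norm (frag_rate_gt0 density Bm_gt0 BmM bounds x0)) pw1//.
  by rewrite /v; ring.
have Iyf : leb.-integrable D (EFin \o (fun x => x * f x)).
  by apply: eq_integrable If => // x /[!inE]; rewrite half_lineE => x0; rewrite pw1.
have Iyaf : leb.-integrable D (EFin \o (fun x => x * `|f x|)).
  by apply: eq_integrable (inL_int w0 mw If) => // x /[!inE]; rewrite half_lineE => x0; rewrite /= pw1.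
have n4 : `|A| <= `|mass f| + \int[leb]_(y in D) ((y - core y) * `|f y|).
  have Id : leb.-integrable D (EFin \o (fun x => (x - core x) * f x)).
    have : leb.-integrable D ((EFin \o (fun x => x * f x)%R) \- (EFin \o (fun x => core x * f x)%R))%E.
      exact: integrableB.
    by apply: eq_integrable => // x _; rewrite /= -EFinB mulrBl.
  have -> : A = mass f - \int[leb]_(y in D) ((y - core y) * f y).
    rewrite /mass -RintegralB//; apply: eq_Rintegral => x _; ring.
  apply: le_trans (ler_normB _ _) _; rewrite lerD2l.
  apply: le_trans (le_normr_Rintegral _ _) _ => //.
  apply: eq_imp_le; apply: eq_Rintegral => x /[!inE].
  rewrite half_lineE => x0; rewrite normrM ger0_norm// subr_ge0.
  by have /andP[] := core_itv x0.
have n5 : \int[leb]_(y in D) ((y - 2 * core y) * `|f y|) =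
    \int[leb]_(y in D) ((y - core y) * `|f y|) - \int[leb]_(y in D) (core y * `|f y|).
  rewrite -RintegralB//; last first.
    have : leb.-integrable D ((EFin \o (fun x => x * `|f x|)%R) \- (EFin \o (fun x => core x * `|f x|)%R))%E.
      exact: integrableB.
    by apply: eq_integrable => // x _; rewrite /= -EFinB mulrBl.
  by apply: eq_Rintegral => x _; ring.
rewrite n3 in n2; rewrite n5.
have cq0 : 0 < c' * q by rewrite mulr_gt0.
have : c' * q * `|A| <= c' * q * (`|mass f| + \int[leb]_(y in D) ((y - core y) * `|f y|)).
  by rewrite ler_pM2l.
move: n2; rewrite [`|A| * c' * q](_ : _ = c' * q * `|A|); last by ring.
rewrite !mulrDr mulrN; lra.
Qed.

End Doeblin.

(** * The Lyapunov estimate and the choice of constants *)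

Section Lyapunov.
Variable R : realType.

Lemma pw_le (p x y : R) : 0 <= p -> 0 < x -> x <= y -> pw p x <= pw p y.
Proof.
move=> p0 x0 xy; apply: ge0_ler_powR => //; rewrite nnegrE ltW//.
exact: lt_le_trans xy.
Qed.

Lemma pwK (p x : R) : 0 < p -> 0 < x -> pw p (pw p^-1 x) = x.
Proof. by move=> p0 x0; rewrite /pw -powRrM mulVf ?gt_eqF// powRr1// ltW. Qed.

Lemma pwN (p x : R) : pw (- p) x = (pw p x)^-1.
Proof. by rewrite /pw powRN. Qed.

Lemma pw_between (s u v y : R) : 0 < u -> u <= y <= v -> pw s y <= pw s u + pw s v.
Proof.
move=> u0 /andP[uy yv].
have y0 : 0 < y by exact: lt_le_trans uy.
have v0 : 0 < v by exact: lt_le_trans yv.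
have [s0|s0] := leP 0 s.
  by rewrite (le_trans (pw_le s0 y0 yv))// lerDr powR_ge0.
have ns0 : 0 <= - s by rewrite oppr_ge0 ltW.
have -> : s = - (- s) by rewrite opprK.
rewrite !(pwN (- s)) -[leLHS]addr0 lerD ?invr_ge0 ?powR_ge0//.
by rewrite lef_pV2 ?posrE ?pw_gt0// pw_le.
Qed.

(** Near 0 the power y^q is negligible compared with y^p, near infinity
    compared with y^r, and in between it is at most a multiple of y. *)
Lemma pw_interpolation (p q r eta : R) : p < q < r -> 0 < eta ->
  exists2 K, 0 < K & forall y, 0 < y ->
    pw q y <= eta * (pw p y + pw r y) + K * y.
Proof.
move=> /andP[pq qr] eta0.
pose u := pw (q - p)^-1 eta; pose v := pw (r - q)^-1 eta^-1.
have u0 : 0 < u by exact: pw_gt0.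
have v0 : 0 < v by rewrite pw_gt0// invr_gt0.
pose K := pw (q - 1) u + pw (q - 1) v.
have K0 : 0 < K by rewrite addr_gt0// pw_gt0.
exists K => // y y0.
have [p0 r0] : 0 < pw p y /\ 0 < pw r y by rewrite !pw_gt0.
have [yu|uy] := leP y u.
  have : pw q y <= eta * pw p y.
    have -> : q = p + (q - p) by ring.
    rewrite pwD// mulrC ler_pM2r// -(pwK (_ : 0 < q - p) eta0) ?subr_gt0//.
    by apply: pw_le => //; rewrite subr_ge0 ltW.
  move=> h; apply: le_trans h _; rewrite mulrDr -addrA lerDl.
  by rewrite addr_ge0 ?mulr_ge0 ?ltW.
have [yv|vy] := leP y v.
  have -> : pw q y = pw (q - 1) y * y by exact: pw_pred.
  apply: (@le_trans _ _ (K * y)).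
    by rewrite ler_pM2r// pw_between// yv ltW.
  by rewrite lerDr mulr_ge0 ?addr_ge0 ?ltW.
have : pw q y <= eta * pw r y.
  have -> : pw r y = pw q y * pw (r - q) y by rewrite -pwD//; congr pw; ring.
  rewrite mulrCA ler_peMr ?powR_ge0// -ler_pdivrMl// mulr1.
  rewrite -(pwK (_ : 0 < r - q) (_ : 0 < eta^-1)) ?subr_gt0 ?invr_gt0//.
  by apply: pw_le => //; [rewrite subr_ge0 ltW|exact: ltW].
move=> h; apply: le_trans h _; rewrite mulrDr addrAC lerDr.
by rewrite addr_ge0 ?mulr_ge0 ?ltW.
Qed.

Variables (m M gamma C1 c2 : R).
Hypothesis m1 : m < 1.
Hypothesis M1 : 1 < M.
Hypothesis gamma0 : 0 < gamma.
Hypothesis C10 : 0 < C1.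
Hypothesis c20 : 0 < c2.

(** The rate of change of W along the flow: the density against |f| in the
    bound for d/dt int W |f|. The coefficients m - 1 and M - 1 come from
    transport, the other two terms from fragmentation. *)
Definition drift (y : R) : R :=
  (m - 1) * pw m y + C1 * pw (gamma + m) y + (M - 1) * pw M y - c2 * pw (gamma + M) y.

(** Half of the damping (m - 1) y^m, together with - c2 y^(gamma + M),
    controls the intermediate powers by pw_interpolation. *)
Lemma drift_lyapunov : exists a K, [/\ 0 < a, 0 < K & forall y, 0 < y ->
  drift y <= - a * (pw m y + pw M y) + K * y].
Proof.
pose a := (1 - m) / 2; have a0 : 0 < a by rewrite divr_gt0// subr_gt0.
pose mn := Num.min a c2; have mn0 : 0 < mn by rewrite lt_min a0.
have Ma0 : 0 < M - 1 + a by rewrite addr_gt0// subr_gt0.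
pose den := C1 + (M - 1 + a); have den0 : 0 < den by rewrite addr_gt0.
pose eta := mn / den; have eta0 : 0 < eta by rewrite divr_gt0.
have o1 : m < gamma + m < gamma + M by rewrite ltrDr gamma0 ltrD2l (lt_trans m1).
have o2 : m < M < gamma + M by rewrite ltrDr gamma0 (lt_trans m1).
have [K1 K10 h1] := pw_interpolation o1 eta0.
have [K2 K20 h2] := pw_interpolation o2 eta0.
exists a, (C1 * K1 + (M - 1 + a) * K2); split => //; first by rewrite addr_gt0// mulr_gt0.
move=> y y0; rewrite /drift.
have := h1 y y0; rewrite -(ler_pM2l C10) => e1.
have := h2 y y0; rewrite -(ler_pM2l Ma0) => e2.
have p0 := pw_gt0 m y0; have r0 := pw_gt0 (gamma + M) y0.
have e3 : C1 * (eta * (pw m y + pw (gamma + M) y)) + (M - 1 + a) * (eta * (pw m y + pw (gamma + M) y)) =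
   mn * (pw m y + pw (gamma + M) y).
  by rewrite -mulrDl mulrA -/den /eta mulrCA divff ?gt_eqF// mulr1.
have e4 : mn * pw m y <= a * pw m y by rewrite ler_pM2r// ge_min lexx.
have e5 : mn * pw (gamma + M) y <= c2 * pw (gamma + M) y by rewrite ler_pM2r// ge_min lexx orbT.
have ea : m - 1 = - 2 * a by rewrite /a; field.
rewrite ea; move: e1 e2 e3 e4 e5.
move: (pw m y) (pw (gamma + M) y) (pw (gamma + m) y) (pw M y) => X Y Z T.
move: (eta * _) => W; lra.
Qed.

(** W(y)/y is y^(m - 1) + y^(M - 1), which tends to infinity both at 0 and at
    infinity because m < 1 < M. *)
Lemma weight_coercive (Lam : R) : 0 < Lam -> exists u v, 0 < u < v /\
  forall y, 0 < y -> ~~ (u <= y <= v) -> Lam * y <= pw m y + pw M y.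
Proof.
move=> L0; have Li0 : 0 < Lam^-1 by rewrite invr_gt0.
have m10 : 0 < 1 - m by rewrite subr_gt0.
have M10 : 0 < M - 1 by rewrite subr_gt0.
pose u := Num.min (pw (1 - m)^-1 Lam^-1) 1; pose v := Num.max (pw (M - 1)^-1 Lam) 2.
have u0 : 0 < u by rewrite lt_min pw_gt0 ?ltr01.
exists u, v; split.
  rewrite u0/=; apply: (@le_lt_trans _ _ 1); first by rewrite ge_min lexx orbT.
  by rewrite lt_max ltr1n orbT.
move=> y y0; rewrite negb_and -!ltNge => /orP[yu|vy].
  have : Lam * y <= pw m y.
    have -> : pw m y = pw (m - 1) y * y by exact: pw_pred.
    rewrite ler_pM2r//; have -> : m - 1 = - (1 - m) by ring.
    rewrite pwN -[Lam]invrK lef_pV2 ?posrE ?pw_gt0//.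
    rewrite -(pwK m10 Li0); apply: pw_le => //; first exact: ltW.
    by apply: le_trans (ltW yu) _; rewrite ge_min lexx.
  by move=> h; apply: le_trans h _; rewrite lerDl powR_ge0.
have : Lam * y <= pw M y.
  have -> : pw M y = pw (M - 1) y * y by exact: pw_pred.
  rewrite ler_pM2r// -[leLHS](pwK M10 L0); apply: pw_le; [exact: ltW|exact: pw_gt0|].
  by apply: le_trans (ltW vy); rewrite le_max lexx.
by move=> h; apply: le_trans h _; rewrite lerDr powR_ge0.
Qed.

Lemma id_le_weight y : 0 < y -> y <= pw m y + pw M y.
Proof.
move=> y0; have [y1|y1] := leP y 1.
  apply: (@le_trans _ _ (pw m y)); last by rewrite lerDl powR_ge0.
  have -> : pw m y = pw (m - 1) y * y by exact: pw_pred.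
  rewrite ler_peMl ?(ltW y0)//; have -> : m - 1 = - (1 - m) by ring.
  rewrite pwN invf_ge1 ?pw_gt0//.
  have : pw (1 - m) y <= pw (1 - m) 1 by apply: pw_le => //; rewrite subr_ge0 ltW.
  by rewrite [X in _ <= X]/pw powR1.
apply: (@le_trans _ _ (pw M y)); last by rewrite lerDr powR_ge0.
have -> : pw M y = pw (M - 1) y * y by exact: pw_pred.
rewrite ler_peMl ?(ltW y0)//.
have : pw (M - 1) 1 <= pw (M - 1) y by apply: pw_le => //; rewrite ?subr_ge0 ltW.
by rewrite [X in X <= _]/pw powR1.
Qed.

(** With eps K = c/2, the error eps K y of the Lyapunov bound is absorbed on
    [u, v], where the Doeblin term is - c y. Outside [u, v] the Doeblin term
    has the wrong sign and the total error is 3 eps K y, which is absorbed by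
    half of the confinement since W(y) >= (6 K/a) y there. What remains, eps a
    W/2, dominates alpha (y + eps W) since y <= W(y). The interval does not
    depend on c, because c is known only once the interval is fixed. *)
Lemma harris_constants : exists u v, 0 < u < v /\
  forall c, 0 < c -> exists eps alpha, [/\ 0 < eps, 0 < alpha & forall y, 0 < y ->
    c * (y - 2 * core u v y) + eps * drift y <= - alpha * (y + eps * (pw m y + pw M y))].
Proof.
have [a [K [a0 K0 hd]]] := drift_lyapunov.
have L0 : 0 < 6 * K / a by rewrite divr_gt0// mulr_gt0.
have [u [v [uv huv]]] := weight_coercive L0.
exists u, v; split => // c c0.
pose eps := c / (2 * K); have eps0 : 0 < eps by rewrite divr_gt0// mulr_gt0.
pose alpha := eps * a / (2 * (1 + eps)).
have alpha0 : 0 < alpha by apply: divr_gt0; apply: mulr_gt0 => //; exact: addr_gt0.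
exists eps, alpha; split => // y y0.
have W1 := id_le_weight y0; set W := pw m y + pw M y in W1 *.
have W0 : 0 < W by exact: lt_le_trans W1.
have h1 : - alpha * (y + eps * W) >= - (eps * a / 2 * W).
  rewrite mulNr lerN2.
  have -> : eps * a / 2 * W = alpha * ((1 + eps) * W).
    have ne : 1 + eps != 0 by rewrite gt_eqF// addr_gt0.
    rewrite /alpha; move: (eps) ne => x ne; field; exact: ne.
  by rewrite ler_pM2l// mulrDl mul1r lerD2r.
apply: le_trans h1.
have := hd y y0; rewrite -/W -(ler_pM2l eps0) => h2.
have e2 : eps * (- a * W + K * y) = - (eps * a * W) + eps * (K * y) by ring.
have h3 : eps * (K * y) = c / 2 * y by rewrite /eps; field; rewrite gt_eqF.
have h4 : 0 < eps * a * W by apply: mulr_gt0 => //; exact: mulr_gt0.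
rewrite /core; case: ifPn => [_|out].
  have : 0 < c * y by rewrite mulr_gt0.
  rewrite e2 h3 in h2; lra.
have := huv y y0 out; rewrite -/W.
have e1 : 0 < eps * a / 2 by apply: divr_gt0 => //; exact: mulr_gt0.
rewrite -(ler_pM2l e1).
have -> : eps * a / 2 * (6 * K / a * y) = 3 * (eps * (K * y)) by field; rewrite gt_eqF.
rewrite h3; rewrite e2 h3 in h2; rewrite mulr0 subr0; lra.
Qed.

End Lyapunov.

(** * Euler steps of the generator *)

Section Damping.
Variable R : realType.
Local Notation leb := (@lebesgue_measure R).
Local Notation D := (half_line R).
Variable w : R -> R.
Hypothesis w_gt0 : forall x, 0 < x -> 0 < w x.
Hypothesis mw : measurable_fun D w.

Let defect (s a k q : R) : R := (`|a + s * k - s * (q * a)| - `|a + s * k| + s * (q * `|a|)) / s.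

Let defect_le s a k q : 0 < s -> 0 <= q -> `|defect s a k q| <= 2 * (q * `|a|).
Proof.
move=> s0 q0; rewrite /defect normrM normfV (gtr0_norm s0) ler_pdivrMr//.
have sqa : `|s * (q * a)| = s * (q * `|a|).
  by rewrite !normrM (gtr0_norm s0) (ger0_norm q0).
have h1 := ler_normB (a + s * k) (s * (q * a)).
have h2 := ler_normD (a + s * k - s * (q * a)) (s * (q * a)).
rewrite subrK in h2; rewrite sqa in h1 h2.
have sq0 : 0 <= s * (q * `|a|) by rewrite !mulr_ge0// ltW.
rewrite ler_norml; apply/andP; split; lra.
Qed.

Let defect_eq0 s a k q : 0 < s -> 0 <= q -> s * (`|k| + q * `|a|) < `|a| ->
  defect s a k q = 0.
Proof.
move=> s0 q0 h.
have a0 : a != 0.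
  apply: contraTneq h => ->; rewrite normr0 mulr0 addr0 -leNgt.
  by rewrite mulr_ge0// ltW.
have hk : s * k <= s * `|k| by rewrite ler_pM2l// ler_norm.
have hk' : - (s * k) <= s * `|k| by rewrite -mulrN ler_pM2l// ler_normr lexx orbT.
rewrite mulrDr in h; have sq : 0 <= s * (q * `|a|) by rewrite !mulr_ge0// ltW.
rewrite /defect; have [a_gt|a_lt|a_eq] := ltrgt0P a; last by rewrite a_eq eqxx in a0.
  rewrite (gtr0_norm a_gt) in h sq; rewrite !gtr0_norm; [|lra|lra].
  by rewrite (_ : _ + _ = 0) ?mul0r//; ring.
rewrite (ltr0_norm a_lt) in h sq; have e : q * - a = - (q * a) by ring.
rewrite e mulrN in h sq; rewrite !ltr0_norm; [|lra|lra].
by rewrite (_ : _ + _ = 0) ?mul0r//; ring.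
Qed.

(** To first order in s the damping s q f reduces |f + s k| by s q |f|. The
    defect divided by s is at most 2 q |f|, and it vanishes as soon as s is
    small enough at the given point; dominated convergence does the rest. The
    multiplier q may be unbounded. *)
Lemma nrm_damping (f k q : R -> R) :
  (forall x, 0 < x -> 0 <= q x) -> measurable_fun D q ->
  inL w f -> inL w k -> inL w (fun x => q x * f x) ->
  forall e, 0 < e -> exists n0, forall n, (n0 <= n)%N ->
    nrm w (fun x => f x + step R n * k x - step R n * (q x * f x)) <=
    nrm w (fun x => f x + step R n * k x) - step R n * nrm w (fun x => q x * f x)
     + e * step R n.
Proof.
move=> q0 mq If Ik Iqf e e0.
have mf := inL_measurable w_gt0 mw If; have mk := inL_measurable w_gt0 mw Ik.
pose h n x := defect (step R n) (f x) (k x) (q x).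
have mh n : measurable_fun D (h n).
  apply: measurable_funM => //; apply: measurable_funD.
    apply: measurable_funB; apply: measurableT_comp => //.
      apply: measurable_funB; last by apply: measurable_funM => //; exact: measurable_funM.
      by apply: measurable_funD => //; exact: measurable_funM.
    by apply: measurable_funD => //; exact: measurable_funM.
  by apply: measurable_funM => //; apply: measurable_funM => //; exact: measurableT_comp.
have Iqa : inL w (fun x => 2 * `|q x * f x|) by apply: inLZ; exact: inL_abs.
have hle n x : 0 < x -> `|h n x| <= 2 * `|q x * f x|.
  move=> x0; rewrite (normrM (q x)) (ger0_norm (q0 _ x0)); apply: defect_le; last exact: q0.
  exact: step_gt0.
have [_ ch] : inL w (fun=> 0) /\ nrm w (fun x => h n x - (fun=> 0) x) @[n --> \oo] --> (0 : R).
  apply: (nrm_dominated w_gt0 mw _ mh _ Iqa hle); first exact: measurable_cst.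
  apply: aeW => x x0; have [fx0|fx0] := eqVneq (f x) 0.
    rewrite (_ : (fun n => h n x) = (fun=> 0)); first exact: cvg_cst.
    by apply/funext => n; rewrite /h /defect fx0 normr0 !mulr0 subr0 add0r subrr addr0 mul0r.
  apply: cvg_near_cst.
  have den : 0 < `|k x| + q x * `|f x| + 1.
    by rewrite ltr_wpDl// addr_ge0// mulr_ge0// q0.
  have fd0 : 0 < `|f x| / (`|k x| + q x * `|f x| + 1) by rewrite divr_gt0// normr_gt0.
  have [n0 hn0] := step_lt fd0.
  exists n0 => // n n0n; apply: defect_eq0; [exact: step_gt0|exact: q0|].
  have := hn0 n n0n; rewrite ltr_pdivlMr//; apply: le_lt_trans.
  by rewrite ler_pM2l ?step_gt0// lerDl.
move/cvgrPdist_le/(_ _ e0) : ch => [n0 _ hn0].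
exists n0 => n n0n; have := hn0 n n0n; rewrite /= sub0r normrN => /(le_trans (ler_norm _)).
have -> : nrm w (fun x => h n x - 0) = nrm w (h n) by apply: eq_nrm => x _; rewrite subr0.
move=> hn; have s0 := step_gt0 R n.
have Ih : inL w (h n).
  by apply: (inL_le mw (mh n) Iqa) => x x0; rewrite (ger0_norm (_ : 0 <= 2 * `|q x * f x|)) ?mulr_ge0// hle.
have Ifk : inL w (fun x => f x + step R n * k x) by apply: inLD => //; exact: inLZ.
have Ifq : inL w (fun x => f x + step R n * k x - step R n * (q x * f x)).
  by apply: inLB => //; exact: inLZ.
have E1 := nrmDE w_gt0 mw Ifq (inLZ (step R n) Iqf).
have E2 := nrmD w_gt0 mw (inL_abs w_gt0 mw Ifk) (inLZ (step R n) Ih).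
have E3 : nrm w (fun x => `|f x + step R n * k x - step R n * (q x * f x)| + `|step R n * (q x * f x)|)
  = nrm w (fun x => `|f x + step R n * k x| + step R n * h n x).
  apply: eq_nrm => x x0; rewrite /h /defect mulrC.
  rewrite (normrM (step R n)) (gtr0_norm s0) (normrM (q x)) (ger0_norm (q0 _ x0)).
  by field; rewrite gt_eqF.
rewrite (nrmZ w_gt0 mw)// (gtr0_norm s0) in E1.
rewrite (nrmZ w_gt0 mw)// (gtr0_norm s0) in E2.
have E4 : nrm w (fun x => `|f x + step R n * k x|) = nrm w (fun x => f x + step R n * k x).
  by apply: eq_Rintegral => x _; rewrite normr_id.
have : step R n * nrm w (h n) <= step R n * e by rewrite ler_pM2l.
rewrite E4 in E2; rewrite E3 in E1; lra.
Qed.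

End Damping.

Section Dissipation.
Variable R : realType.
Local Notation leb := (@lebesgue_measure R).
Local Notation D := (half_line R).

Section OneWeight.
Variables (p : R) (f d g r h : R -> R).
Hypothesis p04 : 0 <= p <= 4.
Hypothesis If : inL (pw p) f.
Hypothesis Id : inL (pw p) (fun x => x * d x).
Hypothesis Ig : inL (pw p) g.
Hypothesis mr : measurable_fun D r.
Hypothesis r_ge0 : forall x, 0 < x -> 0 <= r x.
Hypothesis Ir : inL (pw p) (fun x => r x * f x).
Hypothesis fd : weak_derivative f d.
Hypothesis hE : eqX h (fun x => - (x * d x) - 2 * f x + g x - r x * f x).
Hypothesis Ih : inL (pw p) h.

Let w0 := @pw_gt0 R p.
Let mw := @measurable_pw R p.

(** The three mechanisms of T act independently to first order: transport
    contributes p + 1, the term - 2 f contributes - 2, and loss and gain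
    contribute their own norms. *)
Lemma euler_step_nrm (e : R) : 0 < e -> exists n0, forall n, (n0 <= n)%N ->
  nrm (pw p) (fun x => f x + step R n * h x) <= nrm (pw p) f +
    step R n * ((p - 1) * nrm (pw p) f + nrm (pw p) g
      - nrm (pw p) (fun x => r x * f x) + e).
Proof.
move=> e0; have e2 : 0 < e / 2 by rewrite divr_gt0.
have [n1 h1] := transport_nrm p04 If Id fd e2.
have q0 x : 0 < x -> 0 <= 2 + r x by move=> x0; rewrite addr_ge0// r_ge0.
have mq : measurable_fun D (fun x => 2 + r x).
  by apply: measurable_funD => //; apply: measurable_cst.
have Iq : inL (pw p) (fun x => (2 + r x) * f x).
  by apply: (eq_inL _ (inLD (inLZ 2 If) Ir)) => x _; rewrite -mulrDl.
have [n2 h2] := nrm_damping w0 mw q0 mq If (inLN Id) Iq e2.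
exists (maxn n1 n2) => n; rewrite geq_max => /andP[/h1 {}h1 /h2 {}h2].
have s0 := step_gt0 R n.
have qE : nrm (pw p) (fun x => (2 + r x) * f x) =
    2 * nrm (pw p) f + nrm (pw p) (fun x => r x * f x).
  have := nrmDE w0 mw (inLZ 2 If) Ir; rewrite (nrmZ w0 mw)// (ger0_norm (ler0n _ 2)) => <-.
  apply: eq_Rintegral => x /[!inE]; rewrite half_lineE => x0; congr (_ * _).
  rewrite !normrM (ger0_norm (q0 _ x0)) (ger0_norm (r_ge0 x0)) (ger0_norm (ler0n _ 2)).
  by rewrite -mulrDl normrM normr_id (ger0_norm (q0 _ x0)).
have E1 : nrm (pw p) (fun x => f x + step R n * - (x * d x)) =
   nrm (pw p) (fun x => f x - step R n * (x * d x)).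
  by apply: eq_nrm => x _; rewrite mulrN.
have Ik : inL (pw p) (fun x => f x + step R n * - (x * d x) - step R n * ((2 + r x) * f x)).
  by apply: inLB; [apply: inLD => //; apply: inLZ; exact: inLN | exact: inLZ].
have E2 : nrm (pw p) (fun x => f x + step R n * h x) =
   nrm (pw p) (fun x => (f x + step R n * - (x * d x) - step R n * ((2 + r x) * f x)) + step R n * g x).
  apply: (nrm_ae_eq w0 mw); first by apply: inLD => //; exact: inLZ.
    by apply: inLD => //; exact: inLZ.
  by apply: ae_weaken hE => x hx x0; rewrite hx//; ring.
have := nrmD w0 mw Ik (inLZ (step R n) Ig).
rewrite (nrmZ w0 mw)// (gtr0_norm s0) E2; rewrite E1 qE in h2.
lra.
Qed.

End OneWeight.
End Dissipation.

Section WeightX.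
Variable R : realType.
Variables m M : R.
Hypothesis m1 : m < 1.
Hypothesis M1 : 1 < M.

Lemma inX_pow f : inX m M f <-> inL (pw m) f /\ inL (pw M) f.
Proof.
split=> [If|[I1 I2]]; last exact: inL_weightD.
have le1 x : 0 < x -> pw m x <= 1 * wX m M x by move=> x0; rewrite mul1r lerDl powR_ge0.
have le2 x : 0 < x -> pw M x <= 1 * wX m M x by move=> x0; rewrite mul1r lerDr powR_ge0.
by split; [apply: (inL_weight_le _ _ _ _ le1 If)|apply: (inL_weight_le _ _ _ _ le2 If)];
  try exact: measurable_wX; try exact: wX_gt0; try exact: measurable_pw; exact: pw_gt0.
Qed.

Lemma inX_mass f : inX m M f -> inL (pw 1) f.
Proof.
have le1 x : 0 < x -> pw 1 x <= 1 * wX m M x.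
  by move=> x0; rewrite mul1r pw1//; exact: id_le_weight.
apply: (inL_weight_le _ _ _ _ le1); [exact: wX_gt0|exact: measurable_wX|exact: pw_gt0|exact: measurable_pw].
Qed.

Lemma nrm_mass_le f : inX m M f -> nrm (pw 1) f <= nrm (wX m M) f.
Proof.
apply: nrm_weight_le; [exact: wX_gt0|exact: measurable_wX|exact: pw_gt0|exact: measurable_pw|].
by move=> x x0; rewrite pw1//; exact: id_le_weight.
Qed.

Lemma nrm_wX f : inX m M f -> nrm (wX m M) f = nrm (pw m) f + nrm (pw M) f.
Proof.
by move=> /inX_pow[I1 I2]; apply: nrm_weightD => //; first [exact: pw_gt0|exact: measurable_pw].
Qed.

Lemma eq_inX f g : {in (fun x => 0 < x), f =1 g} -> inX m M f -> inX m M g.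
Proof. by move=> fg; apply: eq_inL => x x0; rewrite fg. Qed.

End WeightX.

Section PureInequalities.
Variable R : realType.
Implicit Types a k : R.

Lemma norm_minus_twice a k : 0 <= k <= a -> `|a - 2 * k| <= 3 * a.
Proof. by move=> /andP[k0 k1]; rewrite ler_norml; apply/andP; split; lra. Qed.

(** The inequality of harris_constants multiplied by a value t of |f|, in the
    form in which it is integrated term by term. *)
Lemma lyapunov_pointwise (m M gamma c C1 c2 eps alpha u v : R) :
  (forall y, 0 < y -> c * (y - 2 * core u v y) + eps * drift m M gamma C1 c2 y
     <= - alpha * (y + eps * (pw m y + pw M y))) ->
  forall y t, 0 < y -> 0 <= t -> c * ((y - 2 * core u v y) * t) +
     (eps * (m - 1) * (pw m y * t) + (eps * C1 * (pw (gamma + m) y * t) +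
     (eps * (M - 1) * (pw M y * t) + (- (eps * c2) * (pw (gamma + M) y * t) + 0)))) <=
     - alpha * (pw 1 y * t) +
     (- (alpha * eps) * (pw m y * t) + (- (alpha * eps) * (pw M y * t) + 0)).
Proof.
move=> hpt y t y0 t0; have := ler_wpM2r t0 (hpt y y0); rewrite /drift pw1//.
by move: (pw m y) (pw M y) (pw _ y) (pw _ y) (core _ _ _) => *; lra.
Qed.

(** The linear combination of the estimates for the three weights 1, m and M
    that produces the norm N; the letters are the values of the norms
    involved. *)
Lemma euler_combine (m M c C1 c2 eps alpha s e mu J Nm N1 NM Gm G1 GM Rm R1 RM
    Am AM Xm X1 XM : R) : 0 <= s -> 0 <= eps ->
  Xm <= Nm + s * ((m - 1) * Nm + Gm - Rm + e) ->
  X1 <= N1 + s * ((1 - 1) * N1 + G1 - R1 + e) ->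
  XM <= NM + s * ((M - 1) * NM + GM - RM + e) ->
  Gm <= C1 * Am -> GM <= RM - c2 * AM -> G1 <= R1 + c * (mu + J) -> 0 <= Rm ->
  c * J + eps * ((m - 1) * Nm + C1 * Am + (M - 1) * NM - c2 * AM) <=
    - alpha * (N1 + eps * (Nm + NM)) ->
  X1 + eps * (Xm + XM) <= N1 + eps * (Nm + NM) +
    s * (c * mu - alpha * (N1 + eps * (Nm + NM)) + e * (1 + 2 * eps)).
Proof.
move=> s0 eps0 hm h1 hM gm gM g1 rm key.
pose T := (G1 - R1) + eps * (((m - 1) * Nm + Gm - Rm) + ((M - 1) * NM + GM - RM)).
have hT : T <= c * mu - alpha * (N1 + eps * (Nm + NM)).
  have : eps * (((m - 1) * Nm + Gm - Rm) + ((M - 1) * NM + GM - RM)) <=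
         eps * ((m - 1) * Nm + C1 * Am + (M - 1) * NM - c2 * AM).
    by rewrite ler_wpM2l//; lra.
  rewrite /T; lra.
have := ler_wpM2l s0 hT; have := ler_wpM2l eps0 hm; have := ler_wpM2l eps0 hM.
rewrite /T; lra.
Qed.

End PureInequalities.

Section Harris.
Variable R : realType.
Local Notation leb := (@lebesgue_measure R).
Local Notation D := (half_line R).
Variables (b : R -> {measure set (measurableTypeR R) -> \bar R})
          (beta : R -> R -> R) (Bm BM gamma m M : R).
Hypothesis density : frag_density b beta.
Hypothesis Bm_gt0 : 0 < Bm.
Hypothesis BmM : Bm < BM.
Hypothesis gamma02 : 0 < gamma < 2.
Hypothesis bounds : forall x y, 0 < y < x ->
  2 * Bm * x `^ (gamma - 1) <= beta x y <= 2 * BM * x `^ (gamma - 1).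
Hypothesis m01 : 0 < m < 1.
Hypothesis M12 : 1 < M < 2.

Local Notation rate := (frag_rate b).
Local Notation gain := (kernel_op (frag_kernel beta)).
Local Notation nX := (nrm (wX m M)).

Let m1 : m < 1. Proof. by case/andP: m01. Qed.
Let M1 : 1 < M. Proof. by case/andP: M12. Qed.
Let gamma0 : 0 < gamma. Proof. by case/andP: gamma02. Qed.
Let pw0 := @pw_gt0 R.
Let mpw := @measurable_pw R.

Lemma Rintegral_lin (a : R) (F G : R -> R) :
  leb.-integrable D (EFin \o F) -> leb.-integrable D (EFin \o G) ->
  leb.-integrable D (EFin \o (fun x => a * F x + G x)) /\
  \int[leb]_(x in D) (a * F x + G x) =
    a * \int[leb]_(x in D) F x + \int[leb]_(x in D) G x.
Proof.
move=> IF IG.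
have IaF : leb.-integrable D (EFin \o (fun x => a * F x)).
  have : leb.-integrable D (fun x => a%:E * (EFin \o F) x)%E by exact: integrableZl.
  by apply: eq_integrable.
split.
  have : leb.-integrable D ((EFin \o (fun x => (a * F x)%R)) \+ (EFin \o G))%E.
    exact: integrableD.
  by apply: eq_integrable.
by rewrite -(RintegralZl)// RintegralD.
Qed.

Section Graph.
Variables (f h : R -> R).
Hypothesis Ih : inX m M h.
Hypothesis Tfh : T_graph b beta m M f h.

(** All terms of T f have finite moments of orders m and M, hence also of the
    intermediate order 1. *)
Lemma T_graph_pow : exists d, forall p, p \in [:: m; 1; M] ->
  [/\ inL (pw p) f, inL (pw p) (fun x => x * d x), inL (pw p) (gain f),
      inL (pw p) (fun x => rate x * f x) & inL (pw p) h] /\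
  weak_derivative f d /\
  eqX h (fun x => - (x * d x) - 2 * f x + gain f x - rate x * f x).
Proof.
have [If [d [fd Id Ig Ir hE]]] := Tfh.
have {}Ig : inX m M (gain f).
  by apply: eq_inX Ig => x x0; rewrite frag_gainE.
have all g p : p \in [:: m; 1; M] -> inX m M g -> inL (pw p) g.
  rewrite !inE => /or3P[]/eqP-> Ix; [by case/inX_pow: Ix|exact: (inX_mass m1 M1)|by case/inX_pow: Ix].
exists d => p pP; split; first by split; exact: all.
split => //; apply: ae_weaken hE => x hx x0.
by rewrite hx// frag_gainE.
Qed.

(** Transport and the term - 2 f cancel by mass_transport, gain and loss by
    mass_gain. *)
Lemma mass_generator : mass h = 0.
Proof.
have [d /(_ 1)] := T_graph_pow; rewrite !inE eqxx orbT => /(_ isT).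
move=> [[If Id Ig Ir I1h] [fd hE]].
have I2 := inLZ 2 If.
have E : eqX h (fun x => -1 * (x * d x) - 2 * f x + gain f x - rate x * f x).
  by apply: ae_weaken hE => x hx x0; rewrite hx// mulN1r.
have Id' := inLZ (-1) Id.
rewrite (mass_ae_eq I1h _ E); last by apply: inLB => //; apply: inLD => //; exact: inLB.
rewrite massB//; last by apply: inLD => //; exact: inLB.
rewrite massD//; last exact: inLB.
rewrite massB// !massZ// (mass_transport If Id fd).
rewrite (mass_gain density Bm_gt0 BmM bounds); first by ring.
exact: (inL_of_rate density Bm_gt0 BmM bounds Ir).
Qed.

End Graph.

(** The Doeblin estimate for the weight x plus eps times the Lyapunov estimate
    for W. The constants are those of harris_constants, for the interval [u,
    v] on which the Doeblin estimate is used; none of them depends on f. *)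
Lemma harris_dissipation : exists eps alpha c, [/\ 0 < eps, 0 < alpha, 0 < c &
  forall f h, inX m M h -> T_graph b beta m M f h ->
  forall e, 0 < e -> exists n0, forall n, (n0 <= n)%N ->
    let N := fun g => nrm (pw 1) g + eps * nX g in
    N (fun x => f x + step R n * h x) <=
      N f + step R n * (c * `|mass f| - alpha * N f + e)].
Proof.
pose C1 := 2 * BM; pose c2 := (1 - pw (M - 1) 2^-1) * Bm / 8.
have C10 : 0 < C1 by rewrite mulr_gt0// (lt_trans Bm_gt0).
have c20 : 0 < c2.
  rewrite !mulr_gt0 ?invr_gt0// subr_gt0.
  have p1 : (1 : R) `^ (M - 1) = 1 by rewrite powR1.
  rewrite -[X in _ < X]p1.
  have h : (2 : R)^-1 < 1 by rewrite invf_lt1// ltr1n.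
  rewrite /pw; apply: (@gt0_ltr_powR _ (M - 1) _ 2^-1 1 _ _ h); rewrite ?subr_gt0 ?nnegrE ?invr_ge0//.
have [u [v [/andP[u0 uv] hc]]] := harris_constants m1 M1 gamma0 C10 c20.
have [c c0 hD] := doeblin density Bm_gt0 BmM gamma02 bounds u0 uv.
have [eps [alpha [eps0 alpha0 hpt]]] := hc c c0.
exists eps, alpha, c; split => // f h Ih Tfh e e0.
have If : inX m M f by case: Tfh.
have [d hp] := T_graph_pow Ih Tfh.
(* The three Euler errors add up to e after multiplication by 1, eps and eps. *)
pose e' := e / (1 + 2 * eps).
have den0 : 0 < 1 + 2 * eps by rewrite addr_gt0// mulr_gt0.
have e'0 : 0 < e' by rewrite divr_gt0.
have r0 x : 0 < x -> 0 <= rate x by move=> x0; exact/ltW/(frag_rate_gt0 density Bm_gt0 BmM bounds).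
have mr : measurable_fun D rate := measurable_rate density Bm_gt0 BmM bounds.
have step_p p : p \in [:: m; 1; M] -> exists n0, forall n, (n0 <= n)%N ->
  nrm (pw p) (fun x => f x + step R n * h x) <= nrm (pw p) f +
    step R n * ((p - 1) * nrm (pw p) f + nrm (pw p) (gain f)
      - nrm (pw p) (fun x => rate x * f x) + e').
  move=> pP; have [[I1 I2 I3 I4 I5] [fd hE]] := hp p pP.
  apply: (euler_step_nrm _ I1 I2 I3 mr r0 I4 fd hE I5 e'0).
  by move: pP m01 M12; rewrite !inE => /or3P[]/eqP-> /andP[? ?] /andP[? ?]; apply/andP; split; lra.
have memm : m \in [:: m; 1; M] by rewrite !inE eqxx.
have mem1 : 1 \in [:: m; 1; M] by rewrite !inE eqxx orbT.
have memM : M \in [:: m; 1; M] by rewrite !inE eqxx !orbT.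
have [nm hm] := step_p _ memm; have [n1 h1] := step_p _ mem1; have [nM hM] := step_p _ memM.
exists (maxn nm (maxn n1 nM)) => n; rewrite !geq_max => /and3P[/hm {}hm /h1 {}h1 /hM {}hM] /=.
have s0 := step_gt0 R n.
have [[Im _ Igm Irm _] _] := hp _ memm.
have [[I1 _ _ Ir1 _] _] := hp _ mem1.
have [[IM _ _ IrM _] _] := hp _ memM.
have Hm := inL_of_rate density Bm_gt0 BmM bounds Irm.
have H1 := inL_of_rate density Bm_gt0 BmM bounds Ir1.
have HM := inL_of_rate density Bm_gt0 BmM bounds IrM.
have gm : nrm (pw m) (gain f) <= C1 * nrm (pw (gamma + m)) f.
  by apply: (gain_nrm density Bm_gt0 BmM bounds) => //; case/andP: m01 => /ltW.
have gM : nrm (pw M) (gain f) <= nrm (pw M) (fun x => rate x * f x) - c2 * nrm (pw (gamma + M)) f.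
  exact: (gain_nrm_gt1 density Bm_gt0 BmM bounds).
have g1 := hD f H1 I1.
have rm : 0 <= nrm (pw m) (fun x => rate x * f x) by exact: (nrm_ge0 (@pw0 m)).
set J := \int[leb]_(y in D) _ in g1.
have key : c * J + eps * ((m - 1) * nrm (pw m) f + C1 * nrm (pw (gamma + m)) f +
    (M - 1) * nrm (pw M) f - c2 * nrm (pw (gamma + M)) f) <=
    - alpha * (nrm (pw 1) f + eps * nX f).
  have Am := inL_int (@pw0 _) (@mpw _) Im; have AM := inL_int (@pw0 _) (@mpw _) IM.
  have A1 := inL_int (@pw0 _) (@mpw _) I1.
  have Bm' := inL_int (@pw0 _) (@mpw _) Hm; have BM' := inL_int (@pw0 _) (@mpw _) HM.
  have AJ : leb.-integrable D (EFin \o (fun y => (y - 2 * core u v y) * `|f y|)).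
    have mf := inL_measurable (@pw0 _) (@mpw _) I1.
    have A3 : leb.-integrable D (EFin \o (fun y => 3 * (pw 1 y * `|f y|))).
      have : leb.-integrable D (fun x => 3%:E * (EFin \o (fun y => (pw 1 y * `|f y|)%R)) x)%E.
        exact: integrableZl.
      by apply: eq_integrable.
    apply: le_integrable A3 => //.
      apply/measurable_EFinP/measurable_funM; last exact: measurableT_comp.
      apply: measurable_funB => //; apply: measurable_funM => //.
      by apply: measurable_funTS; exact: measurable_core.
    move=> y; rewrite half_lineE => y0 /=; rewrite lee_fin pw1//.
    rewrite normrM normr_id (ger0_norm (_ : 0 <= 3 * (y * `|f y|))).
      by rewrite mulrA ler_wpM2r// norm_minus_twice// core_itv.
    by rewrite !mulr_ge0// ltW.
  have I0 : leb.-integrable D (EFin \o (fun=> 0 : R)) by exact: integrable0.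
  have [L1 E1] := Rintegral_lin (- (eps * c2)) BM' I0.
  have [L2 E2] := Rintegral_lin (eps * (M - 1)) AM L1.
  have [L3 E3] := Rintegral_lin (eps * C1) Bm' L2.
  have [L4 E4] := Rintegral_lin (eps * (m - 1)) Am L3.
  have [L5 E5] := Rintegral_lin c AJ L4.
  have [K1 F1] := Rintegral_lin (- (alpha * eps)) AM I0.
  have [K2 F2] := Rintegral_lin (- (alpha * eps)) Am K1.
  have [K3 F3] := Rintegral_lin (- alpha) A1 K2.
  have Z : \int[leb]_(y in D) (0 : R) = 0 by rewrite /Rintegral integral0.
  rewrite (nrm_wX If).
  apply: (@le_trans _ _ (\int[leb]_(y in D) (c * ((y - 2 * core u v y) * `|f y|) +
     (eps * (m - 1) * (pw m y * `|f y|) + (eps * C1 * (pw (gamma + m) y * `|f y|) +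
     (eps * (M - 1) * (pw M y * `|f y|) + (- (eps * c2) * (pw (gamma + M) y * `|f y|) + 0))))))).
    by rewrite E5 E4 E3 E2 E1 Z; apply: eq_imp_le; rewrite -/J /nrm; ring.
  apply: (@le_trans _ _ (\int[leb]_(y in D) (- alpha * (pw 1 y * `|f y|) +
     (- (alpha * eps) * (pw m y * `|f y|) + (- (alpha * eps) * (pw M y * `|f y|) + 0))))).
    apply: le_Rintegral => // y; rewrite half_lineE => y0.
    exact: lyapunov_pointwise.
  by rewrite F3 F2 F1 Z; apply: eq_imp_le; rewrite /nrm; ring.
have Ifh : inX m M (fun x => f x + step R n * h x) by apply: inLD => //; exact: inLZ.
rewrite (nrm_wX Ifh).
rewrite (nrm_wX If) in key *.
have E : e = e' * (1 + 2 * eps) by rewrite /e' divfK// gt_eqF.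
rewrite E.
exact: (euler_combine (ltW s0) (ltW eps0) hm h1 hM gm gM g1 rm key).
Qed.

End Harris.

(** * Density of the domain of T *)

Section AverageDerivative.
Variable R : realType.
Local Notation leb := (@lebesgue_measure R).
Local Notation D := (half_line R).

Lemma compact_support_pow (z : R -> R) (a c p : R) : 0 < a < c -> 0 <= p ->
  continuous z -> (forall x, ~~ (a <= x <= c) -> z x = 0) ->
  exists2 C, 0 < C & forall x, 0 < x -> `|z x| <= C * pw p x.
Proof.
move=> /andP[a0 ac] p0 cz z0.
have cnz : {within `[a, c], continuous (fun x => `|z x|)}.
  by apply: continuous_subspaceT => x; apply: continuous_comp; [exact: cz|exact: norm_continuous].
have [t _ tM] := EVT_max (ltW ac) cnz.
have pa := pw_gt0 p a0.
exists ((`|z t| + 1) / pw p a); first by rewrite divr_gt0// ltr_wpDl.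
move=> x x0; have [xac|xac] := boolP (a <= x <= c); last first.
  by rewrite z0// normr0 mulr_ge0 ?powR_ge0// divr_ge0 ?addr_ge0 ?powR_ge0.
apply: (@le_trans _ _ (`|z t| + 1)).
  by rewrite (le_trans (tM x _))// ?lerDl// in_itv.
rewrite mulrAC ler_pdivlMr// ler_wpM2l ?addr_ge0//.
by apply: ge0_ler_powR; rewrite ?nnegrE ?(ltW a0) ?(ltW x0)//; case/andP: xac.
Qed.

Lemma derive1_out (z : R -> R) (a c : R) :
  (forall x, ~~ (a <= x <= c) -> z x = 0) ->
  forall x, ~~ (a <= x <= c) -> derive1 z x = 0.
Proof.
move=> z0 x xac; rewrite derive1E.
rewrite (@near_eq_derive _ _ _ z (cst 0) x 1) ?derive_cst//.
move: xac; rewrite negb_and -!ltNge => /orP[xa|cx].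
  apply: filterS (lt_nbhsl xa) => y ya; apply: z0.
  by rewrite negb_and -ltNge ya.
apply: filterS (lt_nbhsr cx) => y cy; apply: z0.
by rewrite negb_and -!ltNge cy orbT.
Qed.

Lemma integrable_mul_weight (w g z : R -> R) (C : R) :
  (forall x, 0 < x -> 0 < w x) -> measurable_fun D w ->
  inL w g -> measurable_fun D z -> (forall x, 0 < x -> `|z x| <= C * w x) ->
  leb.-integrable D (EFin \o (fun x => g x * z x)).
Proof.
move=> w0 mw Ig mz zC; have mg := inL_measurable w0 mw Ig.
have := inLZ C Ig; rewrite /inL; apply: le_integrable => //.
  by apply/measurable_EFinP/measurable_funM.
move=> x; rewrite half_lineE => x0 /=; rewrite lee_fin mulrCA mulrA !normrM mulrC.
rewrite ler_wpM2r// -normrM (le_trans (zC _ x0))// ler_norm//.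
Qed.

Lemma measurable_test (phi : R -> R) : test_function phi ->
  measurable_fun D phi /\ measurable_fun D (derive1 phi).
Proof.
move=> [dphi cphi _]; split; apply: measurable_funTS; apply: continuous_measurable_fun => // x.
by apply: differentiable_continuous; exact/derivable1_diffP.
Qed.

Lemma Rintegral_derive_test (phi : R -> R) (u v : R) : test_function phi -> u < v ->
  \int[leb]_(x in `[u, v[) derive1 phi x = phi v - phi u.
Proof.
move=> [dphi cphi _] uv.
have cont : continuous phi.
  by move=> x; apply: differentiable_continuous; exact/derivable1_diffP.
have Ic : leb.-integrable `[u, v] (EFin \o derive1 phi).
  apply: continuous_compact_integrable; first exact: segment_compact.
  exact: continuous_subspaceT.
rewrite Rintegral_itv_bndo_bndc; last first.
  by apply: integrableS Ic => //; apply: subset_itvl; rewrite bnd_simp.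
rewrite /Rintegral (@continuous_FTC2 _ (derive1 phi) phi u v)//.
  exact: continuous_subspaceT.
split; first by move=> x _; exact: dphi.
  by apply: cvg_at_right_filter; exact: cont.
by apply: cvg_at_left_filter; exact: cont.
Qed.

Section Derivative.
Variables (p s : R) (g : R -> R).
Hypothesis p04 : 0 <= p <= 4.
Hypothesis s01 : 0 < s < 1.
Hypothesis Ig : inL (pw p) g.

Let s0 : 0 < s. Proof. by case/andP: s01. Qed.
Let r0 : 0 < 1 - s. Proof. by case/andP: s01 => _; rewrite subr_gt0. Qed.
Let p0 : 0 <= p. Proof. by case/andP: p04. Qed.
Let mg : measurable_fun D g.
Proof. exact: (inL_measurable (@pw_gt0 R p) (@measurable_pw R p) Ig). Qed.

Let inner (phi : R -> R) y : test_function phi -> 0 < y ->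
  \int[leb]_(x in D) (derive1 phi x * (logav_kernel s x y * g y)) =
  g y * ((phi (y / (1 - s)) - phi y) / (s * y)).
Proof.
move=> tphi y0.
have yr : y < y / (1 - s).
  by rewrite ltr_pdivlMr// -[ltRHS]mulr1 ltr_pM2l// ltrBlDr ltrDl.
rewrite -(Rintegral_derive_test tphi yr).
have -> : \int[leb]_(x in D) (derive1 phi x * (logav_kernel s x y * g y)) =
    \int[leb]_(x in `[y, (y / (1 - s))[) (g y / (s * y) * derive1 phi x).
  rewrite Rintegral_mkcond [RHS]Rintegral_mkcond.
  apply: eq_Rintegral => x _; rewrite !patchE /logav_kernel.
  have -> : ((1 - s) * x < y) = (x < y / (1 - s)) by rewrite ltr_pdivlMr// mulrC.
  have [xD|xD] := boolP (x \in D); have [xI|xI] := boolP (x \in `[y, (y / (1 - s))[%classic) => //.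
  - move: xI; rewrite inE/= in_itv/= => /andP[yx xy].
    by rewrite xy yx/=; field; rewrite !gt_eqF.
  - move: xI; rewrite notin_setE/= in_itv/= => /negP; rewrite andbC => /negbTE ->.
    by rewrite mul0r mulr0.
  - exfalso; move: xD; rewrite notin_setE half_lineE; apply.
    by move: xI; rewrite inE/= in_itv/= => /andP[yx _]; exact: lt_le_trans yx.
rewrite RintegralZl//; first by field; rewrite !gt_eqF.
have [dphi cphi _] := tphi.
have Ic : leb.-integrable `[y, (y / (1 - s))] (EFin \o derive1 phi).
  apply: continuous_compact_integrable; first exact: segment_compact.
  exact: continuous_subspaceT.
by apply: integrableS Ic => //; apply: subset_itvl; rewrite bnd_simp.
Qed.

(** By Fubini the integral of the average against phi' is the integral over y
    of g(y)/(s y) times the increment of phi between y and y/(1 - s);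
    rescaling the first of the two resulting terms moves the dilation from phi
    to g. *)
Lemma weak_derivative_logav :
  weak_derivative (logav s g) (fun x => (g x - g ((1 - s) * x)) / (s * x)).
Proof.
move=> phi tphi; have [mphi mdphi] := measurable_test tphi.
have [dphi cphi [a [c [ac phi0]]]] := tphi.
have cont : continuous phi.
  by move=> x; apply: differentiable_continuous; exact/derivable1_diffP.
have [C C0 hC] := compact_support_pow ac p0 cphi (derive1_out phi0).
have p1 : 0 <= p + 1 by rewrite addr_ge0.
have [B B0 hB] := compact_support_pow ac p1 cont phi0.
have wC0 x : 0 < x -> 0 < C * pw p x by move=> x0; rewrite mulr_gt0 ?pw_gt0.
have mwC : measurable_fun D (fun x => C * pw p x).
  by apply: measurable_funM => //; exact: measurable_pw.
have IgC : inL (fun x => C * pw p x) g.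
  by have := inLZ C Ig; rewrite /inL; apply: eq_integrable => // x _; congr _%:E; ring.
have fub := logav_fubini wC0 mwC (dilation_weightZ (ltW C0) (dilation_weight_pow p04)) s01 mdphi hC IgC.
have -> : \int[leb]_(x in D) (logav s g x * derive1 phi x) =
    \int[leb]_(x in D) (derive1 phi x * logav s g x).
  by apply: eq_Rintegral => x _; rewrite mulrC.
rewrite fub.
have minv : measurable_fun D (fun x : R => x^-1).
  by apply: (@measurable_inv _ _ _ D (fun y => y)) => [y|]; [rewrite half_lineE | exact: measurable_id].
pose z1 (y : R) := phi ((1 - s)^-1 * y) / (s * y).
pose z2 (y : R) := phi y / (s * y).
have msy : measurable_fun D (fun y : R => (s * y)^-1).
  apply: (@eq_measurable_fun _ _ _ _ D (fun y : R => s^-1 * y^-1)).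
    by move=> y _; rewrite invfM.
  exact: measurable_funM.
have r1 : 0 < (1 - s)^-1 by rewrite invr_gt0.
have mz1 : measurable_fun D z1.
  apply: measurable_funM => //; apply: measurable_funTS; apply: continuous_measurable_fun => x.
  by apply: (continuous_comp (f := fun x => (1 - s)^-1 * x)); [apply: cvgM; [exact: cvg_cst|exact: cvg_id]|exact: cont].
have mz2 : measurable_fun D z2 by exact: measurable_funM.
have z2C y : 0 < y -> `|z2 y| <= B / s * pw p y.
  move=> y0; rewrite normrM normfV (gtr0_norm (mulr_gt0 s0 y0)) ler_pdivrMr ?mulr_gt0//.
  apply: le_trans (hB _ y0) _; rewrite pwD// pw1//; apply: eq_imp_le.
  by field; rewrite gt_eqF.
have z1C y : 0 < y -> `|z1 y| <= (B * pw (p + 1) (1 - s)^-1) / s * pw p y.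
  move=> y0; rewrite normrM normfV (gtr0_norm (mulr_gt0 s0 y0)) ler_pdivrMr ?mulr_gt0//.
  apply: le_trans (hB _ (mulr_gt0 r1 y0)) _.
  rewrite pwM// (pwD p 1 y0) pw1//; apply: eq_imp_le.
  by field; rewrite gt_eqF.
have I1 := integrable_mul_weight (@pw_gt0 R p) (@measurable_pw R p) Ig mz1 z1C.
have I2 := integrable_mul_weight (@pw_gt0 R p) (@measurable_pw R p) Ig mz2 z2C.
have -> : \int[leb]_(y in D) \int[leb]_(x in D) (derive1 phi x * (logav_kernel s x y * g y)) =
    \int[leb]_(y in D) (g y * z1 y) - \int[leb]_(y in D) (g y * z2 y).
  rewrite -RintegralB//; apply: eq_Rintegral => y /[!inE]; rewrite half_lineE => y0.
  by rewrite inner// /z1 /z2 -mulrBr -mulrBl [_^-1 * y]mulrC.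
(* The change of variables is mass_dilation; the division by y compensates
    for the weight of the mass. *)
pose psi (y : R) := g y * z1 y / y.
have Ipsi : inL (pw 1) psi.
  by apply: eq_integrable I1 => // y /[!inE]; rewrite half_lineE => y0; congr _%:E; rewrite pw1// /psi [RHS]mulrC divfK// gt_eqF.
have e1 : \int[leb]_(y in D) (g y * z1 y) = mass psi.
  by apply: eq_Rintegral => y /[!inE]; rewrite half_lineE => y0; rewrite /psi [RHS]mulrC divfK// gt_eqF.
have := mass_dilation r0 Ipsi => e2.
have Ipsid := inL_dilation r0 Ipsi.
have e3 : mass psi = \int[leb]_(x in D) (g ((1 - s) * x) * z2 x).
  have -> : mass psi = (1 - s) ^+ 2 * mass (fun x => psi ((1 - s) * x)).
    by rewrite e2 mulrA mulfV ?mul1r// expf_neq0// gt_eqF.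
  rewrite -massZ//; apply: eq_Rintegral => x /[!inE]; rewrite half_lineE => x0.
  rewrite /psi /z1 /z2 mulKf ?gt_eqF//.
  by field; rewrite !gt_eqF.
have I3 : leb.-integrable D (EFin \o (fun x => g ((1 - s) * x) * z2 x)).
  exact: (integrable_mul_weight (@pw_gt0 R p) (@measurable_pw R p) (inL_dilation r0 Ig) mz2 z2C).
have -> : \int[leb]_(x in D) ((g x - g ((1 - s) * x)) / (s * x) * phi x) =
    \int[leb]_(x in D) (g x * z2 x) - \int[leb]_(x in D) (g ((1 - s) * x) * z2 x).
  rewrite -RintegralB//; apply: eq_Rintegral => x _.
  by rewrite /z2; ring.
by rewrite e1 e3 opprB.
Qed.

End Derivative.
End AverageDerivative.

Section Density.
Variable R : realType.
Local Notation leb := (@lebesgue_measure R).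
Local Notation D := (half_line R).
Variables (b : R -> {measure set (measurableTypeR R) -> \bar R})
          (beta : R -> R -> R) (Bm BM gamma m M : R).
Hypothesis density : frag_density b beta.
Hypothesis Bm_gt0 : 0 < Bm.
Hypothesis BmM : Bm < BM.
Hypothesis gamma02 : 0 < gamma < 2.
Hypothesis bounds : forall x y, 0 < y < x ->
  2 * Bm * x `^ (gamma - 1) <= beta x y <= 2 * BM * x `^ (gamma - 1).
Hypothesis m01 : 0 < m < 1.
Hypothesis M12 : 1 < M < 2.

Local Notation nX := (nrm (wX m M)).

(** The average of g is weakly differentiable with x times its derivative
    equal to (g(x) - g((1 - s) x))/s, and averaging preserves moments, so all
    terms of T applied to it are under control as soon as g has enough
    moments. *)
Lemma T_graph_logav (g : R -> R) s : 0 < s < 1 ->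
  (forall q, m <= q <= 4 -> inL (pw q) g) ->
  exists2 h, inX m M h & T_graph b beta m M (logav s g) h.
Proof.
move=> s01 Ig; have /andP[m0 m1] := m01; have /andP[M1 M2] := M12.
have /andP[g0 g2] := gamma02; have /andP[s0 s1] := s01.
have r0 : 0 < 1 - s by rewrite subr_gt0.
have IA q : m <= q <= 4 -> inL (pw q) (logav s g).
  move=> hq; apply: (logav_inL (@pw_gt0 R q) (@measurable_pw R q) _ s01); last exact: Ig.
  by apply: dilation_weight_pow; case/andP: hq => h ->; rewrite (le_trans (ltW m0)).
have hm : m <= m <= 4 by apply/andP; split; lra.
have hM : m <= M <= 4 by apply/andP; split; lra.
have hgm : m <= gamma + m <= 4 by apply/andP; split; lra.
have hgM : m <= gamma + M <= 4 by apply/andP; split; lra.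
pose d x := (g x - g ((1 - s) * x)) / (s * x).
have Id : inX m M (fun x => x * d x).
  have dE q : m <= q <= 4 -> inL (pw q) (fun x => x * d x).
    move=> hq; apply: (@eq_inL _ _ (fun x => s^-1 * (g x - g ((1 - s) * x)))).
      by move=> x x0; rewrite /d; field; rewrite !gt_eqF.
    by apply: inLZ; apply: inLB; [exact: Ig|apply: inL_dilation => //; exact: Ig].
  by apply/inX_pow; split; exact: dE.
have IAX : inX m M (logav s g) by apply/inX_pow; split; exact: IA.
have IG : inX m M (frag_gain beta (logav s g)).
  apply: (@eq_inX _ _ _ (kernel_op (frag_kernel beta) (logav s g))) => [x x0|]; first by rewrite frag_gainE.
  have M0 : 0 <= M by lra.
  by apply/inX_pow; split; apply: (gain_inL density Bm_gt0 BmM bounds) => //; try exact: ltW; exact: IA.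
have IR : inX m M (fun x => frag_rate b x * logav s g x).
  by apply/inX_pow; split; apply: (inL_rate density Bm_gt0 BmM bounds); exact: IA.
exists (fun x => - (x * d x) - 2 * logav s g x + frag_gain beta (logav s g) x - frag_rate b x * logav s g x).
  by apply: inLB => //; apply: inLD => //; apply: inLB; [exact: inLN|exact: inLZ].
split=> //; exists d; split => //.
  apply: (@weak_derivative_logav _ m) => //; last exact: Ig.
  by apply/andP; split; lra.
exact: aeW.
Qed.

Lemma inL_truncation (f : R -> R) (J q : R) : 0 < J -> inL (pw m) f -> m <= q ->
  inL (pw q) (fun x => if x < J then f x else 0).
Proof.
move=> J0 If mq; have mf := inL_measurable (@pw_gt0 R m) (@measurable_pw R m) If.
have := inLZ (pw (q - m) J) If; rewrite /inL; apply: le_integrable => //.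
  apply/measurable_EFinP/measurable_funM; first exact: measurable_pw.
  apply: (@eq_measurable_fun _ _ _ _ D (fun x => f x * (if x < J then 1 else 0))).
    by move=> x _; case: ifPn => _; rewrite ?mulr1 ?mulr0.
  apply: measurable_funM => //; apply: measurable_funTS.
  apply: measurable_fun_ifT; [|exact: measurable_cst|exact: measurable_cst].
  by apply: measurable_fun_ltr; [exact: measurable_id|exact: measurable_cst].
move=> x; rewrite half_lineE => x0 /=; rewrite lee_fin mulrA !normrM.
case: ifPn => xJ; last by rewrite normr0 mulr0 !mulr_ge0.
rewrite ler_wpM2r// !ger0_norm ?powR_ge0//.
rewrite (_ : q = m + (q - m)); last by ring.
rewrite pwD// (_ : m + (q - m) - m = q - m); last by ring.
rewrite ler_wpM2l ?powR_ge0//.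
by apply: ge0_ler_powR; rewrite ?subr_ge0 ?nnegrE// ltW.
Qed.

(** Truncation at large sizes gives moments of every order, averaging then
    gives regularity. *)
Lemma domain_dense (f : R -> R) (e : R) : inX m M f -> 0 < e ->
  exists g h, [/\ inX m M h, T_graph b beta m M g h & nX (fun x => g x - f x) < e].
Proof.
move=> If e0; have /andP[m0 m1] := m01; have /andP[M1 M2] := M12.
have w0 := @wX_gt0 R m M; have mw := @measurable_wX R m M.
have [Im IM] := (inX_pow m M f).1 If.
have e2 : 0 < e / 2 by rewrite divr_gt0.
pose F (n : nat) x := if x < n.+1%:R then f x else 0.
have IF n q : m <= q -> inL (pw q) (F n) by move=> mq; exact: inL_truncation.
have IFX n : inX m M (F n) by apply/inX_pow; split; apply: IF => //; lra.
have [_ cF] : inX m M f /\ nX (fun x => F n x - f x) @[n --> \oo] --> (0 : R).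
  apply: (nrm_dominated w0 mw (g := fun x => `|f x|)).
  - exact: (inL_measurable w0 mw If).
  - by move=> n; exact: (inL_measurable w0 mw (IFX n)).
  - apply: aeW => x x0; apply: cvg_near_cst.
    exists (Num.truncn x) => // n /= hn; rewrite /F ifT//.
    by apply: lt_le_trans (truncnS_gt x) _; rewrite ler_nat ltnS.
  - exact: inL_abs.
  - by move=> n x _; rewrite /F; case: ifPn => // _; rewrite normr0.
move/cvgrPdist_lt/(_ _ e2) : cF => [j _ /(_ j (leqnn j))].
rewrite /= sub0r normrN => /(le_lt_trans (ler_norm _)) hj.
have dw : dilation_weight (wX m M).
  by apply: dilation_weightD; apply: dilation_weight_pow; apply/andP; split; lra.
have := logav_cvg w0 mw dw (IFX j) => /cvgrPdist_lt /(_ _ e2)[n _ /(_ n (leqnn n))].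
rewrite /= sub0r normrN => /(le_lt_trans (ler_norm _)) hn.
have [h Ih Th] : exists2 h, inX m M h & T_graph b beta m M (logav (step R n) (F j)) h.
  by apply: T_graph_logav; [exact: step_itv|move=> q /andP[mq _]; exact: IF].
exists (logav (step R n) (F j)), h; split => //.
have IA : inX m M (logav (step R n) (F j)) by case: Th.
have := nrmD w0 mw (inLB IA (IFX j)) (inLB (IFX j) If).
rewrite (@eq_nrm _ _ (fun x => _ + _) (fun x => logav (step R n) (F j) x - f x)).
  move=> h1; apply: le_lt_trans h1 _; lra.
by move=> x _; rewrite addrA subrK.
Qed.

End Density.

(** * Exponential decay *)

Section Decay.
Variable R : realType.
Local Notation leb := (@lebesgue_measure R).
Local Notation D := (half_line R).
Variables (b : R -> {measure set (measurableTypeR R) -> \bar R})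
          (beta : R -> R -> R) (Bm BM gamma m M : R).
Hypothesis density : frag_density b beta.
Hypothesis Bm_gt0 : 0 < Bm.
Hypothesis BmM : Bm < BM.
Hypothesis gamma02 : 0 < gamma < 2.
Hypothesis bounds : forall x y, 0 < y < x ->
  2 * Bm * x `^ (gamma - 1) <= beta x y <= 2 * BM * x `^ (gamma - 1).
Hypothesis m01 : 0 < m < 1.
Hypothesis M12 : 1 < M < 2.
Variable S : R -> (R -> R) -> R -> R.
Hypothesis ST : semigroup_of_T b beta m M S.

Local Notation nX := (nrm (wX m M)).
Let C0S : C0_semigroup m M S. Proof. by case: ST. Qed.
Let m1 : m < 1. Proof. by case/andP: m01. Qed.
Let M1 : 1 < M. Proof. by case/andP: M12. Qed.
Let w0 := @wX_gt0 R m M.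
Let mw := @measurable_wX R m M.

Lemma mass_lipschitz f g : inX m M f -> inX m M g ->
  `|mass f - mass g| <= nX (fun x => f x - g x).
Proof.
move=> If Ig; rewrite -massB; [|exact: (inX_mass m1 M1)|exact: (inX_mass m1 M1)].
apply: (le_trans (mass_le_nrm (inX_mass m1 M1 (inLB If Ig)))).
by apply: nrm_mass_le => //; exact: inLB.
Qed.

Lemma mass_euler f h s : inX m M h -> T_graph b beta m M f h ->
  mass (fun x => f x + s * h x) = mass f.
Proof.
move=> Ih Tfh; have If : inX m M f by case: Tfh.
have I1 := inX_mass m1 M1 If; have I2 := inX_mass m1 M1 Ih.
rewrite massD//; last exact: inLZ.
by rewrite massZ// (mass_generator density Bm_gt0 BmM bounds m01 M12 Ih Tfh) mulr0 addr0.
Qed.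

(** Decay of |mass (S t f) - mass f| at rate 0: Euler steps do not change the
    mass. *)
Lemma orbit_mass f h t : 0 <= t -> inX m M h -> T_graph b beta m M f h ->
  mass (S t f) = mass f.
Proof.
move=> t0 Ih Tfh; have If : inX m M f by case: Tfh.
have : `|mass (S t f) - mass f| <= expR (- (0 * t)) * `|mass f - mass f|.
  apply: (@orbit_decay _ _ _ _ _ _ ST (fun u => `|mass u - mass f|) 1 0 f h) => //.
  - move=> u v Iu Iv; rewrite mul1r; apply: le_trans (ler_dist_dist _ _) _.
    have -> : mass u - mass f - (mass v - mass f) = mass u - mass v by ring.
    exact: mass_lipschitz.
  - move=> r r0 e e0 eta eta0; exists (eta / 2).
      by rewrite divr_gt0//= ltr_pdivrMr// ltr_pMr// ltr1n.
    have Ihr := semigroup_inX C0S r0 Ih.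
    rewrite (mass_euler _ Ihr (orbit_graph ST r0 Ih Tfh)) mul0r subr0 mul1r lerDl.
    by rewrite mulr_ge0 ?ltW// divr_gt0.
by rewrite subrr normr0 mulr0 normr_le0 subr_eq0 => /eqP.
Qed.

(** Decay of the distance to g at rate 0: the Euler steps of a stationary
    solution are trivial. *)
Lemma orbit_stationary g t : 0 <= t -> T_graph b beta m M g (fun=> 0) ->
  nX (fun x => S t g x - g x) = 0.
Proof.
move=> t0 Tg; have Ig : inX m M g by case: Tg.
have I0 : inX m M (fun=> 0) by exact: inL0.
apply/le_anti/andP; split; last exact: (nrm_ge0 w0).
have : nX (fun x => S t g x - g x) <= expR (- (0 * t)) * nX (fun x => g x - g x).
  apply: (@orbit_decay _ _ _ _ _ _ ST (fun u => nX (fun x => u x - g x)) 1 0 g (fun=> 0)) => //.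
  - by move=> u _; exact: (nrm_ge0 w0).
  - move=> u v Iu Iv; rewrite mul1r.
    apply: le_trans (nrm_lipschitz w0 mw (inLB Iu Ig) (inLB Iv Ig)) _.
    apply: eq_imp_le; apply: eq_nrm => x _; ring.
  - move=> r r0 e e0 eta eta0; exists (eta / 2).
      by rewrite divr_gt0//= ltr_pdivrMr// ltr_pMr// ltr1n.
    have Ir := semigroup_inX C0S r0 Ig; have I0r := semigroup_inX C0S r0 I0.
    have z : nX (S r (fun=> 0)) = 0.
      have [K hK] := semigroup_bounded C0S r0; apply/le_anti/andP; split; last exact: (nrm_ge0 w0).
      by apply: le_trans (hK _ I0) _; rewrite nrm0 mulr0.
    have := nrmD w0 mw (inLB Ir Ig) (inLZ (eta / 2) I0r).
    rewrite (nrmZ w0 mw)// z mulr0 addr0 mul0r subr0 mul1r => h.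
    apply: (@le_trans _ _ (nX (fun x => S r g x - g x))); last first.
      by rewrite lerDl mulr_ge0 ?ltW// divr_gt0.
    apply: le_trans h; apply: eq_imp_le.
    by apply: eq_nrm => x _; ring.
rewrite (@eq_nrm _ _ (fun x => g x - g x) (fun=> 0)) ?nrm0 ?mulr0//.
by move=> x _; rewrite subrr.
Qed.

Section Harris.
Variables (eps alpha c : R).
Hypothesis eps0 : 0 < eps.
Hypothesis alpha0 : 0 < alpha.
Hypothesis c0 : 0 < c.

Let N f := nrm (pw 1) f + eps * nX f.

Hypothesis dissipation : forall f h, inX m M h -> T_graph b beta m M f h ->
  forall e, 0 < e -> exists n0, forall n, (n0 <= n)%N ->
      N (fun x => f x + step R n * h x) <=
      N f + step R n * (c * `|mass f| - alpha * N f + e).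

Let k := c / alpha.
Let k0 : 0 < k. Proof. exact: divr_gt0. Qed.
(** As the mass is conserved, N - k |mass f| decays at rate alpha although N
    alone need not; truncation at 0 makes the functional nonnegative. *)
Let Phi f := Num.max (N f - k * `|mass f|) 0.

Let N_ge0 f : 0 <= N f.
Proof.
apply: addr_ge0; first exact: (nrm_ge0 (@pw_gt0 R 1)).
by rewrite mulr_ge0 ?(ltW eps0)//; exact: (nrm_ge0 w0).
Qed.

Let N_le f : inX m M f -> N f <= (1 + eps) * nX f.
Proof. by move=> If; rewrite mulrDl mul1r lerD2r; exact: nrm_mass_le. Qed.

Let N_lipschitz f g : inX m M f -> inX m M g ->
  `|N f - N g| <= (1 + eps) * nX (fun x => f x - g x).
Proof.
move=> If Ig.
have h1 := nrm_lipschitz (@pw_gt0 R 1) (@measurable_pw R 1) (inX_mass m1 M1 If) (inX_mass m1 M1 Ig).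
have h2 := nrm_lipschitz w0 mw If Ig.
apply: le_trans (N_le (inLB If Ig)).
have -> : N f - N g = (nrm (pw 1) f - nrm (pw 1) g) + eps * (nX f - nX g) by rewrite /N; ring.
apply: le_trans (ler_normD _ _) _; rewrite lerD// normrM (gtr0_norm eps0).
by rewrite ler_wpM2l// ltW.
Qed.

Lemma harris_domain f h t : 0 <= t -> inX m M h -> T_graph b beta m M f h ->
  N (S t f) <= expR (- (alpha * t)) * N f + k * `|mass f|.
Proof.
move=> t0 Ih Tfh; have If : inX m M f by case: Tfh.
have PhiN u : Phi u <= N u.
  by rewrite /Phi ge_max N_ge0 andbT lerBlDr lerDl mulr_ge0// ltW.
have : Phi (S t f) <= expR (- (alpha * t)) * Phi f.
  apply: (@orbit_decay _ _ _ _ _ _ ST Phi (1 + eps + k) alpha f h) => //.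
  - exact: ltW.
  - by move=> u _; rewrite /Phi le_max lexx orbT.
  - move=> u v Iu Iv; apply: (@le_trans _ _ `|(N u - k * `|mass u|) - (N v - k * `|mass v|)|).
      rewrite /Phi; move: (N u - _) (N v - _) => x y.
      have [hx|hx] := leP x 0; have [hy|hy] := leP y 0; rewrite ?subrr ?normr0//.
      + rewrite sub0r normrN (gtr0_norm hy) distrC ger0_norm; lra.
      + rewrite subr0 (gtr0_norm hx) ger0_norm; lra.
    have -> : (N u - k * `|mass u|) - (N v - k * `|mass v|) =
       (N u - N v) - k * (`|mass u| - `|mass v|) by ring.
    apply: le_trans (ler_normB _ _) _; rewrite [leRHS]mulrDl lerD ?N_lipschitz//.
    rewrite normrM (gtr0_norm k0) ler_wpM2l ?(ltW k0)//.
    by apply: le_trans (ler_dist_dist _ _) _; exact: mass_lipschitz.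
  move=> r r0 e e0 eta eta0.
  have Ihr := semigroup_inX C0S r0 Ih; have Tr := orbit_graph ST r0 Ih Tfh.
  have [n0 hn0] := dissipation Ihr Tr e0.
  have [n1 hn1] := step_lt eta0.
  have ai0 : 0 < alpha^-1 by rewrite invr_gt0.
  have [n2 hn2] := step_lt ai0.
  pose n := maxn n0 (maxn n1 n2).
  have s0 := step_gt0 R n.
  exists (step R n); first by rewrite s0 hn1// /n !leq_max leqnn orbT.
  have as1 : alpha * step R n <= 1.
    by rewrite -ler_pdivlMl// mulr1 ltW// hn2// /n !leq_max leqnn !orbT.
  have := hn0 n; rewrite leq_max leqnn => /(_ isT).
  rewrite /Phi (mass_euler _ Ihr Tr).
  move: (N (fun x => _)) (N (S r f)) `|mass (S r f)| => A B mu hA.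
  have ck : c = k * alpha by rewrite /k divfK// gt_eqF.
  rewrite ck in hA.
  have e1 : 0 <= e * step R n by rewrite mulr_ge0// ltW.
  have a1 : 0 <= 1 - alpha * step R n by rewrite subr_ge0.
  have le1 : (1 - alpha * step R n) * (B - k * mu) <=
     (1 - alpha * step R n) * Num.max (B - k * mu) 0 by rewrite ler_wpM2l// le_max lexx.
  have le2 : 0 <= (1 - alpha * step R n) * Num.max (B - k * mu) 0.
    by rewrite mulr_ge0// le_max lexx orbT.
  rewrite ge_max addr_ge0// andbT; apply: le_trans (lerD le1 (lexx _)).
  by lra.
move=> h1; have : Phi (S t f) <= expR (- (alpha * t)) * N f.
  by apply: le_trans h1 _; rewrite ler_wpM2l// expR_ge0.
rewrite /Phi ge_max (orbit_mass t0 Ih Tfh) => /andP[+ _].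
by rewrite lerBlDr.
Qed.

Lemma harris_decay f t : 0 <= t -> inX m M f ->
  N (S t f) <= expR (- (alpha * t)) * N f + k * `|mass f|.
Proof.
move=> t0 If; have [K hK] := semigroup_bounded C0S t0.
have It := semigroup_inX C0S t0 If.
pose L := (1 + eps) * `|K| + (1 + eps) + k.
have L0 : 0 < L.
  by rewrite ltr_wpDl// addr_ge0// ?mulr_ge0// addr_ge0// ltW.
apply/ler_addgt0Pr => e e0.
have eL : 0 < e / L by exact: divr_gt0.
have [g [h [Ih Tg hg]]] := domain_dense density Bm_gt0 BmM gamma02 bounds m01 M12 If eL.
have Ig : inX m M g by case: Tg.
have Igt := semigroup_inX C0S t0 Ig.
have d1 := harris_domain t0 Ih Tg.
have d2 : N (S t f) - N (S t g) <= (1 + eps) * (`|K| * nX (fun x => g x - f x)).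
  apply: le_trans (ler_norm _) _; rewrite distrC.
  apply: le_trans (N_lipschitz Igt It) _; rewrite ler_wpM2l ?addr_ge0 ?(ltW eps0)//.
  apply: le_trans (semigroup_nXB C0S t0 hK Ig If) _.
  by rewrite ler_wpM2r ?ler_norm//; exact: (nrm_ge0 w0).
have d3 : N g - N f <= (1 + eps) * nX (fun x => g x - f x).
  exact: le_trans (ler_norm _) (N_lipschitz Ig If).
have d4 : `|mass g| - `|mass f| <= nX (fun x => g x - f x).
  by apply: le_trans (mass_lipschitz Ig If); exact: lerB_dist.
have E1 : expR (- (alpha * t)) <= 1 by rewrite -expR0 ler_expR oppr_le0 mulr_ge0// ltW.
have E0 := expR_gt0 (- (alpha * t)).
have del0 : 0 <= nX (fun x => g x - f x) by exact: (nrm_ge0 w0).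
have hL : L * nX (fun x => g x - f x) <= e.
  by rewrite mulrC -ler_pdivlMr// ltW.
move: (expR _) (nX (fun x => g x - f x)) (N (S t f)) (N (S t g)) (N f) (N g) `|mass g| `|mass f| E0 E1
  d1 d2 d3 d4 del0 hL => E del A A' B B' mu' mu E0 E1 d1 d2 d3 d4 del0 hL.
have h1 : E * (B' - B) <= (1 + eps) * del.
  apply: (@le_trans _ _ (E * ((1 + eps) * del))); first by rewrite ler_wpM2l// ltW.
  by rewrite ler_piMl// mulr_ge0// addr_ge0// ltW.
have h2 := ler_wpM2l (ltW k0) d4.
rewrite /L in hL; lra.
Qed.

(** The difference g - G has mass 0 and G is stationary, so harris_decay
    applies without its second term; N dominates eps times the norm of X and
    is at most (1 + eps) times it. *)
Lemma spectral_gap G g t : 0 <= t -> inX m M g -> mass g = 1 ->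
  self_similar_profile b beta m M G ->
  nX (fun x => S t g x - G x) <=
    (1 + eps) / eps * expR (- (alpha * t)) * nX (fun x => g x - G x).
Proof.
move=> t0 Ig g1 [TG G1]; have IG : inX m M G by case: TG.
pose f x := -1 * G x + g x.
have If : inX m M f by apply: inLD => //; exact: inLZ.
have IGt := semigroup_inX C0S t0 IG; have Igt := semigroup_inX C0S t0 Ig.
have mf : mass f = 0.
  rewrite massD; [|apply: inLZ; exact: (inX_mass m1 M1)|exact: (inX_mass m1 M1)].
  by rewrite massZ ?G1 ?g1 ?mulN1r ?addNr//; exact: (inX_mass m1 M1).
have fE : nX f = nX (fun x => g x - G x).
  by apply: eq_nrm => x _; rewrite /f; ring.
have := harris_decay t0 If; rewrite mf normr0 mulr0 addr0 => h1.
have h2 : eps * nX (S t f) <= N (S t f).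
  by rewrite /N lerDr; exact: (nrm_ge0 (@pw_gt0 R 1)).
have h3 : expR (- (alpha * t)) * N f <= expR (- (alpha * t)) * ((1 + eps) * nX f).
  by rewrite ler_wpM2l ?expR_ge0// N_le.
have h4 : nX (fun x => S t g x - G x) <= nX (S t f).
  rewrite (semigroup_lin_nX C0S (-1) t0 IG Ig).
  have := nrmD w0 mw (inLB Igt IGt) (inLB IGt IG).
  rewrite (orbit_stationary t0 TG) addr0.
  rewrite (@eq_nrm _ _ (fun x => _ + _) (fun x => S t g x - G x)); last by move=> x _; ring.
  move=> /le_trans; apply; apply: eq_imp_le.
  by apply: eq_nrm => x _; ring.
apply: (le_trans h4); rewrite -fE -(ler_pM2l eps0).
apply: (le_trans h2); apply: (le_trans h1); apply: (le_trans h3).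
apply: eq_imp_le.
by field; rewrite gt_eqF.
Qed.

End Harris.
End Decay.

Unset Implicit Arguments.

Theorem theorem5 (R : realType)
    (b : R -> {measure set (measurableTypeR R) -> \bar R})
    (beta : R -> R -> R)
    (hyp_i : frag_measure b)
    (hyp_ii : frag_number b)
    (hyp_iii_density : frag_density b beta)
    (hyp_iii : frag_bounds beta)
    (m : R) (hm : 2^-1 < m < 1) :
  exists M : R, 1 < M < 2 /\
  exists alpha C : R, [/\ 0 < alpha, 1 <= C &
    forall S : R -> (R -> R) -> R -> R, semigroup_of_T b beta m M S ->
    forall G : R -> R, self_similar_profile b beta m M G ->
    forall g_in : R -> R, inX m M g_in -> mass g_in = 1 ->
    forall t : R, 0 <= t ->
      (normX m M (fun x => (S t g_in x - G x)%R)
        <= (C * expR (- (alpha * t)))%:E * normX m M (fun x => (g_in x - G x)%R))%E].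
Proof.
have [Bm [BM [gamma [/andP[Bm0 BmM] gamma02 bounds]]]] := hyp_iii.
have m01 : 0 < m < 1.
  by case/andP: hm => h ->; rewrite andbT (lt_trans _ h)// invr_gt0.
pose M : R := 3 / 2.
have M12 : 1 < M < 2 by rewrite /M; apply/andP; split; lra.
exists M; split => //.
have [eps [alpha [c [eps0 alpha0 c0 hd]]]] :=
  harris_dissipation hyp_iii_density Bm0 BmM gamma02 bounds m01 M12.
exists alpha, ((1 + eps) / eps); split => //.
  by rewrite ler_pdivlMr// mul1r lerDr.
move=> S ST G profG g Ig g1 t t0.
have IG : inX m M G by case: profG => -[].
have C0S : C0_semigroup m M S by case: ST.
rewrite !normXE; [|exact: inLB|apply: inLB => //; exact: (semigroup_inX C0S)].
rewrite -EFinM lee_fin.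
exact: (spectral_gap hyp_iii_density Bm0 BmM gamma02 bounds m01 M12 ST eps0 alpha0 c0 hd t0 Ig g1 profG).
Qed.
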